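(* Let $A$ and $B$ be finite square matrices with entries in $\{0,1\}$, and assume that every row and every column of $A$ and $B$ is nonzero. The following conditions are equivalent. \begin{enumerate} \item $X_A$ and $X_B$ are continuously orbit equivalent. \item The groupoids $\mathcal{G}_{X_A}$ and $\mathcal{G}_{X_B}$ are isomorphic (as topological groupoids). \item There is a $*$-isomorphism $\Psi:\mathcal{O}_A\to\mathcal{O}_B$ such that $\Psi(\mathcal{D}_A)=\mathcal{D}_B$. \end{enumerate}
   Context: $\mathbb{N}_0$ is the set of non-negative integers. For an $N\times N$ matrix $A$ with entries in $\{0,1\}$ and every row and column nonzero: $X_A:=\{(x_i)_{i\in\mathbb{N}_0}\in\{1,\dots,N\}^{\mathbb{N}_0}:A(x_i,x_{i+1})=1\text{ for all }i\in\mathbb{N}_0\}$ with the product topology and the shift map $(\sigma_{X_A}(x))_j=x_{j+1}$; it is a one-sided shift of finite type. $\mathcal{O}_A$ is the Cuntz--Krieger algebra of $A$ (if $A$ does not satisfy Condition (I) of Cuntz and Krieger, $\mathcal{O}_A$ denotes the universal Cuntz--Krieger algebra of an Huef and Raeburn); thus in all cases it is the universal $C^*$-algebra generated by partial isometries $S_1,\dots,S_N$ with $\sum_{j=1}^NS_jS_j^*=1$ and $S_i^*S_i=\sum_{j=1}^NA(i,j)S_jS_j^*$ for $i=1,\dots,N$. $\mathcal{D}_A$ is its canonical abelian subalgebra, the $C^*$-subalgebra generated by the projections $S_{i_1}\cdots S_{i_n}S_{i_n}^*\cdots S_{i_1}^*$. One-sided shift spaces $X$ and $Y$ (with shift maps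 $\sigma_X,\sigma_Y$) are continuously orbit equivalent if there is a homeomorphism $h:X\to Y$ and continuous $k,l:X\to\mathbb{N}_0$, $k',l':Y\to\mathbb{N}_0$ with $\sigma_Y^{k(x)}(h(\sigma_X(x)))=\sigma_Y^{l(x)}(h(x))$ for all $x\in X$ and $\sigma_X^{k'(y)}(h^{-1}(\sigma_Y(y)))=\sigma_X^{l'(y)}(h^{-1}(y))$ for all $y\in Y$. For a one-sided shift of finite type $X$, $\mathcal{G}_X:=\{(x,n,x')\in X\times\mathbb{Z}\times X:\exists i,j\in\mathbb{N}_0,\ n=i-j,\ \sigma_X^i(x)=\sigma_X^j(x')\}$ with $r(x,n,x')=x$, $s(x,n,x')=x'$, $(x,n,x')(x',n',x'')=(x,n+n',x'')$, $(x,n,x')^{-1}=(x',-n,x)$. Its topology has as basis the sets $\{(x,i-j,x'):x\in U,\ x'\in U',\ \sigma_X^i(x)=\sigma_X^j(x')\}$ where $i,j\in\mathbb{N}_0$, $U,U'\subseteq X$ are open, $\sigma_X^i|_U$ and $\sigma_X^j|_{U'}$ are injective, and $\sigma_X^i(U)=\sigma_X^j(U')$. *)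

(* Defs.v *)
From HB Require Import structures.
From mathcomp Require Import all_boot all_order all_algebra.
From mathcomp Require Import complex zify.
From mathcomp Require Import all_classical all_reals all_analysis.

Set Implicit Arguments.
Unset Strict Implicit.
Unset Printing Implicit Defensive.

Import Order.TTheory GRing.Theory Num.Theory.

Local Open Scope classical_set_scope.
Local Open Scope ring_scope.

(* A 0-1 matrix is a boolean matrix; the alphabet {1, ..., N} is 'I_N. *)
Definition nonzero_rows_cols n (A : 'M[bool]_n) : Prop :=
  (forall i, exists j, A i j) /\ (forall j, exists i, A i j).

Definition sft_set n (A : 'M[bool]_n) :
    set (prod_topology (fun _ : nat => discrete_topology 'I_n)) :=
  [set x | forall i : nat, A (x i) (x i.+1)].

Definition sft n (A : 'M[bool]_n) : topologicalType := set_type (sft_set A).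

Lemma sft_shift_subproof n (A : 'M[bool]_n) (x : sft A) :
  (fun i => set_val x i.+1) \in sft_set A.
Proof. by apply/mem_set => i; have /set_mem := valP x; apply. Qed.

Definition sft_shift n (A : 'M[bool]_n) (x : sft A) : sft A :=
  exist _ (fun i => set_val x i.+1) (sft_shift_subproof x).

Definition homeomorphism (X Y : topologicalType) (f : X -> Y) (g : Y -> X) :=
  [/\ cancel f g, cancel g f, continuous f & continuous g].

Definition continuously_orbit_equivalent
    (X : topologicalType) (sX : X -> X) (Y : topologicalType) (sY : Y -> Y) :=
  exists (h : X -> Y) (hV : Y -> X), [/\ homeomorphism h hV,
    (exists k l : X -> nat, [/\ continuous k, continuous l &
       forall x, iter (k x) sY (h (sX x)) = iter (l x) sY (h x)]) &
    (exists k' l' : Y -> nat, [/\ continuous k', continuous l' &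
       forall y, iter (k' y) sX (hV (sY y)) = iter (l' y) sX (hV y)])].

Record sft_groupoid n (A : 'M[bool]_n) := SftGroupoid {
  grange : sft A;
  glag : int;
  gsource : sft A;
  glagP : exists i j : nat, glag = i%:Z - j%:Z /\
    iter i (@sft_shift n A) grange = iter j (@sft_shift n A) gsource }.

HB.instance Definition _ n (A : 'M[bool]_n) := gen_eqMixin (sft_groupoid A).
HB.instance Definition _ n (A : 'M[bool]_n) := gen_choiceMixin (sft_groupoid A).

Definition sft_bisection n (A : 'M[bool]_n) (i j : nat) (U U' : set (sft A)) :
    set (sft_groupoid A) :=
  [set g | [/\ glag g = i%:Z - j%:Z, U (grange g), U' (gsource g) &
    iter i (@sft_shift n A) (grange g) = iter j (@sft_shift n A) (gsource g)]].

Definition sft_groupoid_basis n (A : 'M[bool]_n) : set_system (sft_groupoid A) :=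
  [set B | exists (i j : nat) (U U' : set (sft A)),
    [/\ open U /\ open U',
        {in U &, injective (iter i (@sft_shift n A))},
        {in U' &, injective (iter j (@sft_shift n A))},
        iter i (@sft_shift n A) @` U = iter j (@sft_shift n A) @` U' &
        B = sft_bisection i j U U']].

Section sft_groupoid_topology.
Variables (n : nat) (A : 'M[bool]_n).
Local Notation X := (sft A).
Local Notation sigma := (@sft_shift n A).

Lemma sftP (x y : X) : (forall t, set_val x t = set_val y t) -> x = y.
Proof. by move=> xy; apply: val_inj; apply: funext. Qed.

Lemma iter_sft_shift k (x : X) t : set_val (iter k sigma x) t = set_val x (t + k)%N.
Proof. elim: k t => [|k IHk] t; first by rewrite addn0.
by rewrite iterS -addSnnS -IHk. Qed.

Lemma sft_adm (x : X) i : A (set_val x i) (set_val x i.+1).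
Proof. by have /set_mem := valP x; apply. Qed.

Definition sft_cylinder (x : X) (m : nat) : set X :=
  [set y | forall t, (t <= m)%N -> set_val y t = set_val x t].

Lemma open_sft_cylinder x m : open (sft_cylinder x m).
Proof.
have oc t : open [set y : X | set_val y t = set_val x t].
  have ct : continuous (fun y : X => set_val y t : discrete_topology 'I_n).
    move=> y; apply: (@continuous_comp X (prod_topology _)
      (discrete_topology 'I_n) set_val (fun f => f t)).
      exact: initial_continuous.
    exact: (@proj_continuous nat (fun=> discrete_topology 'I_n) t).
  have := @discrete_open (discrete_topology 'I_n) [set set_val x t].
  by move/continuousP: ct => /[apply].
elim: m => [|m IHm].
  rewrite (_ : sft_cylinder x 0 = [set y : X | set_val y 0%N = set_val x 0%N])//.
  apply/seteqP; split => y /= xy; first exact: xy.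
  by move=> t; rewrite leqn0 => /eqP->.
rewrite (_ : sft_cylinder x m.+1 = sft_cylinder x m `&`
  [set y : X | set_val y m.+1 = set_val x m.+1]); first exact: openI.
apply/seteqP; split => y /=.
  by move=> xy; split=> [t tm|]; apply: xy => //; exact: leqW.
by move=> [xy xym] t; rewrite leq_eqVlt => /predU1P[->//|]; exact: xy.
Qed.

Lemma sft_cylinder_base (x : X) (U : set X) : open U -> U x ->
  exists m0, forall m, (m0 <= m)%N -> sft_cylinder x m `<=` U.
Proof.
move=> oU Ux; pose F := filter_from setT (sft_cylinder x).
have FF : Filter F.
  apply: filter_from_filter; first by exists 0%N.
  move=> i j _ _; exists (maxn i j) => // y xy; split=> t ti; apply: xy;
    by rewrite leq_max ti ?orbT.
have Fx : F --> x.
  move=> V; rewrite nbhsE => -[W [[W' oW' <-] W'x] sWV].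
  apply: filterS sWV _; rewrite nbhs_filterE.
  suff : (set_val @ F) --> (set_val x : prod_topology _).
    by apply; apply: open_nbhs_nbhs; split.
  apply/cvg_sup => t P; rewrite nbhsE => -[Q [[Q' _ <-] Q'x] sQP].
  exists t => // y /(_ t (leqnn t)) xy; apply: sQP.
  by rewrite /= xy.
have [m0 _ sU] : F U by apply: Fx; exact: open_nbhs_nbhs.
exists m0 => m m0m y xy; apply: sU => t tm; apply: xy; exact: leq_trans m0m.
Qed.

Lemma injective_sft_cylinder x i m : (i <= m)%N ->
  {in sft_cylinder x m &, injective (iter i sigma)}.
Proof.
move=> im y z /set_mem xy /set_mem xz yz; apply: sftP => t.
have [tm|mt] := leqP t m; first by rewrite xy// xz.
have it : (i <= t)%N by apply: leq_trans im (ltnW _).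
by rewrite -(subnK it) -!iter_sft_shift yz.
Qed.

Lemma image_sft_cylinder (x x' : X) i j q : iter i sigma x = iter j sigma x' ->
  iter i sigma @` sft_cylinder x (i + q) `<=`
  iter j sigma @` sft_cylinder x' (j + q).
Proof.
move=> xx' _ [y xy <-].
have E t : set_val x (t + i)%N = set_val x' (t + j)%N.
  by rewrite -!iter_sft_shift xx'.
pose f t := if (t <= j)%N then set_val x' t else set_val y (t - j + i)%N.
have fE t : (j <= t)%N -> f t = set_val y (t - j + i)%N.
  rewrite /f => jt; case: ifP => // tj.
  have -> : t = j by apply/eqP; rewrite eqn_leq tj.
  by rewrite subnn xy ?leq_addr// add0n -[X in _ = _ X]add0n -E.
have fA : f \in sft_set A.
  apply/mem_set => t; have [jt|tj] := leqP j t.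
    by rewrite !fE ?leqW// subSn// addSn; exact: sft_adm.
  by rewrite /f (ltnW tj) tj; exact: sft_adm.
pose z : X := exist _ f fA.
have zE t : set_val z t = f t by [].
clearbody z; exists z.
  move=> t tm; rewrite zE; have [tj|/ltnW jt] := leqP t j; first by rewrite /f tj.
  by rewrite fE// xy ?E ?subnK//; lia.
apply: sftP => t; rewrite !iter_sft_shift zE fE ?leq_addl//.
by rewrite addnK.
Qed.

Lemma sft_groupoid_cyl (g : sft_groupoid A) i j q :
    glag g = i%:Z - j%:Z ->
    iter i sigma (grange g) = iter j sigma (gsource g) ->
  let B := sft_bisection i j (sft_cylinder (grange g) (i + q))
                             (sft_cylinder (gsource g) (j + q)) in
  sft_groupoid_basis B /\ B g.
Proof.
move=> gl gij B; split; last by split.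
exists i, j, (sft_cylinder (grange g) (i + q)),
  (sft_cylinder (gsource g) (j + q)); split => //.
- by split; exact: open_sft_cylinder.
- exact/injective_sft_cylinder/leq_addr.
- exact/injective_sft_cylinder/leq_addr.
- by apply/seteqP; split; exact: image_sft_cylinder.
Qed.

Lemma sft_groupoid_basis_cover :
  \bigcup_(B in @sft_groupoid_basis n A) B = setT.
Proof.
apply/seteqP; split => // g _; have [i [j [gl gij]]] := glagP g.
by have [bB Bg] := @sft_groupoid_cyl g i j 0 gl gij; eexists; [exact: bB|].
Qed.

Lemma sft_groupoid_basis_join (B C : set (sft_groupoid A)) g :
    sft_groupoid_basis B -> sft_groupoid_basis C -> B g -> C g ->
  exists D, [/\ sft_groupoid_basis D, D g & D `<=` B `&` C].
Proof.
move=> [i [j [U [U' [[oU oU'] iU iU' UU' ->]]]]].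
move=> [k [l [W [W' [[oW oW'] iW iW' WW' ->]]]]].
wlog : i j k l U U' W W' oU oU' iU iU' UU' oW oW' iW iW' WW' / (i <= k)%N.
  move=> wl; have [|/ltnW] := leqP i k; first exact: wl.
  move=> ki gB gC; have [D [bD Dg DB]] :=
    wl k l i j W W' U U' oW oW' iW iW' WW' oU oU' iU iU' UU' ki gC gB.
  by exists D; split => //; rewrite setIC.
move=> ik [gl Ug U'g gij] [gl' Wg W'g gkl].
have [a Ha] := sft_cylinder_base (openI oU oW) (conj Ug Wg).
have [b Hb] := sft_cylinder_base (openI oU' oW') (conj U'g W'g).
have [bD Dg] := @sft_groupoid_cyl g i j (maxn a b) gl gij.
eexists; split; [exact: bD|exact: Dg|].
move=> h [hl hr hs hij].
have [Ur Wr] : (U `&` W) (grange h).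
  by apply: Ha hr; exact: leq_trans (leq_maxl a b) (leq_addl _ _).
have [Us Ws] : (U' `&` W') (gsource h).
  by apply: Hb hs; exact: leq_trans (leq_maxr a b) (leq_addl _ _).
have [kE lE] : k = (k - i + i)%N /\ l = (k - i + j)%N.
  by have : i%:Z - j%:Z = k%:Z - l%:Z; [rewrite -gl -gl' | split; lia].
split; split => //; first by rewrite hl -gl.
by rewrite kE lE !iterD hij.
Qed.

End sft_groupoid_topology.

HB.instance Definition _ n (A : 'M[bool]_n) :=
  @isBaseTopological.Build (sft_groupoid A) (set (sft_groupoid A))
    (@sft_groupoid_basis n A) id
    (@sft_groupoid_basis_cover n A) (@sft_groupoid_basis_join n A).

Definition composable n (A : 'M[bool]_n) (g h : sft_groupoid A) : Prop :=
  gsource g = grange h.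

Lemma gmul_subproof n (A : 'M[bool]_n) (g h : sft_groupoid A) :
  composable g h -> exists i j : nat, glag g + glag h = i%:Z - j%:Z /\
    iter i (@sft_shift n A) (grange g) = iter j (@sft_shift n A) (gsource h).
Proof.
rewrite /composable => gh; have [i [j [gl gij]]] := glagP g.
have [k [l [hl hkl]]] := glagP h.
exists (i + k)%N, (j + l)%N; split; first by rewrite gl hl; lia.
by rewrite addnC iterD gij gh -iterD addnC iterD hkl -iterD.
Qed.

Definition gmul n (A : 'M[bool]_n) (g h : sft_groupoid A)
  (gh : composable g h) : sft_groupoid A := SftGroupoid (gmul_subproof gh).

Lemma ginv_subproof n (A : 'M[bool]_n) (g : sft_groupoid A) :
  exists i j : nat, - glag g = i%:Z - j%:Z /\
    iter i (@sft_shift n A) (gsource g) = iter j (@sft_shift n A) (grange g).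
Proof.
have [i [j [gl gij]]] := glagP g; exists j, i; split; last exact: esym.
by rewrite gl opprB.
Qed.

Definition ginv n (A : 'M[bool]_n) (g : sft_groupoid A) : sft_groupoid A :=
  SftGroupoid (ginv_subproof g).

Definition groupoid_morphism n (A : 'M[bool]_n) m (B : 'M[bool]_m)
    (f : sft_groupoid A -> sft_groupoid B) : Prop :=
  (forall g h (gh : composable g h),
     exists fgh : composable (f g) (f h), f (gmul gh) = gmul fgh) /\
  (forall g, f (ginv g) = ginv (f g)).

Definition isomorphic_groupoids n (A : 'M[bool]_n) m (B : 'M[bool]_m) : Prop :=
  exists (f : sft_groupoid A -> sft_groupoid B)
         (fV : sft_groupoid B -> sft_groupoid A),
    [/\ homeomorphism f fV, groupoid_morphism f & groupoid_morphism fV].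

(* Unital complex C*-algebras.  The norm is a field of the structure because
   there is no structure joining the normed modules with the rings other than
   the ordered ones.  The structure [algType] excludes the zero algebra. *)
HB.mixin Record isCStarAlgebra (R : realType) V of GRing.Algebra R[i] V := {
  star : V -> V;
  cnorm : V -> R;
  starK : involutive star;
  starD : {morph star : x y / x + y};
  starZ : forall (a : R[i]) x, star (a *: x) = (a^*)%C *: star x;
  starM : forall x y, star (x * y) = star y * star x;
  cnormD : forall x y, cnorm (x + y) <= cnorm x + cnorm y;
  cnormZ : forall (a : R[i]) x, cnorm (a *: x) = complex.Re `|a| * cnorm x;
  cnorm0_eq0 : forall x, cnorm x = 0 -> x = 0;
  cnormM : forall x y, cnorm (x * y) <= cnorm x * cnorm y;
  cnorm_starM : forall x, cnorm (star x * x) = cnorm x ^+ 2;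
  cnorm_complete : forall u : nat -> V,
    (forall e : R, 0 < e -> exists N, forall p q, (N <= p)%N -> (N <= q)%N ->
       cnorm (u p - u q) < e) ->
    exists l, forall e : R, 0 < e -> exists N, forall p, (N <= p)%N ->
       cnorm (u p - l) < e }.

#[short(type="cstarAlgType")]
HB.structure Definition CStarAlgebra (R : realType) :=
  {V of GRing.Algebra R[i] V & isCStarAlgebra R V}.

Definition star_preserving (R : realType) (V W : cstarAlgType R) (f : V -> W) :=
  forall x, f (star x) = star (f x).

(* C*-subalgebras are norm-closed *-subalgebras, not necessarily unital. *)
Definition cstar_subalgebra (R : realType) (V : cstarAlgType R) (B : set V) :=
  [/\ B 0 /\ (forall x y, B x -> B y -> B (x + y)),
      forall (a : R[i]) x, B x -> B (a *: x),
      forall x y, B x -> B y -> B (x * y),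
      forall x, B x -> B (star x) &
      forall x, (forall e : R, 0 < e -> exists2 b, B b & cnorm (x - b) < e) ->
        B x].

Definition cstar_generated (R : realType) (V : cstarAlgType R) (G : set V) :
  set V := smallest (@cstar_subalgebra R V) G.

Definition partial_isometry (R : realType) (V : cstarAlgType R) (s : V) :=
  s * star s * s = s.

Definition cuntz_krieger_family (R : realType) n (A : 'M[bool]_n)
    (V : cstarAlgType R) (S : 'I_n -> V) : Prop :=
  [/\ forall i, partial_isometry (S i),
      \sum_j S j * star (S j) = 1 &
      forall i, star (S i) * S i =
        \sum_j (A i j)%:R *: (S j * star (S j))].

(* O_A is only determined up to isomorphism: this predicate says that [V] with
   the generators [S] is a model of it.  The morphisms are unital, as they must
   be because 1 is a polynomial in the generators. *)
Definition cuntz_krieger_algebra (R : realType) n (A : 'M[bool]_n)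
    (V : cstarAlgType R) (S : 'I_n -> V) : Prop :=
  [/\ cuntz_krieger_family A S,
      cstar_generated (range S) = [set: V] &
      forall (W : cstarAlgType R) (T : 'I_n -> W), cuntz_krieger_family A T ->
        exists2 f : {lrmorphism V -> W},
          star_preserving f & forall i, f (S i) = T i].

(* D_A; the empty word gives 1, which is already the sum of the S_j S_j^*. *)
Definition cuntz_krieger_diagonal (R : realType) n (V : cstarAlgType R)
    (S : 'I_n -> V) : set V :=
  cstar_generated [set x | exists w : seq 'I_n,
    x = (\prod_(i <- w) S i) * star (\prod_(i <- w) S i)].

Definition diagonal_preserving_isomorphic (R : realType)
    n (V : cstarAlgType R) (S : 'I_n -> V)
    m (W : cstarAlgType R) (T : 'I_m -> W) : Prop :=
  exists Psi : {lrmorphism V -> W}, [/\ bijective Psi, star_preserving Psi &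
    Psi @` cuntz_krieger_diagonal S = cuntz_krieger_diagonal T].

(* Main.v *)
Require Import Defs.
From HB Require Import structures.
From mathcomp Require Import all_boot all_order all_algebra.
From mathcomp Require Import complex zify ring lra.
From mathcomp Require Import all_classical all_reals all_analysis.

Set Implicit Arguments.
Unset Strict Implicit.
Unset Printing Implicit Defensive.

Import Order.TTheory GRing.Theory Num.Theory numFieldNormedType.Exports.

Local Open Scope classical_set_scope.
Local Open Scope ring_scope.

(** Notation: [X] and [Y] are the shift spaces of [A] and [B], with shift maps
    [sh].  A point of the groupoid, called an arrow, goes from [gsource] to
    [grange] and has an integer lag.

    Orbit equivalence and isomorphic groupoids.  An isomorphism [f] maps units to
    units, which gives a homeomorphism [unit_map f]; it maps the arrow from [sh x]
    to [x] to an arrow whose merging times are locally constant in [x], and these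
    make an orbit equivalence ([orbit_equivalent_of_isomorphic]).  Conversely, the
    difference [c] of the two functions of an orbit equivalence [h] sums along
    orbits to a cocycle on the groupoid, and [(x, d, y)] is sent to
    [(h x, c (x, d, y), h y)] ([arrow_map]).  The corresponding map for the inverse
    of [h] is inverse to it at all arrows whose ends are not isolated, because a
    continuous map of arrows that fixes the ends cannot change the lag there
    ([lag_rigid]).  Isolated points are eventually periodic, and at them the map may
    fail to be bijective on isotropy groups; changing [c] at one point of each
    isolated orbit makes it so ([corrected]).

    From groupoids to algebras.  An element [v] stands for a set [U] of arrows if,
    on the cylinders of some level, [v] replaces prefixes in the way in which [U]
    does ([represents]).  Such an element is unique, and products, adjoints and
    disjoint sums of elements correspond to those of sets of arrows.  The image under
    [f] of the bisection of a generator is again of this local form, so it has an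
    element; these elements satisfy the Cuntz-Krieger relations, and the universal
    property gives a morphism.  The morphism coming from the inverse of [f] is its
    inverse, and both preserve the diagonals, which contain the elements of sets of
    units ([diagonal_isomorphic_of_isomorphic]).

    From algebras to orbit equivalence.  A representation on the square summable
    functions on [X] shows that the projections of cylinders do not vanish
    ([universal_Qx_neq0]), so that the characters of the diagonals are the points
    of the shift spaces and an isomorphism [psi] preserving diagonals induces a
    homeomorphism [h] ([state_map_exists]).  To find the lags near [x], approximate
    [psi (S i)], where [i] is the first letter of [x], by a linear combination of
    elements of bisections.  Cut down to small cylinders at [h x'] and [h (sh x')],
    for [x'] near [x], it keeps norm close to one ([image_generator_corner]), so
    one of its terms merges these two points.  The lags that occur near [x] all
    occur at [x]; those which occur at some nearby [x'] other than [x] have a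
    coefficient of modulus close to one, and averaging over the gauge action bounds
    the sum of the squares of the moduli of the coefficients of different lags by
    the square of the norm ([coefficient_bound]).  Hence there is only one such
    lag, and it is constant near [x] ([local_cocycle]).

    Elementary facts on C*-algebras are derived from the square roots of positive
    elements of the form [1 - x] ([corner_sqrt]): morphisms are contractive
    ([star_morphism_contractive]), and projections with sum one are orthogonal
    ([projections_orthogonal]). *)

(** * Points of a one-sided shift of finite type *)

Section Points.
Variables (n : nat) (A : 'M[bool]_n).
Local Notation X := (sft A).
Local Notation sh := (@sft_shift n A).

Definition letter (x : X) (t : nat) : 'I_n := set_val x t.

Definition agree N (x y : X) := forall t, (t < N)%N -> letter x t = letter y t.

Lemma letter_iter k (x : X) t : letter (iter k sh x) t = letter x (t + k)%N.
Proof. exact: iter_sft_shift. Qed.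

Lemma letter_shift (x : X) t : letter (sh x) t = letter x t.+1.
Proof. by []. Qed.

Lemma letterP (x y : X) : letter x =1 letter y -> x = y.
Proof. exact: sftP. Qed.

Lemma letter_adm (x : X) t : A (letter x t) (letter x t.+1).
Proof. exact: sft_adm. Qed.

Lemma agree_refl N x : agree N x x. Proof. by []. Qed.

Lemma agree_sym N x y : agree N x y -> agree N y x.
Proof. by move=> xy t tN; rewrite xy. Qed.

Lemma agree_trans N y x z : agree N x y -> agree N y z -> agree N x z.
Proof. by move=> xy yz t tN; rewrite xy// yz. Qed.

Lemma agree_le M N x y : (N <= M)%N -> agree M x y -> agree N x y.
Proof. by move=> NM xy t tN; apply: xy; exact: leq_trans NM. Qed.

Lemma agree_iter N k x y : agree (N + k) x y -> agree N (iter k sh x) (iter k sh y).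
Proof. by move=> xy t tN; rewrite !letter_iter xy// ltn_add2r. Qed.

Lemma agree_shift N x y : agree N.+1 x y -> agree N (sh x) (sh y).
Proof. by move=> xy t tN; rewrite !letter_shift xy. Qed.

Lemma agree_glue N k x y :
  agree k x y -> agree N (iter k sh x) (iter k sh y) -> agree (N + k) x y.
Proof.
move=> xy xyk t tNk; have [/xy//|kt] := ltnP t k.
have := xyk (t - k)%N; rewrite !letter_iter subnK//; apply; lia.
Qed.

Lemma eq_glue k x y : agree k x y -> iter k sh x = iter k sh y -> x = y.
Proof.
move=> xy xyk; apply: letterP => t; apply: (@agree_glue t.+1 k) => //.
  by rewrite xyk.
by rewrite ltn_addr.
Qed.

Lemma point_exists (f : nat -> 'I_n) :
  (forall t, A (f t) (f t.+1)) -> exists x : X, letter x =1 f.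
Proof. by move=> fA; exists (exist _ f (mem_set fA)). Qed.

Lemma splice k x y : letter x k = letter y 0 ->
  exists z, agree k x z /\ iter k sh z = y.
Proof.
move=> xy; pose f t := if (t < k)%N then letter x t else letter y (t - k).
have fA t : A (f t) (f t.+1).
  rewrite /f; have [tk|kt] := ltnP t k; have [tk'|kt'] := ltnP t.+1 k; try lia.
  - exact: letter_adm.
  - have -> : k = t.+1 by lia.
    rewrite subnn; have -> : letter y 0 = letter x t.+1 by rewrite -xy; congr letter; lia.
    exact: letter_adm.
  - by rewrite subSn//; exact: letter_adm.
have [z zE] := point_exists fA; exists z; split.
  by move=> t tk; rewrite zE /f tk.
by apply: letterP => t; rewrite letter_iter zE /f ltnNge leq_addl addnK.
Qed.

(** Beyond the first [j] letters, each letter is the one [j - i] places before it. *)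
Lemma eventually_periodic_unique i j x y : (i < j)%N ->
  iter i sh x = iter j sh x -> iter i sh y = iter j sh y ->
  agree j x y -> x = y.
Proof.
move=> ij xij yij xy; apply: letterP => t.
elim/ltn_ind: t => t IH; have [/xy//|jt] := ltnP t j.
have E (z : X) : iter i sh z = iter j sh z -> letter z t = letter z (t - j + i)%N.
  by move=> zij; rewrite -letter_iter zij letter_iter subnK.
by rewrite (E x)// (E y)// IH//; lia.
Qed.

Lemma agree_cylinder N x : [set y | agree N.+1 x y] = sft_cylinder x N.
Proof. by apply/seteqP; split => y /= xy t tN; apply/esym; exact: xy. Qed.

Lemma open_agree N x : open [set y | agree N x y].
Proof.
case: N => [|N]; last by rewrite agree_cylinder; exact: open_sft_cylinder.
rewrite (_ : [set y | _] = setT); first exact: openT.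
by apply/seteqP; split.
Qed.

Lemma openP_agree (U : set X) :
  open U <-> forall x, U x -> exists N, forall y, agree N x y -> U y.
Proof.
split=> [oU x Ux|UP].
  have [m mU] := sft_cylinder_base oU Ux; exists m.+1 => y xy.
  by apply: (mU m) => //; rewrite -agree_cylinder.
rewrite openE => x /UP[N NU]; rewrite /interior nbhsE/=.
by exists [set y | agree N x y]; [split; [exact: open_agree|]|].
Qed.

Lemma nbhs_agree N x : nbhs x [set y | agree N x y].
Proof. by apply: open_nbhs_nbhs; split; [exact: open_agree|]. Qed.

Lemma nbhsP_agree x (U : set X) :
  nbhs x U <-> exists N, forall y, agree N x y -> U y.
Proof.
split=> [|[N NU]]; last by apply: filterS (nbhs_agree N x).
rewrite nbhsE => -[V [oV Vx] VU]; have /openP_agree/(_ _ Vx)[N NV] := oV.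
by exists N => y /NV/VU.
Qed.

Lemma continuous_natP (k : X -> nat) :
  continuous k <-> forall x, exists M, forall y, agree M x y -> k y = k x.
Proof.
split=> [ck x|kP x U /nbhs_singleton Ux].
  have : nbhs x (k @^-1` [set k x]) by apply: ck; exact: discrete_set1.
  by move/nbhsP_agree.
by apply/nbhsP_agree; have [M MP] := kP x; exists M => y /MP /= ->.
Qed.

(** Compactness of the space of points, in the form of a uniform bound for
    hereditary properties of cylinders: were there no bound, one could extend
    letter by letter a word all of whose levels fail, and the limit point would
    contradict the pointwise bound. *)
Lemma uniform_level (P : X -> nat -> Prop) :
  (forall x N M, (N <= M)%N -> P x N -> P x M) ->
  (forall x y N, agree N x y -> P x N -> P y N) ->
  (forall x, exists N, P x N) -> exists N, forall x, P x N.
Proof.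
move=> Pmono Pagree Pex; apply: contrapT => noN.
(* the cylinder of level [N] at [x] has no uniform level *)
pose Bad x N := forall M, exists y, agree N x y /\ ~ P y M.
have step x N : exists y, Bad x N -> agree N x y /\ Bad y N.+1.
  have [bx|nb] := pselect (Bad x N); last by exists x.
  apply: contrapT => noy.
  have MP (j : 'I_n) : exists M, forall z, agree N x z -> letter z N = j -> P z M.
    apply: contrapT => noM; apply: noy.
    have [y [xy yj]] : exists y, agree N x y /\ letter y N = j.
      apply: contrapT => noy; apply: noM; exists 0%N => z xz zj.
      by exfalso; apply: noy; exists z.
    exists y => _; split => // M; apply: contrapT => noz; apply: noM.
    exists M => z xz zj; apply: contrapT => nPz; apply: noz; exists z; split => //.
    move=> t; rewrite ltnS leq_eqVlt => /predU1P[->|tN]; first by rewrite yj zj.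
    by rewrite -xy// xz.
  have [f fP] := choice MP.
  have [y [xy nPy]] := bx (\max_j f j); apply: nPy.
  by apply: Pmono (fP (letter y N) y xy erefl); exact: leq_bigmax.
have [x0 Bx0] : exists x0, Bad x0 0%N.
  have [x0 _] : exists x0 : X, True.
    by apply: contrapT => nox; apply: noN; exists 0%N => x; exfalso; apply: nox; exists x.
  exists x0 => M; apply: contrapT => noy; apply: noN; exists M => y.
  by apply: contrapT => nPy; apply: noy; exists y; split.
have [f fP] := choice (fun p : X * nat => step p.1 p.2).
pose u := fix u k := if k is k'.+1 then f (u k', k') else x0.
have uP k : Bad (u k) k by elim: k => //= k IH; have /= := fP (u k, k); case.
have uA k : agree k (u k) (u k.+1).
  by have /= := fP (u k, k); case; [exact: uP|].
have uAA k m : (k <= m)%N -> agree k (u k) (u m).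
  elim: m => [|m IH]; first by rewrite leqn0 => /eqP->.
  rewrite leq_eqVlt => /predU1P[<-//|km].
  by apply: agree_trans (IH km) _; exact: agree_le (uA m).
have [|z zE] := @point_exists (fun t => letter (u t.+1) t).
  by move=> t; rewrite (uA t.+1)//; exact: letter_adm.
have zu k : agree k z (u k) by move=> t tk; rewrite zE (uAA t.+1 k).
have [N PzN] := Pex z; have [y [uy]] := uP N N; apply.
by apply: Pagree PzN; exact: agree_trans (zu N) uy.
Qed.

(** The witness at a point is read off its shortest good prefix, which is shared
    by all the points of the corresponding cylinder: hence the choice is locally
    constant although the witnesses are only assumed to exist locally. *)
Lemma locally_constant_choice (C : choiceType) (c0 : C) (P : X -> C -> Prop) :
  (forall x, exists M c, forall y, agree M x y -> P y c) ->
  exists c : X -> C, (forall x, P x (c x)) /\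
    forall x, exists M, forall y, agree M x y -> c y = c x.
Proof.
move=> Pex; pose Q x M := [set c | forall y, agree M x y -> P y c].
have QE M x y : agree M x y -> Q x M = Q y M.
  move=> xy; apply/seteqP; split=> c cQ z.
    by move=> yz; apply: cQ; exact: agree_trans yz.
  by move=> xz; apply: cQ; apply: agree_trans xz; exact: agree_sym.
have Mex x : exists M, `[< exists c, Q x M c >].
  by have [M [c cP]] := Pex x; exists M; apply/asboolP; exists c.
pose m x := ex_minn (Mex x).
have mP x : exists c, Q x (m x) c.
  by rewrite /m; case: ex_minnP => M /asboolP.
have mE x y : agree (m x) x y -> m y = m x.
  rewrite /m; case: ex_minnP => M /asboolP MP Mmin xy.
  case: ex_minnP => M' /asboolP MP' Mmin'; apply/eqP; rewrite eqn_leq.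
  have -> /= : (M' <= M)%N by apply: Mmin'; apply/asboolP; rewrite -(QE M x y).
  have [//|M'M] := leqP M M'.
  have := Mmin M'; rewrite leqNgt M'M; apply; apply/asboolP; rewrite (QE M' x y)//.
  exact: agree_le (ltnW M'M) xy.
exists (fun x => xget c0 (Q x (m x))); split=> [x|x].
  by have [c cQ] := mP x; have /= := xgetPex c0 (ex_intro _ c cQ); apply.
by exists (m x) => y xy; rewrite (mE x y xy) (QE _ _ _ xy).
Qed.

Definition isolated_pt x := exists N, forall y, agree N x y -> y = x.

(** An equation [iter i sh y = iter j sh y] has at most one solution in a small
    enough cylinder, so it can only hold on a neighbourhood of an isolated point. *)
Lemma isolated_of_lag i j x : i != j -> (exists M, forall y, agree M x y ->
  iter i sh y = iter j sh y) -> isolated_pt x.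
Proof.
move=> ij [M MP]; exists (maxn M (maxn i j)) => y xy.
have xE : iter i sh x = iter j sh x by exact: MP.
have yE : iter i sh y = iter j sh y.
  by apply: MP; apply: agree_le xy; exact: leq_maxl.
apply/esym; have [ij'|ji|E] := ltngtP i j; last by rewrite E eqxx in ij.
  by apply: (eventually_periodic_unique ij') => //; apply: agree_le xy; lia.
by apply: (eventually_periodic_unique ji) => //; apply: agree_le xy; lia.
Qed.

End Points.

Lemma continuous_agreeP n (A : 'M[bool]_n) m (B : 'M[bool]_m) (f : sft A -> sft B) :
  continuous f <->
  forall x N, exists M, forall y, agree M x y -> agree N (f x) (f y).
Proof.
split=> [cf x N|fP x U].
  have : nbhs x (f @^-1` [set y | agree N (f x) y]) by apply: cf; exact: nbhs_agree.
  by move/nbhsP_agree.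
move/nbhsP_agree => [N NU]; apply/nbhsP_agree; have [M MP] := fP x N.
by exists M => y /MP/NU.
Qed.

(** * Arrows and the topology of the groupoid *)

Section GroupoidTopology.
Variables (n : nat) (A : 'M[bool]_n).
Local Notation X := (sft A).
Local Notation sh := (@sft_shift n A).
Local Notation G := (sft_groupoid A).

Definition lag_rel (x : X) (d : int) (y : X) :=
  exists i j : nat, d = i%:Z - j%:Z /\ iter i sh x = iter j sh y.

Definition witness (i j : nat) (g : G) :=
  glag g = i%:Z - j%:Z /\ iter i sh (grange g) = iter j sh (gsource g).

Lemma witness_exists g : exists i j, witness i j g.
Proof. by have [i [j ?]] := glagP g; exists i, j. Qed.

Lemma arrow_exists x d y : lag_rel x d y ->
  exists g : G, [/\ grange g = x, glag g = d & gsource g = y].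
Proof. by move=> H; exists (SftGroupoid H). Qed.

Lemma arrowP (g g' : G) : grange g = grange g' -> glag g = glag g' ->
  gsource g = gsource g' -> g = g'.
Proof.
case: g g' => [x d y H] [x' d' y' H'] /= xx dd yy.
move: H H'; rewrite xx dd yy => H H'; congr SftGroupoid; exact: Prop_irrelevance.
Qed.

Lemma lag_rel0 x : lag_rel x 0 x.
Proof. by exists 0%N, 0%N. Qed.

Lemma lag_rel_shift x : lag_rel x 1 (sh x).
Proof. by exists 1%N, 0%N. Qed.

Lemma lag_relD x d y e z : lag_rel x d y -> lag_rel y e z -> lag_rel x (d + e) z.
Proof.
move=> [i [j [-> xy]]] [k [l [-> yz]]]; exists (i + k)%N, (j + l)%N; split.
  by lia.
by rewrite addnC iterD xy -iterD addnC iterD yz -iterD.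
Qed.

Lemma lag_relN x d y : lag_rel x d y -> lag_rel y (- d) x.
Proof. by move=> [i [j [-> xy]]]; exists j, i; split=> //; lia. Qed.

Lemma lag_rel_iter k x : lag_rel x k%:Z (iter k sh x).
Proof. by exists k, 0%N; split => //; lia. Qed.

(** The basic neighbourhoods of an arrow: those arrows with the same lag and the
    same merging times whose ends share long prefixes with its ends. *)
Definition near_arrow i j q (g g' : G) :=
  [/\ glag g' = glag g, iter i sh (grange g') = iter j sh (gsource g'),
      agree q (grange g) (grange g') & agree q (gsource g) (gsource g')].

Lemma near_arrow_le i j q q' g g' : (q <= q')%N ->
  near_arrow i j q' g g' -> near_arrow i j q g g'.
Proof. by move=> qq [? ? ? ?]; split=> //; exact: agree_le qq _. Qed.

(** Two witnesses of an arrow differ by a common number of further shifts; going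
    back over these shifts is possible because the letters involved lie within the
    common prefixes. *)
Lemma near_arrow_change i j k l q g g' : witness i j g -> witness k l g ->
  (i <= q)%N -> (j <= q)%N -> (k <= q)%N -> (l <= q)%N ->
  near_arrow i j q g g' -> near_arrow k l q g g'.
Proof.
move=> [gd gij] [gd' gkl] iq jq kq lq [gg rs ar as_]; split => //.
move: (leqP i k) => [ik|ki].
  have [kE lE] : k = (k - i + i)%N /\ l = (k - i + j)%N.
    by have : i%:Z - j%:Z = k%:Z - l%:Z; [rewrite -gd -gd'|split; lia].
  by rewrite kE lE !iterD rs.
have [iE jE] : i = (i - k + k)%N /\ j = (i - k + l)%N.
  by have : i%:Z - j%:Z = k%:Z - l%:Z; [rewrite -gd -gd'|split; lia].
apply: (@eq_glue _ _ (i - k)); last by rewrite -!iterD -iE -jE.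
move=> t tik; rewrite !letter_iter -as_; last by lia.
rewrite -ar; last by lia.
by rewrite -!letter_iter gkl.
Qed.

Lemma openP_near (O : set G) :
  open O <-> forall g, O g -> forall i j, witness i j g ->
    exists q, forall g', near_arrow i j q g g' -> O g'.
Proof.
split=> [[D' D'D <-] g [B D'B Bg] i j wij|OP].
  have [k [l [W [W' [[oW oW'] _ _ _ BE]]]]] := D'D _ D'B.
  move: Bg; rewrite /= BE => -[gkl Wg W'g rs].
  have /openP_agree/(_ _ Wg)[a aP] := oW.
  have /openP_agree/(_ _ W'g)[b bP] := oW'.
  exists (a + b + i + j + k + l)%N => g' gg'.
  have [g'd g'rs ar as_] : near_arrow k l (a + b + i + j + k + l)%N g g'.
    by apply: near_arrow_change wij _ _ _ _ _ gg' => //; lia.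
  exists B => //=; rewrite BE; split => //; first by rewrite g'd.
    by apply: aP; apply: agree_le ar; lia.
  by apply: bP; apply: agree_le as_; lia.
rewrite openE => g Og; have [i [j wij]] := witness_exists g.
have [q qP] := OP g Og i j wij; have [gd grs] := wij.
have [bB Bg] := @sft_groupoid_cyl _ _ g i j q gd grs.
rewrite /interior nbhsE/=; exists (sft_bisection i j
    (sft_cylinder (grange g) (i + q)) (sft_cylinder (gsource g) (j + q))).
  split=> //; eexists; last exact: bigcup_set1.
  by move=> _ ->.
move=> g' [gd' ar as_ rs]; apply: qP; split=> //; first by rewrite gd'.
  by move: ar; rewrite -agree_cylinder; apply: agree_le; lia.
by move: as_; rewrite -agree_cylinder; apply: agree_le; lia.
Qed.

Lemma nbhsP_near g (O : set G) i j : witness i j g ->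
  nbhs g O <-> exists q, forall g', near_arrow i j q g g' -> O g'.
Proof.
move=> wij; split=> [|[q qP]].
  rewrite nbhsE => -[V [oV Vg] VO]; have /openP_near/(_ _ Vg _ _ wij)[q qP] := oV.
  by exists q => g' /qP/VO.
have [gd grs] := wij; have [bB Bg] := @sft_groupoid_cyl _ _ g i j q gd grs.
rewrite nbhsE/=; exists (sft_bisection i j
    (sft_cylinder (grange g) (i + q)) (sft_cylinder (gsource g) (j + q))).
  split=> //; eexists; last exact: bigcup_set1.
  by move=> _ ->.
move=> g' [gd' ar as_ rs]; apply: qP; split=> //; first by rewrite gd'.
  by move: ar; rewrite -agree_cylinder; apply: agree_le; lia.
by move: as_; rewrite -agree_cylinder; apply: agree_le; lia.
Qed.

Definition unit_arrow (x : X) : G := SftGroupoid (lag_rel0 x).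
Definition shift_arrow (x : X) : G := SftGroupoid (lag_rel_shift x).

End GroupoidTopology.

Lemma continuous_nearP n (A : 'M[bool]_n) m (B : 'M[bool]_m)
    (f : sft_groupoid A -> sft_groupoid B) :
  (forall g i j k l, witness i j g -> witness k l (f g) -> forall q, exists q',
     forall g', near_arrow i j q' g g' -> near_arrow k l q (f g) (f g')) <->
  continuous f.
Proof.
split=> [fP g U|cf g i j k l wg wf q].
  have [i [j wg]] := witness_exists g; have [k [l wf]] := witness_exists (f g).
  move/(nbhsP_near _ wf) => [q qP]; apply/(nbhsP_near _ wg).
  have [q' q'P] := fP g i j k l wg wf q; exists q' => g' /q'P; exact: qP.
have : nbhs (f g) (near_arrow k l q (f g)) by apply/(nbhsP_near _ wf); exists q.
by move=> /cf; move/(nbhsP_near _ wg).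
Qed.

(** * Orbit equivalences from groupoid isomorphisms *)

Section IsomorphismToOrbitEquivalence.
Variables (n : nat) (A : 'M[bool]_n) (m : nat) (B : 'M[bool]_m).

Section Morphism.
Variable f : sft_groupoid A -> sft_groupoid B.
Hypothesis fM : groupoid_morphism f.

Definition unit_map (x : sft A) : sft B := grange (f (unit_arrow x)).

(** Units are the idempotents, and an idempotent has lag zero and equal ends. *)
Lemma morphism_unit x : f (unit_arrow x) = unit_arrow (unit_map x).
Proof.
have xx : composable (unit_arrow x) (unit_arrow x) by [].
have [fxx] := fM.1 _ _ xx.
have -> : gmul xx = unit_arrow x by exact: arrowP.
move=> E; apply: arrowP => /=; [by []| |exact: fxx].
by have := congr1 (@glag m B) E => /=; lia.
Qed.

Lemma morphism_range g : grange (f g) = unit_map (grange g).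
Proof.
have ug : composable (unit_arrow (grange g)) g by [].
have [fug E] := fM.1 _ _ ug; have -> : g = gmul ug.
  by apply: arrowP => //=; rewrite add0r.
by rewrite E.
Qed.

Lemma morphism_source g : gsource (f g) = unit_map (gsource g).
Proof.
have gu : composable g (unit_arrow (gsource g)) by [].
by have [+ _] := fM.1 _ _ gu; rewrite /composable morphism_unit.
Qed.

Hypothesis fC : continuous f.

Lemma unit_map_continuous : continuous unit_map.
Proof.
apply/continuous_agreeP => x N.
have wx : witness 0 0 (unit_arrow x) by [].
have wf : witness 0 0 (f (unit_arrow x)) by rewrite morphism_unit.
have /continuous_nearP/(_ _ _ _ _ _ wx wf N)[q qP] := fC.
exists q => y xy; have [] := qP (unit_arrow y); last by [].
by split.
Qed.

(** The image of the arrow from [sft_shift x] to [x] merges the images of its two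
    ends, and by continuity the merging times of one image serve for all nearby
    arrows of this kind. *)
Lemma unit_map_shift : exists k l : sft A -> nat, [/\ continuous k, continuous l &
  forall x, iter (k x) (@sft_shift m B) (unit_map (sft_shift x)) =
            iter (l x) (@sft_shift m B) (unit_map x)].
Proof.
pose P (x : sft A) (c : nat * nat) := iter c.1 (@sft_shift m B) (unit_map (sft_shift x)) =
            iter c.2 (@sft_shift m B) (unit_map x).
have [|c [cP cC]] := @locally_constant_choice _ _ _ (0, 0)%N P.
  move=> x; have wx : witness 1 0 (shift_arrow x) by [].
  have [i [j wf]] := witness_exists (f (shift_arrow x)).
  have /continuous_nearP/(_ _ _ _ _ _ wx wf 0%N)[q qP] := fC.
  exists q.+1, (j, i) => y xy; rewrite /P/=.
  have [] := qP (shift_arrow y).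
    by split=> //=; [exact: agree_le xy|exact: agree_shift].
  by rewrite !morphism_range !morphism_source /= => _ -> _ _.
exists (fst \o c), (snd \o c); split=> //.
  by apply/continuous_natP => x; have [M MP] := cC x; exists M => y /MP /= ->.
by apply/continuous_natP => x; have [M MP] := cC x; exists M => y /MP /= ->.
Qed.

End Morphism.
End IsomorphismToOrbitEquivalence.

Lemma orbit_equivalent_of_isomorphic n (A : 'M[bool]_n) m (B : 'M[bool]_m) :
  isomorphic_groupoids A B ->
  continuously_orbit_equivalent (@sft_shift n A) (@sft_shift m B).
Proof.
move=> [f [fV [[fK fVK fC fVC] fM fVM]]].
exists (unit_map f), (unit_map fV); split; first split.
- by move=> x; rewrite {1}/unit_map -morphism_unit// fK.
- by move=> x; rewrite {1}/unit_map -morphism_unit// fVK.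
- exact: unit_map_continuous.
- exact: unit_map_continuous.
- exact: unit_map_shift.
- exact: unit_map_shift.
Qed.

(** * Cocycles and the maps of arrows that they define *)

Section Cocycles.
Variables (n : nat) (A : 'M[bool]_n) (m : nat) (B : 'M[bool]_m).
Local Notation shA := (@sft_shift n A).
Local Notation shB := (@sft_shift m B).
Variables (h : sft A -> sft B).

(** The groupoid only sees the difference [c] of the two functions of an orbit
    equivalence.  The functions themselves are not determined by [c] and survive
    as locally constant merging times. *)
Definition cocycle_over (c : sft A -> int) := forall x, exists (M i j : nat),
  forall y, agree M x y ->
    c y = i%:Z - j%:Z /\ iter i shB (h y) = iter j shB (h (shA y)).

Lemma cocycle_of_orbit_equivalence (k l : sft A -> nat) :
  continuous k -> continuous l ->
  (forall x, iter (k x) shB (h (shA x)) = iter (l x) shB (h x)) ->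
  cocycle_over (fun x => (l x)%:Z - (k x)%:Z).
Proof.
move=> /continuous_natP kC /continuous_natP lC kl x.
have [M MP] := kC x; have [M' MP'] := lC x.
exists (maxn M M'), (l x), (k x) => y xy.
rewrite -[in RHS](MP y) ?[in LHS](MP y) ?(MP' y)//; try by apply: agree_le xy; lia.
by split=> //; rewrite -(MP y) -?(MP' y) ?kl//; apply: agree_le xy; lia.
Qed.

Definition csum (c : sft A -> int) N x := \sum_(t < N) c (iter t shA x).

Lemma csumD c M N x : csum c (M + N) x = csum c N x + csum c M (iter N shA x).
Proof.
rewrite /csum addnC big_split_ord/=; congr (_ + _).
by apply: eq_bigr => t _; rewrite addnC iterD.
Qed.

Variable c : sft A -> int.
Hypothesis cP : cocycle_over c.

Lemma csum_local x N : exists (M i j : nat), forall y, agree M x y ->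
  csum c N y = i%:Z - j%:Z /\ iter i shB (h y) = iter j shB (h (iter N shA y)).
Proof.
elim: N => [|N [M [i [j IH]]]].
  by exists 0%N, 0%N, 0%N => y _; rewrite /csum big_ord0.
have [M' [i' [j' H]]] := cP (iter N shA x).
exists (maxn M (M' + N)), (i' + i)%N, (j + j')%N => y xy.
have [|cN hN] := IH y; first by apply: agree_le xy; lia.
have [|cN' hN'] := H (iter N shA y).
  by apply: agree_iter; apply: agree_le xy; lia.
rewrite -add1n csumD cN /csum big_ord1 /= cN'; split; first by lia.
by rewrite iterD hN -iterD addnC iterD hN' -iterD.
Qed.

Lemma csum_lag N x : lag_rel (h x) (csum c N x) (h (iter N shA x)).
Proof.
by have [M [i [j H]]] := csum_local x N; exists i, j; exact: H.
Qed.

(** The extension of the cocycle to the arrows: the lag of an arrow is measured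
    along the two orbit segments up to a point where they have merged, and the
    contributions beyond that point cancel. *)
Definition cval x (d : int) y : int :=
  let p := xget (0, 0)%N [set p : nat * nat |
    d = p.1%:Z - p.2%:Z /\ iter p.1 shA x = iter p.2 shA y] in
  csum c p.1 x - csum c p.2 y.

Lemma cvalE i j x d y : d = i%:Z - j%:Z -> iter i shA x = iter j shA y ->
  cval x d y = csum c i x - csum c j y.
Proof.
move=> dE xy; rewrite /cval; set P := [set p | _].
have /= := @xgetPex _ (0, 0)%N P (ex_intro _ (i, j) (conj dE xy)).
case: (xget _ _) => k l /= [dE' xy'].
have key (i' j' k' l' : nat) : (i' <= k')%N -> i'%:Z - j'%:Z = k'%:Z - l'%:Z ->
    iter i' shA x = iter j' shA y ->
    csum c k' x - csum c l' y = csum c i' x - csum c j' y.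
  move=> ik E xy0; have [-> ->] : k' = (k' - i' + i')%N /\ l' = (k' - i' + j')%N.
    by split; lia.
  by rewrite !csumD addnK xy0; lia.
have [ik|/ltnW ki] := leqP i k; first by apply: key => //; rewrite -dE dE'.
by apply/esym; apply: key => //; rewrite -dE dE'.
Qed.

Lemma cval_lag x d y : lag_rel x d y -> lag_rel (h x) (cval x d y) (h y).
Proof.
move=> [i [j [dE xy]]]; rewrite (cvalE dE xy).
apply: (@lag_relD _ _ _ _ (h (iter i shA x))); first exact: csum_lag.
by rewrite xy; apply: lag_relN; exact: csum_lag.
Qed.

Lemma cvalD x d y e z : lag_rel x d y -> lag_rel y e z ->
  cval x (d + e) z = cval x d y + cval y e z.
Proof.
move=> [i [j [dE xy]]] [k [l [eE yz]]].
rewrite (cvalE dE xy) (cvalE eE yz) (@cvalE (k + i) (j + l)); last 2 first.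
- by lia.
- by rewrite iterD xy -iterD addnC iterD yz -iterD.
rewrite !csumD xy -yz.
have := csumD c j k y; have := csumD c k j y; rewrite addnC => -> E.
lia.
Qed.

Lemma cval0 x : cval x 0 x = 0.
Proof. by rewrite (@cvalE 0 0)// /csum !big_ord0. Qed.

Lemma cvalN x d y : lag_rel x d y -> cval y (- d) x = - cval x d y.
Proof.
move=> xy; have := cvalD xy (lag_relN xy); rewrite subrr cval0; lia.
Qed.

Definition arrow_map (g : sft_groupoid A) : sft_groupoid B :=
  SftGroupoid (cval_lag (glagP g)).

Lemma arrow_map_morphism : groupoid_morphism arrow_map.
Proof.
split=> [g g' gg'|g].
  have fgg' : composable (arrow_map g) (arrow_map g') by rewrite /composable /= gg'.
  exists fgg'; apply: arrowP => //=.
  have := glagP g'; rewrite -gg' => H'.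
  by rewrite (cvalD (glagP g) H').
by apply: arrowP => //=; rewrite cvalN//; exact: glagP.
Qed.

Hypothesis hC : continuous h.

(** Near an arrow the sums of the cocycle along its two orbit segments are constant
    and witnessed by constant merging times. *)
Lemma arrow_map_continuous : continuous arrow_map.
Proof.
apply/continuous_nearP => g i j k l [gd gij] wf q.
have [M1 [i1 [j1 H1]]] := csum_local (grange g) i.
have [M2 [i2 [j2 H2]]] := csum_local (gsource g) j.
pose Q := (q + k + l + (i1 + j2) + (i2 + j1))%N.
move/continuous_agreeP: hC => hC'.
have [M3 H3] := hC' (grange g) Q; have [M4 H4] := hC' (gsource g) Q.
have W g' : glag g' = i%:Z - j%:Z ->
    iter i shA (grange g') = iter j shA (gsource g') ->
    agree M1 (grange g) (grange g') -> agree M2 (gsource g) (gsource g') ->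
    witness (i1 + j2) (i2 + j1) (arrow_map g').
  move=> g'd g'ij /H1[c1 h1] /H2[c2 h2]; rewrite /witness/= (cvalE g'd g'ij) c1 c2.
  split; first by lia.
  by rewrite addnC iterD h1 -iterD addnC iterD g'ij -h2 -iterD addnC.
have wg := W g gd gij (@agree_refl _ _ _ _) (@agree_refl _ _ _ _).
exists (M1 + M2 + M3 + M4)%N => g' [g'd g'ij ar as_].
have [w1 w2] : witness (i1 + j2) (i2 + j1) (arrow_map g').
  by apply: W => //; [rewrite g'd|apply: agree_le ar; lia|apply: agree_le as_; lia].
apply: (@near_arrow_le _ _ _ _ _ Q); first by rewrite /Q; lia.
apply: (near_arrow_change wg wf); try by rewrite /Q; lia.
split=> //; first by rewrite w1 wg.1.
  by apply: H3; apply: agree_le ar; lia.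
by apply: H4; apply: agree_le as_; lia.
Qed.

End Cocycles.

(** If [f] changed the lag of an arrow with range [x], it would change the lags of
    all nearby arrows in the same way by continuity, and then all points near [x] would be
    eventually periodic with the same preperiod and period; only one of them has
    the initial letters of [x], so [x] would be isolated. *)
Lemma lag_rigid n (A : 'M[bool]_n) (f : sft_groupoid A -> sft_groupoid A) g :
  continuous f -> (forall g, grange (f g) = grange g) ->
  (forall g, gsource (f g) = gsource g) ->
  ~ isolated_pt (grange g) -> glag (f g) = glag g.
Proof.
move=> fC fr fs ni; apply: contrapT => /eqP E; apply: ni.
have [i [j wg]] := witness_exists g; have [k [l wf]] := witness_exists (f g).
move/continuous_nearP: fC => /(_ _ _ _ _ _ wg wf 0%N)[q qP].
apply: (@isolated_of_lag _ _ (i + l)%N (j + k)%N).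
  by have [gd _] := wg; have [fd _] := wf; move: E; rewrite fd gd; lia.
exists (q + i + j + 1)%N => y ry.
have [z [sz zE]] : exists z, agree j (gsource g) z /\
    iter j (@sft_shift n A) z = iter i (@sft_shift n A) y.
  apply: splice; rewrite letter_iter -ry; last by lia.
  by rewrite -letter_iter wg.2 letter_iter.
have [g' [g'r g'd g's]] : exists g' : sft_groupoid A,
    [/\ grange g' = y, glag g' = glag g & gsource g' = z].
  by apply: arrow_exists; exists i, j; split=> //; rewrite wg.1.
have [] := qP g'.
  split=> //; rewrite ?g'r ?g's//; first by apply: agree_le ry; lia.
  apply: (@agree_le _ _ (q + j)); first by lia.
  apply: agree_glue => //; rewrite -wg.2 zE; apply: agree_iter.
  by apply: agree_le ry; lia.
rewrite fr fs g'r g's => _ kl _ _.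
by rewrite addnC iterD -zE -iterD addnC iterD -kl -iterD.
Qed.

(** * Isolated points and the correction of cocycles *)

Section Periods.
Variables (n : nat) (A : 'M[bool]_n).
Local Notation X := (sft A).
Local Notation sh := (@sft_shift n A).

Lemma iter_mul r (z : X) t : iter r sh z = z -> iter (r * t) sh z = z.
Proof. by move=> zr; elim: t => [|t IH]; rewrite ?muln0// mulnS iterD IH. Qed.

(** A point which is alone in the cylinder of its first letter and lies on a
    periodic orbit; every isolated point is eventually such a point. *)
Definition anchor (z : X) := (forall u, letter u 0 = letter z 0 -> u = z) /\
  exists2 p, (0 < p)%N & iter p sh z = z.

(** Beyond the isolating prefix some letter occurs twice.  Whatever follows its
    first occurrence is forced, and so coincides with what follows its second
    occurrence. *)
Lemma isolated_anchor x : isolated_pt x -> exists s, anchor (iter s sh x).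
Proof.
move=> [N NP].
have [s [t [Ns st xst]]] : exists s t, [/\ (N <= s)%N, (s < t)%N & letter x s = letter x t].
  have ninj : ~ injective (fun k : 'I_n.+1 => letter x (N + k)).
    by move=> /leq_card; rewrite !card_ord ltnn.
  apply: contrapT => noex; apply: ninj => a b ab; apply/val_inj.
  have [ab'|ba'|//] := ltngtP a b; exfalso; apply: noex.
    by exists (N + a)%N, (N + b)%N; split=> //; lia.
  by exists (N + b)%N, (N + a)%N; split=> //; lia.
have alone u : letter u 0 = letter x s -> u = iter s sh x.
  move=> us; have [z [xz zu]] := @splice _ _ s x u (esym us).
  by rewrite -zu (NP z)//; exact: agree_le xz.
exists s; split=> [u|]; first by rewrite letter_iter; exact: alone.
exists (t - s)%N; first by rewrite subn_gt0.
rewrite -iterD subnK; last exact: ltnW.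
by apply: alone; rewrite letter_iter.
Qed.

Lemma anchor_isolated z : anchor z -> isolated_pt z.
Proof. by move=> [zP _]; exists 1%N => y zy; apply: zP; rewrite -zy. Qed.

(** The positive generator of the isotropy group of [x], if this is not trivial. *)
Definition period (x : X) : nat := xget 0%N [set p : nat |
  [/\ (0 < p)%N, lag_rel x p%:Z x &
      forall q : nat, (0 < q)%N -> lag_rel x q%:Z x -> (p <= q)%N]].

Lemma periodP (x : X) : (exists2 p : nat, (0 < p)%N & lag_rel x p%:Z x) ->
  [/\ (0 < period x)%N, lag_rel x (period x)%:Z x &
      forall q : nat, (0 < q)%N -> lag_rel x q%:Z x -> (period x <= q)%N].
Proof.
move=> [p p0 xp]; rewrite /period; set P := [set p : nat | _].
have ex : exists p : nat, `[< (0 < p)%N /\ lag_rel x p%:Z x >].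
  by exists p; apply/asboolP.
suff Pex : exists p, P p by have := xgetPex 0%N Pex.
case: (ex_minnP ex) => r /asboolP[r0 xr] rmin; exists r; split=> // q q0 xq.
by apply: rmin; apply/asboolP.
Qed.

Lemma lag_rel_mul (x : X) d : lag_rel x d x -> forall q : int, lag_rel x (q * d) x.
Proof.
move=> xd; have pos (q : nat) : lag_rel x (q%:Z * d) x.
  elim: q => [|q IH]; first by rewrite mul0r; exact: lag_rel0.
  by rewrite -addn1 PoszD mulrDl mul1r; exact: lag_relD IH xd.
case=> q; first exact: pos.
by rewrite NegzE mulNr; apply: lag_relN; exact: pos.
Qed.

Lemma period_dvd (x : X) d : (exists2 p : nat, (0 < p)%N & lag_rel x p%:Z x) ->
  lag_rel x d x -> exists q : int, d = q * (period x)%:Z.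
Proof.
move=> /periodP[p0 xp pmin] xd; exists (divz d (period x)).
rewrite {1}(divz_eq d (period x)); set r := modz _ _.
have r0 : 0 <= r by apply: modz_ge0; lia.
have rp : r < (period x)%:Z by rewrite ltz_mod//; lia.
have xr : lag_rel x r x.
  have -> : r = d + - ((d %/ period x)%Z * (period x)%:Z).
    by rewrite {1}(divz_eq d (period x)) addrC addKr.
  by apply: lag_relD xd _; apply: lag_relN; exact: lag_rel_mul.
case: r r0 rp xr => // r _ rp xr; case: r rp xr => [|r] rp xr; first by rewrite addr0.
by have := pmin r.+1 isT xr; lia.
Qed.

Lemma isolated_lag (x : X) : isolated_pt x -> exists2 p : nat, (0 < p)%N & lag_rel x p%:Z x.
Proof.
move=> /isolated_anchor[s [_ [p p0 ps]]]; exists p => //.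
exists (p + s)%N, s; split; last by rewrite iterD.
by rewrite PoszD; lia.
Qed.

Lemma anchor_period z : anchor z -> iter (period z) sh z = z.
Proof.
move=> az; have [_ [r r0 rz]] := az.
have [_ [i [j [pE zij]]] _] := periodP (isolated_lag (anchor_isolated az)).
have iE : i = (period z + j)%N by lia.
rewrite iE in zij.
rewrite -[X in iter _ _ X](iter_mul j rz) -iterD.
have -> : (period z + r * j = (r * j - j) + (period z + j))%N by nia.
by rewrite iterD zij -iterD subnK ?iter_mul//; nia.
Qed.

(** Anchors are determined by their first letter, so that among the anchors of an
    orbit there is one with least first letter. *)
Definition base_anchor (z : X) := anchor z /\
  forall z' d, anchor z' -> lag_rel z d z' -> (letter z 0 <= letter z' 0)%N.

Lemma base_anchor_exists (x : X) : isolated_pt x ->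
  exists z d, base_anchor z /\ lag_rel x d z.
Proof.
move=> xi; have [s as_] := isolated_anchor xi.
have ex : exists k : nat, `[< exists z d, [/\ anchor z, lag_rel x d z &
    letter z 0 = k :> nat] >].
  exists (letter (iter s sh x) 0); apply/asboolP; exists (iter s sh x), s%:Z; split=> //.
  exact: lag_rel_iter.
case: (ex_minnP ex) => k /asboolP[z [d [az xz zk]]] kmin; exists z, d; split=> //.
split=> // z' d' az' zz'; rewrite zk; apply: kmin; apply/asboolP.
by exists z', (d + d'); split=> //; exact: lag_relD zz'.
Qed.

Lemma base_anchor_unique z z' d : base_anchor z -> base_anchor z' ->
  lag_rel z d z' -> z = z'.
Proof.
move=> [az zmin] [az' z'min] zz'; apply: az'.1; apply/val_inj/eqP.
by rewrite eqn_leq (zmin _ _ az' zz') (z'min _ _ az (lag_relN zz')).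
Qed.

End Periods.

Section IsolatedCorrection.
Variables (n : nat) (A : 'M[bool]_n) (m : nat) (B : 'M[bool]_m).
Local Notation shA := (@sft_shift n A).
Local Notation shB := (@sft_shift m B).
Variables (h : sft A -> sft B) (c : sft A -> int).
Hypotheses (cP : cocycle_over h c)
  (h_isolated : forall x, isolated_pt x -> isolated_pt (h x)).

(** On an isolated orbit the cocycle may send a generator of the isotropy group to
    any multiple of a generator.  Changing the cocycle at one point of the orbit,
    which is allowed since that point is open and closed, repairs this. *)
Definition corrected (x : sft A) : int := c x +
  if `[< base_anchor x >] then (period (h x))%:Z - csum c (period x) x else 0.

(** The correction term is a lag from [h x] to itself, because the sum of [c] over a
    full period of an anchor also is one. *)
Lemma corrected_cocycle : cocycle_over h corrected.
Proof.
move=> x; have [[u [au ux]]|noanchor] :=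
    pselect (exists u : sft A, anchor u /\ letter x 0 = letter u 0).
  have {ux au} ax : anchor x by rewrite (au.1 _ ux).
  suff [i [j ij]] : lag_rel (h x) (corrected x) (h (shA x)).
    exists 1%N, i, j => y xy; suff -> : y = x by [].
    by apply: ax.1; rewrite xy.
  have cx : lag_rel (h x) (c x) (h (shA x)).
    by have [M [i [j H]]] := cP x; exists i, j; exact: H.
  rewrite /corrected; case: asboolP => [bx|_]; last by rewrite addr0.
  rewrite addrC; apply: lag_relD cx.
  have xi := anchor_isolated ax.
  apply: (@lag_relD _ _ _ _ (h x)).
    by have [] := periodP (isolated_lag (h_isolated xi)).
  apply: lag_relN; rewrite -[in X in lag_rel _ _ X](anchor_period ax).
  exact: csum_lag.
have [M [i [j H]]] := cP x; exists M.+1, i, j => y xy.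
rewrite /corrected; case: asboolP => [[ay _]|_].
  by exfalso; apply: noanchor; exists y; split=> //; rewrite xy.
by rewrite addr0; apply: H; exact: agree_le xy.
Qed.

(** A period of the base anchor visits the base anchor only once, so the correction
    enters the sum only once. *)
Lemma corrected_period z : base_anchor z ->
  csum corrected (period z) z = (period (h z))%:Z.
Proof.
move=> bz; have az := bz.1; have [p0 _ pmin] := periodP (isolated_lag (anchor_isolated az)).
rewrite /csum/corrected big_split/= -/(csum c _ z).
suff -> : \sum_(t < period z) (if `[< base_anchor (iter t shA z) >]
    then (period (h (iter t shA z)))%:Z - csum c (period (iter t shA z)) (iter t shA z)
    else 0) = (period (h z))%:Z - csum c (period z) z by rewrite addrC subrK.
rewrite (bigD1 (Ordinal p0))//= asboolT// big1 ?addr0// => -[t tp]/=.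
rewrite -val_eqE/= => t0; case: asboolP => // bt; exfalso.
have zt : iter t shA z = z.
  by apply/esym; apply: base_anchor_unique bz bt _; exact: lag_rel_iter.
have := pmin t; rewrite lt0n t0 => /(_ isT).
have /[swap]/[apply] : lag_rel z t%:Z z by rewrite -[X in lag_rel _ _ X]zt; exact: lag_rel_iter.
by rewrite leqNgt tp.
Qed.

Lemma corrected_isotropy x d : isolated_pt x -> lag_rel x d x ->
  exists z e (q : int), [/\ base_anchor z, lag_rel x e z,
    d = q * (period z)%:Z & cval corrected x d x = q * (period (h z))%:Z].
Proof.
move=> xi xd; have [z [e [bz xz]]] := base_anchor_exists xi.
have zi := anchor_isolated bz.1.
have zx := lag_relN xz.
have zd : lag_rel z d z.
  by have := lag_relD (lag_relD zx xd) xz; rewrite addrAC addNr add0r.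
have [q dE] := period_dvd (isolated_lag zi) zd.
exists z, e, q; split=> //.
have -> : cval corrected x d x = cval corrected z d z.
  have := cvalD corrected (lag_relD zx xd) xz; rewrite (cvalD _ zx xd) (cvalN _ xz).
  have -> : - e + d + e = d by lia.
  by move=> ->; lia.
have zp : cval corrected z (period z)%:Z z = (period (h z))%:Z.
  rewrite (@cvalE _ _ _ (period z) 0) ?subr0//; last exact: anchor_period bz.1.
  by rewrite corrected_period// /csum big_ord0 subr0.
have zpp : lag_rel z (period z)%:Z z by have [] := periodP (isolated_lag zi).
have pos (r : nat) : cval corrected z (r%:Z * (period z)%:Z) z = r%:Z * (period (h z))%:Z.
  elim: r => [|r IH]; first by rewrite !mul0r cval0.
  by rewrite -addn1 PoszD !mulrDl !mul1r (cvalD _ (lag_rel_mul zpp r) zpp) IH zp.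
rewrite dE; case: (q) => r; first exact: pos.
by rewrite NegzE !mulNr -pos (cvalN _ (lag_rel_mul zpp r.+1)).
Qed.

End IsolatedCorrection.

(** * Groupoid isomorphisms from orbit equivalences *)

Lemma isolated_homeomorphism n (A : 'M[bool]_n) m (B : 'M[bool]_m)
    (h : sft A -> sft B) (hV : sft B -> sft A) x :
  cancel h hV -> cancel hV h -> continuous hV ->
  isolated_pt x -> isolated_pt (h x).
Proof.
move=> hK hVK /continuous_agreeP hVC [N NP].
have [M MP] := hVC (h x) N; exists M => y /MP; rewrite hK => /NP <-.
by rewrite hVK.
Qed.

Section OrbitEquivalenceToIsomorphism.
Variables (n : nat) (A : 'M[bool]_n) (m : nat) (B : 'M[bool]_m).
Local Notation shA := (@sft_shift n A).
Local Notation shB := (@sft_shift m B).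
Variables (h : sft A -> sft B) (hV : sft B -> sft A).
Hypotheses (hK : cancel h hV) (hVK : cancel hV h)
  (hC : continuous h) (hVC : continuous hV).
Variables (c : sft A -> int) (cV : sft B -> int).
Hypotheses (cVP : cocycle_over hV cV).

Let h_isolated x : isolated_pt x -> isolated_pt (h x).
Proof. exact: isolated_homeomorphism. Qed.

Let d := corrected h c.
Hypothesis dP : cocycle_over h d.

Let phi := arrow_map dP.
Let psi := arrow_map cVP.

Let psi_phi_lag g : ~ isolated_pt (grange g) -> glag (psi (phi g)) = glag g.
Proof.
apply: (lag_rigid (f := psi \o phi)) => [|g'|g'] /=; rewrite ?hK//.
move=> g'; apply: continuous_comp; [exact: arrow_map_continuous|].
exact: arrow_map_continuous.
Qed.

Let phi_psi_lag g : ~ isolated_pt (grange g) -> glag (phi (psi g)) = glag g.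
Proof.
apply: (lag_rigid (f := phi \o psi)) => [|g'|g'] /=; rewrite ?hVK//.
move=> g'; apply: continuous_comp; [exact: arrow_map_continuous|].
exact: arrow_map_continuous.
Qed.

(** At isolated points the correction makes [phi] an isomorphism of isotropy
    groups; elsewhere [psi] inverts it by rigidity of lags. *)
Lemma arrow_map_inj : injective phi.
Proof.
move=> g g' E.
have rE : grange g = grange g'.
  by apply: (can_inj hK); exact: (congr1 (@grange _ _) E).
have sE : gsource g = gsource g'.
  by apply: (can_inj hK); exact: (congr1 (@gsource _ _) E).
apply: arrowP => //.
have [xi|xni] := pselect (isolated_pt (grange g)); last first.
  by rewrite -(psi_phi_lag xni) E psi_phi_lag// -rE.
have dE : cval d (grange g) (glag g) (gsource g) =
          cval d (grange g) (glag g') (gsource g).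
  by have := congr1 (@glag _ _) E; rewrite /= rE sE.
have H := glagP g; have H' : lag_rel (grange g) (glag g') (gsource g).
  by rewrite rE sE; exact: glagP.
have [z [e [q [bz _ dq cq]]]] :=
  corrected_isotropy h c xi (lag_relD H (lag_relN H')).
move: cq; rewrite (cvalD _ H (lag_relN H')) (cvalN _ H') dE subrr => /esym/eqP.
have [p0 _ _] := periodP (isolated_lag (h_isolated (anchor_isolated bz.1))).
rewrite mulf_eq0 => /orP[/eqP q0|]; last by move=> /eqP; lia.
by move: dq; rewrite q0 mul0r => /eqP; rewrite subr_eq0 => /eqP.
Qed.

(** The isotropy group of an isolated point of the target is generated by the image
    of a generator, so any arrow that differs from the image of [psi g] by isotropy
    is again an image. *)
Lemma arrow_map_surj g : exists g', phi g' = g.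
Proof.
have [xi|xni] := pselect (isolated_pt (grange g)); last first.
  by exists (psi g); apply: arrowP; rewrite ?phi_psi_lag//= hVK.
have yi : isolated_pt (hV (grange g)).
  exact: (isolated_homeomorphism hVK hK hC).
have H := glagP (psi g); have /= HB := cval_lag dP H.
rewrite !hVK in HB.
set x := hV (grange g) in yi *.
have [z [e [bz xz]]] := base_anchor_exists yi.
have zi := anchor_isolated bz.1.
have hxz : lag_rel (h x) (cval d x e z) (h z) by exact: cval_lag.
have xd : lag_rel (h x) (glag g - cval d x (glag (psi g)) (hV (gsource g))) (h x).
  by rewrite /x hVK; apply: lag_relD (glagP g) (lag_relN HB).
have zd : lag_rel (h z) (glag g - cval d x (glag (psi g)) (hV (gsource g))) (h z).
  have := lag_relD (lag_relD (lag_relN hxz) xd) hxz.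
  by rewrite addrAC addNr add0r.
have [q dE] := period_dvd (isolated_lag (h_isolated zi)) zd.
have zp : lag_rel z (q * (period z)%:Z) z.
  by apply: lag_rel_mul; have [] := periodP (isolated_lag zi).
have xq : lag_rel x (q * (period z)%:Z) x.
  have := lag_relD (lag_relD xz zp) (lag_relN xz).
  by rewrite [e + _]addrC addrK.
have [z' [e' [q' [bz' xz' qE cE]]]] := corrected_isotropy h c yi xq.
have zz : z' = z.
  by apply/esym/(base_anchor_unique bz bz')/(lag_relD (lag_relN xz) xz').
move: qE cE; rewrite zz => qE cE.
have [p0 _ _] := periodP (isolated_lag zi).
have {}qE : q' = q by move/eqP: qE; rewrite (inj_eq (mulIf _)) ?lt0n_neq0// => /eqP.
have := @arrow_exists _ _ x _ _ (lag_relD xq H).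
move=> [g' [g'r g'd g's]]; exists g'; apply: arrowP => /=.
- by rewrite g'r hVK.
- by rewrite g'r g's g'd (cvalD d xq H) cE qE -dE subrK.
- by rewrite g's hVK.
Qed.

Lemma inverse_morphism (f : sft_groupoid A -> sft_groupoid B) fV :
  cancel f fV -> cancel fV f -> groupoid_morphism f -> groupoid_morphism fV.
Proof.
move=> fK fVK fM; split=> [g g' gg'|g]; last first.
  by apply: (can_inj fK); rewrite fM.2 !fVK.
have fVgg' : composable (fV g) (fV g').
  have uinj : injective (unit_map f).
    move=> x y xy; have : f (unit_arrow x) = f (unit_arrow y).
      by rewrite !morphism_unit// xy.
    by move/(can_inj fK)/(congr1 (@grange _ _)).
  by apply: uinj; rewrite -morphism_source// -morphism_range// !fVK.
exists fVgg'; apply: (can_inj fK); have [fgg' ->] := fM.1 _ _ fVgg'.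
by rewrite fVK; apply: arrowP => /=; rewrite !fVK.
Qed.

(** Both range maps are local homeomorphisms and [phi] covers the homeomorphism
    [h], so [phi] is open: an arrow near [phi g] is the image of the arrow near [g]
    with the corresponding range. *)
Lemma arrow_map_inverse_continuous fV :
  cancel phi fV -> cancel fV phi -> continuous fV.
Proof.
move=> fK fVK; apply/continuous_nearP => b k l i j wb wg q.
have bE : phi (fV b) = b by rewrite fVK.
set g := fV b in wg bE *; rewrite -bE in wb.
have /continuous_nearP/(_ _ _ _ _ _ wg wb 0%N)[q1 q1P] := arrow_map_continuous (cP := dP) hC.
move/continuous_agreeP: (hC) => /(_ (gsource g) l)[q2 q2P].
pose q' := (q + q1 + q2 + i + j + 1)%N.
move/continuous_agreeP: (hVC) => /(_ (h (grange g)) (q' + i)%N)[q3 q3P].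
exists (q3 + l)%N => b' [b'd b'kl ar as_]; rewrite -bE/= in b'd b'kl ar as_.
have [r' s'] : grange b' = h (hV (grange b')) /\ gsource b' = h (hV (gsource b')).
  by rewrite !hVK.
set x := hV (grange b').
have xg : agree (q' + i) (grange g) x.
  by have := q3P (grange b'); rewrite hK; apply; apply: agree_le ar; lia.
have [y [sy yx]] : exists y, agree j (gsource g) y /\ iter j shA y = iter i shA x.
  apply: splice; rewrite letter_iter -xg ?add0n; last by rewrite /q'; lia.
  by have := congr1 (fun z => letter z 0) wg.2; rewrite !letter_iter !add0n.
have [g' [g'r g'd g's]] : exists g' : sft_groupoid A,
    [/\ grange g' = x, glag g' = glag g & gsource g' = y].
  by apply: arrow_exists; exists i, j; split=> //; rewrite wg.1.
have sg : agree q' (gsource g) y.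
  apply: (@agree_le _ _ (q' + j)); first by lia.
  by apply: agree_glue => //; rewrite -wg.2 yx; exact: agree_iter.
have ng : near_arrow i j q' g g'.
  by split=> //; rewrite ?g'r ?g's//; apply: agree_le xg; lia.
suff <- : phi g' = b' by rewrite fK; apply: near_arrow_le ng; rewrite /q'; lia.
have [|p'd p'kl p'r p's] := q1P g'; first by apply: near_arrow_le ng; rewrite /q'; lia.
apply: arrowP.
- by rewrite /= g'r /x hVK.
- by rewrite p'd b'd.
apply: (@eq_glue _ _ l).
  apply: (@agree_trans _ _ _ (h (gsource g))); last by apply: agree_le as_; lia.
  apply: agree_sym; rewrite /= g's; apply: q2P; apply: agree_le sg; rewrite /q'; lia.
by rewrite -b'kl -p'kl /= g'r /x hVK.
Qed.

End OrbitEquivalenceToIsomorphism.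

Lemma isomorphic_of_orbit_equivalent n (A : 'M[bool]_n) m (B : 'M[bool]_m) :
  continuously_orbit_equivalent (@sft_shift n A) (@sft_shift m B) ->
  isomorphic_groupoids A B.
Proof.
move=> [h [hV [[hK hVK hC hVC] [k [l [kC lC kl]]] [k' [l' [kC' lC' kl']]]]]].
have cP := cocycle_of_orbit_equivalence kC lC kl.
have cVP := cocycle_of_orbit_equivalence kC' lC' kl'.
have hI x : isolated_pt x -> isolated_pt (h x) by exact: isolated_homeomorphism.
pose phi := arrow_map (corrected_cocycle cP hI).
have [fV fVK] := choice (arrow_map_surj hK hVK hC hVC cVP (corrected_cocycle cP hI)).
have phi_inj : injective phi by exact: (arrow_map_inj hK hVK hC hVC cVP).
have fK : cancel phi fV by move=> g; apply: phi_inj; exact: fVK.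
have phiM : groupoid_morphism phi by exact: arrow_map_morphism.
exists phi, fV; split=> //; first split=> //.
- exact: arrow_map_continuous.
- by apply: arrow_map_inverse_continuous fK fVK.
- exact: inverse_morphism phiM.
Qed.

(** * Norms and projections in C*-algebras *)

Section CStarBasics.
Variables (R : realType) (V : cstarAlgType R).
Implicit Types x y : V.

Lemma star0 : star (0 : V) = 0.
Proof. by apply: (addrI (star 0)); rewrite -starD !addr0. Qed.

Lemma starN x : star (- x) = - star x.
Proof. by apply: (addrI (star x)); rewrite -starD !subrr star0. Qed.

Lemma starB x y : star (x - y) = star x - star y.
Proof. by rewrite starD starN. Qed.

Lemma star1 : star (1 : V) = 1.
Proof. by rewrite -[LHS]mulr1 -{2}(starK 1) -starM mulr1 starK. Qed.

Lemma star_sum (I : Type) (r : seq I) (P : pred I) (F : I -> V) :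
  star (\sum_(i <- r | P i) F i) = \sum_(i <- r | P i) star (F i).
Proof. exact: (big_morph star (@starD _ _) star0). Qed.

Lemma ReNorm_real (a : R) : complex.Re `|a%:C%C| = `|a|.
Proof. by rewrite normc_def /= expr0n addr0 sqrtr_sqr. Qed.

Lemma cnormN x : cnorm (- x) = cnorm x.
Proof. by rewrite -scaleN1r cnormZ normrN1 mul1r. Qed.

Lemma cnorm0 : cnorm (0 : V) = 0.
Proof. by rewrite -(scale0r (0 : V)) cnormZ normr0 mul0r. Qed.

Lemma cnorm_ge0 x : 0 <= cnorm x.
Proof. by have := cnormD x (- x); rewrite subrr cnorm0 cnormN; lra. Qed.

Lemma cnormB x y : cnorm (x - y) <= cnorm x + cnorm y.
Proof. by have := cnormD x (- y); rewrite cnormN. Qed.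

Lemma cnorm_distC x y : cnorm (x - y) = cnorm (y - x).
Proof. by rewrite -cnormN opprB. Qed.

Lemma cnorm_gt0 x : x != 0 -> 0 < cnorm x.
Proof.
move=> x0; rewrite lt_neqAle cnorm_ge0 andbT; apply: contra_neq x0 => /esym.
exact: cnorm0_eq0.
Qed.

(** From [|x|^2 = |x^* x| <= |x^*| |x|]. *)
Lemma cnorm_star x : cnorm (star x) = cnorm x.
Proof.
suff le y : cnorm y <= cnorm (star y).
  by apply/eqP; rewrite eq_le le andbT -{2}(starK x) le.
have [->|y0] := eqVneq y 0; first by rewrite cnorm0 cnorm_ge0.
have := cnorm_starM y; have := cnormM (star y) y => /[swap] ->.
by rewrite expr2 ler_pM2r// cnorm_gt0.
Qed.

Lemma cnorm1 : cnorm (1 : V) = 1.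
Proof.
have := cnorm_starM (1 : V); rewrite star1 mul1r => /eqP.
rewrite expr2 -subr_eq0 -{1}[cnorm 1]mulr1 -mulrBr mulf_eq0 => /orP[/eqP/cnorm0_eq0|].
  by move/eqP; rewrite oner_eq0.
by rewrite subr_eq0 => /eqP.
Qed.

Lemma cnormZr (a : R) x : cnorm (a%:C%C *: x) = `|a| * cnorm x.
Proof. by rewrite cnormZ ReNorm_real. Qed.

Lemma cnorm_sum (I : Type) (r : seq I) (P : pred I) (F : I -> V) :
  cnorm (\sum_(i <- r | P i) F i) <= \sum_(i <- r | P i) cnorm (F i).
Proof.
elim/big_rec2: _ => [|i u v _ IH]; first by rewrite cnorm0.
by apply: le_trans (cnormD _ _) _; rewrite lerD2l.
Qed.

Definition projection (p : V) := star p = p /\ p * p = p.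

Lemma projection_norm_le1 p : projection p -> cnorm p <= 1.
Proof.
move=> [pp p2]; have := cnorm_starM p; rewrite pp p2 => /eqP E.
have [->|p0] := eqVneq p 0; first by rewrite cnorm0.
have pn := cnorm_gt0 p0; have {E}: cnorm p * (cnorm p - 1) == 0.
  by rewrite mulrBr mulr1 -expr2 -(eqP E) subrr.
by rewrite mulf_eq0 gt_eqF//= subr_eq0 => /eqP ->.
Qed.

Lemma projection_norm1 p : projection p -> p != 0 -> cnorm p = 1.
Proof.
move=> [pp p2] p0; have := cnorm_starM p; rewrite pp p2 => /eqP E.
have pn := cnorm_gt0 p0; have {E}: cnorm p * (cnorm p - 1) == 0.
  by rewrite mulrBr mulr1 -expr2 -(eqP E) subrr.
by rewrite mulf_eq0 gt_eqF//= subr_eq0 => /eqP ->.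
Qed.

Lemma projectionC p : projection p -> projection (1 - p).
Proof.
move=> [pp p2]; split; first by rewrite starB star1 pp.
by rewrite mulrBr mulr1 mulrBl mul1r p2 subrr subr0.
Qed.

Lemma cnorm_compress p q x : projection p -> projection q ->
  cnorm (p * x * q) <= cnorm x.
Proof.
move=> /projection_norm_le1 pn /projection_norm_le1 qn.
apply: le_trans (cnormM _ _) _; apply: le_trans (ler_piMr (cnorm_ge0 _) qn) _.
by apply: le_trans (cnormM _ _) _; exact: ler_piMl (cnorm_ge0 _) pn.
Qed.

Definition ccvg (u : nat -> V) (l : V) := forall e : R, 0 < e ->
  exists N, forall p, (N <= p)%N -> cnorm (u p - l) < e.

Lemma eq_of_cnorm_small x : (forall e : R, 0 < e -> cnorm x < e) -> x = 0.
Proof.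
move=> xe; apply: cnorm0_eq0; apply/eqP; rewrite eq_le cnorm_ge0 andbT.
by rewrite leNgt; apply/negP => /xe; rewrite ltxx.
Qed.

End CStarBasics.

(** The form in which relations between algebraic expressions pass to closures: such
    expressions come with Lipschitz bounds. *)
Lemma lipschitz_closed (R : realType) (V W : cstarAlgType R) (f : V -> W) (K : R) :
  0 <= K -> (forall x y, cnorm (f x - f y) <= K * cnorm (x - y)) ->
  forall x, (forall e : R, 0 < e -> exists2 y, f y = 0 & cnorm (x - y) < e) -> f x = 0.
Proof.
move=> K0 fL x xP; apply: cnorm0_eq0; apply/eqP; rewrite eq_le cnorm_ge0 andbT.
rewrite leNgt; apply/negP => fx0.
have e0 : 0 < cnorm (f x) / (K + 1) by rewrite divr_gt0// ltr_wpDl.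
have [y fy xy] := xP _ e0; have := fL x y; rewrite fy subr0.
apply/negP; rewrite -ltNge; apply: (@le_lt_trans _ _ (K * (cnorm (f x) / (K + 1)))).
  by rewrite ler_wpM2l// ltW.
by rewrite mulrA ltr_pdivrMr ?ltr_wpDl// mulrC ltr_pM2l//; lra.
Qed.

(** * Square roots, contractivity and orthogonal projections *)

Lemma subrACA (M : zmodType) (a b c d : M) : (a - b) - (c - d) = (a - c) - (b - d).
Proof. by rewrite !opprB addrACA [RHS]addrACA [- b - c]addrC. Qed.

Lemma half_double (R : realType) (V : lmodType R[i]) (a : V) :
  (2^-1)%:C%C *: (a + a) = a.
Proof. by rewrite scalerDr -scalerDl -rmorphD/= -div1r -splitr scale1r. Qed.

Section SquareRoots.
Variables (R : realType) (V : cstarAlgType R).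
Implicit Types x y z e w : V.

Lemma lipschitz_limit (W : cstarAlgType R) (f : V -> W) (K : R) u l :
  0 <= K -> (forall x y, cnorm (f x - f y) <= K * cnorm (x - y)) ->
  (forall k, f (u k) = 0) -> ccvg u l -> f l = 0.
Proof.
move=> K0 fL fu ul; apply: (lipschitz_closed K0 fL) => d d0.
by have [N NP] := ul d d0; exists (u N) => //; rewrite cnorm_distC; exact: NP.
Qed.

Lemma exists_small_power (r d : R) : 0 <= r -> r < 1 -> 0 < d ->
  exists N, 2 * r ^+ N < d.
Proof.
move=> r0 r1 d0; have rc : (fun k => r ^+ k) @ \oo --> 0.
  by apply: cvg_expr; rewrite ger0_norm.
have d2 : 0 < d / 2 by rewrite divr_gt0.
have /cvgrPdist_lt/(_ _ d2)[N _ NP] := rc.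
exists N; have := NP N (leqnn N); rewrite /= sub0r normrN ger0_norm ?exprn_ge0//.
by lra.
Qed.

(* The map [sqrt_step] is a contraction of the ball of radius [cnorm x], which is
   less than one, into itself; at a fixed point [l] one has [(1 - l)^2 = 1 - x]. *)
Section Iteration.
Variables (x : V).
Hypothesis x1 : cnorm x < 1.

Definition sqrt_step z := (2^-1)%:C%C *: (x + z * z).
Definition sqrt_iter k := iter k sqrt_step (0 : V).

Let r := cnorm x.
Let r0 : 0 <= r. Proof. exact: cnorm_ge0. Qed.

Lemma sqrt_step_norm z : cnorm z <= r -> cnorm (sqrt_step z) <= r.
Proof.
move=> zr; rewrite /sqrt_step cnormZr ger0_norm ?invr_ge0//.
have := cnormD x (z * z); have := cnormM z z; rewrite -/r.
have : cnorm z * cnorm z <= r * 1.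
  by apply: ler_pM; rewrite ?cnorm_ge0//; apply: le_trans zr _; exact: ltW.
lra.
Qed.

Lemma sqrt_iter_norm k : cnorm (sqrt_iter k) <= r.
Proof. by elim: k => [|k IH]; [rewrite cnorm0|exact: sqrt_step_norm]. Qed.

Lemma sqrt_step_dist z w : cnorm z <= r -> cnorm w <= r ->
  cnorm (sqrt_step z - sqrt_step w) <= r * cnorm (z - w).
Proof.
move=> zr wr; rewrite /sqrt_step -scalerBr cnormZr ger0_norm ?invr_ge0//.
have -> : x + z * z - (x + w * w) = z * (z - w) + (z - w) * w.
  by rewrite mulrBr mulrBl addrA subrK opprD addrACA subrr add0r.
have := cnormD (z * (z - w)) ((z - w) * w).
have := cnormM z (z - w); have := cnormM (z - w) w.
have := ler_wpM2r (cnorm_ge0 (z - w)) zr.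
have := ler_wpM2l (cnorm_ge0 (z - w)) wr.
lra.
Qed.

Lemma sqrt_iter_cauchy N a b :
  cnorm (sqrt_iter (N + a) - sqrt_iter (N + b)) <= 2 * r ^+ N.
Proof.
elim: N => [|N IH].
  rewrite expr0 mulr1; apply: le_trans (cnormB _ _) _.
  have := sqrt_iter_norm (0 + a); have := sqrt_iter_norm (0 + b).
  by have := x1; rewrite -/r; lra.
apply: le_trans (sqrt_step_dist (sqrt_iter_norm _) (sqrt_iter_norm _)) _.
by rewrite exprS mulrCA ler_wpM2l.
Qed.

Lemma sqrt_iter_cvg : exists l, ccvg sqrt_iter l.
Proof.
apply: (@cnorm_complete R V) => d d0; have [N NP] := exists_small_power r0 x1 d0.
exists N => p q Np Nq; rewrite -(subnKC Np) -(subnKC Nq).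
exact: le_lt_trans (sqrt_iter_cauchy _ _ _) NP.
Qed.

Lemma sqrt_fixpoint l : ccvg sqrt_iter l -> x + l * l = l + l.
Proof.
move=> ul; suff : l - sqrt_step l = 0.
  move/subr0_eq => {3 4}->; rewrite /sqrt_step -scalerDl.
  rewrite -rmorphD/= -div1r -splitr scale1r.
  by [].
apply: eq_of_cnorm_small => d d0.
have d3 : 0 < d / 3 by rewrite divr_gt0.
have [N NP] := ul _ d3.
have lr : cnorm l <= r.
  rewrite leNgt; apply/negP => rl; have [K KP] := ul (cnorm l - r) ltac:(by rewrite subr_gt0).
  have := KP K (leqnn K); have := sqrt_iter_norm K.
  have := cnormB (sqrt_iter K) (sqrt_iter K - l); rewrite opprB addrC subrK.
  lra.
have := cnormD (l - sqrt_iter N.+1) (sqrt_iter N.+1 - sqrt_step l).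
rewrite addrA subrK; move/le_lt_trans; apply.
have := NP N.+1 (leqW (leqnn N)); rewrite cnorm_distC.
have := sqrt_step_dist (sqrt_iter_norm N) lr.
have := NP N (leqnn N); have := cnorm_ge0 (sqrt_iter N - l).
have : r * cnorm (sqrt_iter N - l) <= 1 * cnorm (sqrt_iter N - l).
  by rewrite ler_wpM2r ?cnorm_ge0// ltW.
rewrite /sqrt_iter/= -/(sqrt_iter N); lra.
Qed.

Lemma sqrt_iter_inv (f : V -> V) (K : R) l : ccvg sqrt_iter l -> 0 <= K ->
  (forall x y, cnorm (f x - f y) <= K * cnorm (x - y)) ->
  f 0 = 0 -> (forall z, f z = 0 -> f (sqrt_step z) = 0) -> f l = 0.
Proof.
move=> ul K0 fL f0 fS; apply: (lipschitz_limit K0 fL) ul.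
by elim=> [|k IH]//; exact: fS.
Qed.

End Iteration.

(** The square root of [e - x] in the corner of the projection [e]: one minus a
    fixed point of the contraction [z |-> (x + z^2) / 2].  It inherits every
    closed algebraic property of the iterates, all of which are polynomials in
    [x]. *)
Lemma corner_sqrt e x : projection e -> star x = x -> e * x = x -> x * e = x ->
  cnorm x < 1 ->
  exists y, [/\ star y = y, y * y = e - x &
    forall w, w * x = x * w -> w * e = e * w -> w * y = y * w].
Proof.
move=> [es ee] xs ex xe x1; have [l ul] := sqrt_iter_cvg x1.
have lin (f : V -> V) : (forall a b, f (a - b) = f a - f b) ->
    (exists2 K, 0 <= K & forall a, cnorm (f a) <= K * cnorm a) ->
    (forall z, f z = 0 -> f (sqrt_step x z) = 0) -> f l = 0.
  move=> fB [K K0 fK] fS; apply: (sqrt_iter_inv ul K0) => //.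
    by move=> a b; rewrite -fB.
  by have := fB 0 0; rewrite !subrr.
have ls : star l = l.
  apply/eqP; rewrite -subr_eq0; apply/eqP; apply: (lin (fun z => star z - z)).
  - by move=> a b; rewrite starB subrACA.
  - exists 2 => // a; apply: le_trans (cnormB _ _) _; rewrite cnorm_star; lra.
  - move=> z /subr0_eq zs; rewrite /sqrt_step starZ starD starM xs zs.
    by rewrite conjc_real subrr.
have el : e * l = l.
  apply/eqP; rewrite -subr_eq0; apply/eqP; apply: (lin (fun z => e * z - z)).
  - by move=> a b; rewrite mulrBr subrACA.
  - exists (cnorm e + 1) => [|a]; first by rewrite addr_ge0 ?cnorm_ge0.
    by apply: le_trans (cnormB _ _) _; rewrite mulrDl mul1r lerD2r cnormM.
  - move=> z /subr0_eq ez; rewrite /sqrt_step -scalerAr mulrDr ex mulrA ez.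
    by rewrite subrr.
have le : l * e = l by rewrite -[in LHS]ls -es -starM el ls.
have comm w : w * x = x * w -> w * e = e * w -> w * l = l * w.
  move=> wx we; apply/eqP; rewrite -subr_eq0; apply/eqP.
  apply: (lin (fun z => w * z - z * w)).
  - by move=> a b; rewrite mulrBr mulrBl subrACA.
  - exists (cnorm w + cnorm w) => [|a]; first by rewrite addr_ge0 ?cnorm_ge0.
    apply: le_trans (cnormB _ _) _; rewrite mulrDl lerD ?cnormM//.
    by rewrite mulrC cnormM.
  - move=> z /subr0_eq wz; rewrite /sqrt_step -scalerAr -scalerAl.
    by rewrite mulrDr mulrDl wx mulrA wz -!mulrA wz subrr.
exists (e - l); split.
- by rewrite starB es ls.
- have llE : l * l = l + l - x by rewrite -(sqrt_fixpoint x1 ul) addrAC subrr add0r.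
  by rewrite mulrBr !mulrBl ee el le llE opprB [l + l - x]addrAC addrK addrA subrK.
- by move=> w wx we; rewrite mulrBr mulrBl we comm.
Qed.

Lemma conjc_i : ('i%C : R[i])^*%C = - 'i%C.
Proof. by apply/eqP; rewrite eq_complex /= oppr0 !eqxx. Qed.

Lemma sqr_i : ('i%C : R[i]) * 'i%C = -1.
Proof. by apply/eqP; rewrite eq_complex /= !mulr0 !mul0r mulr1 sub0r addr0 oppr0 !eqxx. Qed.

Lemma sum_of_squares (a b : V) : star a = a -> star b = b -> a * b = b * a ->
  star (a + 'i%C *: b) * (a + 'i%C *: b) = a * a + b * b.
Proof.
move=> sa sb ab; rewrite starD starZ conjc_i sa sb mulrDl !mulrDr.
rewrite -!scalerAl -!scalerAr scalerA mulNr sqr_i opprK scale1r ab.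
by rewrite scaleNr addrA addrK.
Qed.

(** [a] is the real part of [a + i b]. *)
Lemma sum_of_squares_norm (a b : V) : star a = a -> star b = b -> a * b = b * a ->
  cnorm a ^+ 2 <= cnorm (a * a + b * b).
Proof.
move=> sa sb ab; rewrite -sum_of_squares// cnorm_starM.
set u := a + _; rewrite ler_sqr ?nnegrE ?cnorm_ge0//.
have -> : a = (2^-1)%:C%C *: (u + star u).
  rewrite /u starD starZ conjc_i sa sb scaleNr addrACA subrr addr0.
  by rewrite half_double.
rewrite cnormZr ger0_norm ?invr_ge0//.
by have := cnormD u (star u); rewrite cnorm_star; lra.
Qed.

End SquareRoots.

Section Contractive.
Variables (R : realType) (V W : cstarAlgType R) (f : {lrmorphism V -> W}).
Hypothesis fstar : star_preserving f.

(** A self-adjoint contraction is the real part of a unitary, and unitaries are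
    mapped to unitaries, which have norm one. *)
Lemma star_morphism_contractive x : cnorm (f x) <= cnorm x.
Proof.
have lt1 a : star a = a -> cnorm a < 1 -> cnorm (f a) <= 1.
  move=> sa a1.
  have [y [ys yy yc]] : exists y, [/\ star y = y, y * y = 1 - a * a &
      forall w, w * (a * a) = (a * a) * w -> w * 1 = 1 * w -> w * y = y * w].
    apply: corner_sqrt; rewrite ?mulr1 ?mul1r ?starM ?sa//.
      by split; [exact: star1|rewrite mulr1].
    apply: le_lt_trans (cnormM _ _) _; rewrite -[1]mulr1.
    by rewrite ltr_pM ?cnorm_ge0.
  have ay : a * y = y * a by apply: yc; rewrite ?mulrA// mulr1 mul1r.
  have fa : star (f a) = f a by rewrite -fstar sa.
  have fy : star (f y) = f y by rewrite -fstar ys.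
  have := sum_of_squares_norm fa fy; rewrite -!rmorphM ay => /(_ erefl).
  rewrite -rmorphD yy addrC subrK rmorph1 cnorm1 => fa1.
  by rewrite -(@expr_le1 _ 2)// cnorm_ge0.
have sa_le a : star a = a -> cnorm (f a) <= cnorm a.
  move=> sa; apply/ler_addgt0Pr => d d0.
  have t0 : 0 < cnorm a + d by rewrite ltr_wpDl ?cnorm_ge0.
  have := lt1 (((cnorm a + d)^-1)%:C%C *: a).
  rewrite starZ conjc_real sa linearZ/= !cnormZr ger0_norm ?invr_ge0 ?(ltW t0)//.
  rewrite ltr_pdivrMl// mulr1 ltrDl => /(_ erefl d0).
  by rewrite ler_pdivrMl// mulr1.
rewrite -ler_sqr ?nnegrE ?cnorm_ge0// -!cnorm_starM -fstar -rmorphM.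
by apply: sa_le; rewrite starM starK.
Qed.

End Contractive.

Section OrthogonalProjections.
Variables (R : realType) (V : cstarAlgType R).
Implicit Types a e : V.

(** The two norm inequalities say that [a] and [- a] are positive in the corner of
    [e], so up to [d] both have square roots there; the squares sum to a small
    multiple of [e]. *)
Lemma corner_antisymmetry e a (M : R) : projection e -> star a = a ->
  e * a = a -> a * e = a -> 0 < M ->
  cnorm (e - a) <= 1 -> cnorm (M%:C%C *: e + a) <= M -> a = 0.
Proof.
move=> pe sa ea ae M0 h1 h2; have [es ee] := pe.
have main d : 0 < d -> cnorm a <= 3 * d.
  move=> d0.
  have D1 : 0 < 1 + d by lra.
  have D2 : 0 < M + d by lra.
  have corner b (t s : R) : 0 < t -> t < s -> star b = b -> e * b = b -> b * e = b ->
      cnorm b <= t -> exists y, [/\ star y = y, y * y = s%:C%C *: e - b &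
        forall w, w * b = b * w -> w * e = e * w -> w * y = y * w].
    move=> t0 ts sb eb be bt; have s0 : 0 < s by exact: lt_trans ts.
    have [||||y [ys yy yc]] := @corner_sqrt _ _ e ((s^-1)%:C%C *: b) pe.
    - by rewrite starZ conjc_real sb.
    - by rewrite -scalerAr eb.
    - by rewrite -scalerAl be.
    - rewrite cnormZr ger0_norm ?invr_ge0 ?(ltW s0)//.
      by rewrite ltr_pdivrMl// mulr1; exact: le_lt_trans ts.
    exists ((Num.sqrt s)%:C%C *: y); split.
    - by rewrite starZ conjc_real ys.
    - rewrite -scalerAl -scalerAr scalerA -rmorphM/= -expr2 sqr_sqrtr ?(ltW s0)//.
      by rewrite yy scalerBr scalerA -rmorphM/= mulfV ?gt_eqF// scale1r.
    - move=> w wb we; rewrite -scalerAr -scalerAl yc//.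
      by rewrite -scalerAr -scalerAl wb.
  have [|||y [ys yy yc]] := corner (e - a) 1 (1 + d) ltr01 ltac:(lra) _ _ _ h1.
  - by rewrite starB es sa.
  - by rewrite mulrBr ee ea.
  - by rewrite mulrBl ee ae.
  have [|||z [zs zz zc]] := corner (M%:C%C *: e + a) M (M + d) M0 ltac:(lra) _ _ _ h2.
  - by rewrite starD starZ conjc_real es sa.
  - by rewrite mulrDr -scalerAr ee ea.
  - by rewrite mulrDl -scalerAl ee ae.
  have yyE : y * y = d%:C%C *: e + a.
    by rewrite yy rmorphD/= scalerDl scale1r opprB addrC addrA subrK addrC.
  have zzE : z * z = d%:C%C *: e - a.
    by rewrite zz rmorphD/= scalerDl opprD addrACA subrr add0r.
  have ey : y * e = e * y.
    apply/esym/yc; first by rewrite mulrBr mulrBl ea ae.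
    by [].
  have ay : y * a = a * y.
    apply/esym/yc; first by rewrite mulrBr mulrBl ea ae.
    by rewrite ea ae.
  have yz : y * z = z * y.
    by apply: zc => //; rewrite mulrDr mulrDl -scalerAr -scalerAl ey ay.
  have H := sum_of_squares_norm ys zs yz.
  rewrite yyE zzE addrACA subrr addr0 -scalerDl -rmorphD/= cnormZr in H.
  have E := cnorm_starM y; rewrite ys yyE in E.
  have e1 := projection_norm_le1 pe; have d20 : 0 <= d + d by lra.
  have : cnorm (d%:C%C *: e + a) <= 2 * d.
    rewrite E; apply: le_trans H _; rewrite ger0_norm//.
    by have := ler_wpM2l d20 e1; lra.
  have := cnormB (d%:C%C *: e + a) (d%:C%C *: e); rewrite addrAC subrr add0r cnormZr.
  rewrite gtr0_norm//; have : d * cnorm e <= d * 1 by rewrite ler_pM2l.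
  lra.
apply: eq_of_cnorm_small => d d0; have := main (d / 4); rewrite divr_gt0// => /(_ isT).
lra.
Qed.

(** [1 - 2 p] is a self-adjoint unitary. *)
Lemma reflection_norm (p : V) : projection p -> cnorm ((2^-1)%:C%C *: (1 : V) - p) <= 2^-1.
Proof.
move=> [sp pp].
have -> : (2^-1)%:C%C *: 1 - p = (2^-1)%:C%C *: (1 - (p + p)).
  by rewrite scalerBr half_double.
rewrite cnormZr ger0_norm ?invr_ge0// -[leRHS]mulr1 ler_wpM2l ?invr_ge0//.
have := cnorm_starM (1 - (p + p)); rewrite starB starD star1 sp.
have -> : (1 - (p + p)) * (1 - (p + p)) = 1.
  rewrite mulrBr mulr1 mulrBl mul1r mulrDl !mulrDr !pp.
  by rewrite opprB addrK subrK.
rewrite cnorm1 => /esym/eqP; rewrite sqrf_eq1 => /orP[/eqP->//|/eqP H].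
by have := cnorm_ge0 (1 - (p + p)); rewrite H; lra.
Qed.

(** Compressing the relation [sum P = 1] to the corner of [P j] shows that the
    positive element [P j * P k * P j] is also negative there. *)
Lemma projections_orthogonal (I : finType) (P : I -> V) :
  (forall i, projection (P i)) -> \sum_i P i = 1 ->
  forall j k, j != k -> P k * P j = 0.
Proof.
move=> pP P1 j k jk; have [sj jj] := pP j; have [sk kk] := pP k.
set e := P j; set a := e * P k * e.
suff a0 : a = 0.
  apply: cnorm0_eq0; apply/eqP; rewrite -sqrf_eq0 -cnorm_starM.
  suff -> : star (P k * e) * (P k * e) = a by rewrite a0 cnorm0.
  by rewrite starM sj sk /a -!mulrA [P k * (P k * _)]mulrA kk.
pose J := [pred i | (i != j) && (i != k)].
pose W := \sum_(i | J i) ((2^-1)%:C%C *: 1 - P i).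
pose M0 : R := \sum_(i | J i) 2^-1.
have M00 : 0 <= M0 by apply: sumr_ge0 => i _; rewrite invr_ge0.
have WM : cnorm W <= M0.
  by apply: le_trans (cnorm_sum _ _ _) _; apply: ler_sum => i _; exact: reflection_norm.
have WE : W = M0%:C%C *: 1 - (1 - e - P k).
  rewrite /W sumrB -scaler_suml -rmorph_sum/=; congr (_ - _).
  have -> : 1 = e + (P k + \sum_(i | J i) P i).
    by rewrite -P1 (bigD1 j)//= (bigD1 k)//=; rewrite eq_sym.
  by rewrite [e + _]addrC addrK addrC addKr.
have ae : a * e = a by rewrite /a -mulrA jj.
have ea : e * a = a by rewrite /a !mulrA jj.
apply: (@corner_antisymmetry e a (M0 + 1)) => //.
- by rewrite /a !starM sj sk mulrA.
- by lra.
- have -> : e - a = e * (1 - P k) * e by rewrite mulrBr mulr1 mulrBl jj.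
  apply: le_trans (cnorm_compress _ (pP j) (pP j)) _.
  exact/projection_norm_le1/projectionC.
- have -> : (M0 + 1)%:C%C *: e + a = e + e * W * e.
    rewrite WE mulrBr mulrBl -scalerAr mulr1 -scalerAl jj.
    rewrite !mulrBr mulr1 !mulrBl !jj subrr sub0r opprK -/a.
    by rewrite rmorphD/= scalerDl scale1r addrA [e + _]addrC.
  apply: le_trans (cnormD _ _) _; rewrite addrC lerD//.
    by apply: le_trans (cnorm_compress _ (pP j) (pP j)) _.
  exact: projection_norm_le1.
Qed.

End OrthogonalProjections.

(** * Words in a Cuntz-Krieger family *)

Section Words.
Variables (n : nat) (A : 'M[bool]_n).
Local Notation X := (sft A).
Local Notation sh := (@sft_shift n A).

Definition prefix (x : X) k : seq 'I_n := mkseq (letter x) k.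

Lemma prefix_agree k x y : agree k x y -> prefix x k = prefix y k.
Proof. by move=> xy; apply/eq_in_map => t; rewrite mem_iota add0n => /andP[_ /xy]. Qed.

Lemma agree_prefix k x y : prefix x k = prefix y k -> agree k x y.
Proof.
move=> xy t tk; have := congr1 (fun s => nth (letter x 0) s t) xy.
by rewrite !nth_mkseq.
Qed.

Lemma size_prefix x k : size (prefix x k) = k. Proof. exact: size_mkseq. Qed.

Lemma prefixD x k l : prefix x (k + l) = prefix x k ++ prefix (iter k sh x) l.
Proof.
rewrite /prefix /mkseq iotaD map_cat add0n; congr (_ ++ _).
rewrite -[k in iota k]addn0 iotaDl -map_comp; apply: eq_map => t /=.
by rewrite letter_iter addnC.
Qed.

Hypothesis rows : forall i, exists j, A i j.

Lemma point_from i : exists x : X, letter x 0 = i.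
Proof.
have [f fP] := choice rows.
have [x xE] : exists x : X, letter x =1 (fun t => iter t f i).
  by apply: point_exists => t /=; exact: fP.
by exists x; rewrite xE.
Qed.

Lemma point_cons i (x : X) : A i (letter x 0) -> exists y : X, letter y 0 = i /\ sh y = x.
Proof.
move=> ix; have [y yE] : exists y : X, letter y =1 (fun t => if t is t'.+1 then letter x t' else i).
  by apply: point_exists => -[|t] //=; exact: letter_adm.
by exists y; split; [rewrite yE|apply: letterP => t; rewrite letter_shift yE].
Qed.

Fixpoint words k : seq (seq 'I_n) :=
  if k is k'.+1 then [seq i :: w | i <- enum 'I_n, w <- words k'] else [:: [::]].

Lemma mem_words k w : (w \in words k) = (size w == k).
Proof.
elim: k w => [|k IH] w; first by rewrite inE; case: w.
apply/allpairsP/eqP => [[[i u] /= [_ uw ->]] /=|].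
  by move: uw; rewrite IH => /eqP->.
by case: w => // i u [/eqP uk]; exists (i, u); rewrite /= mem_enum IH.
Qed.

Lemma words_uniq k : uniq (words k).
Proof.
elim: k => //= k IH; apply: allpairs_uniq => //; first exact: enum_uniq.
by move=> [i u] [j w] _ _ /= [-> ->].
Qed.

End Words.

Section WordsInAlgebra.
Variables (R : realType) (n : nat) (A : 'M[bool]_n) (V : cstarAlgType R).
Variable S : 'I_n -> V.
Hypotheses (rows : forall i, exists j, A i j) (SP : cuntz_krieger_family A S).
Local Notation X := (sft A).
Local Notation sh := (@sft_shift n A).

Lemma gen_partial i : S i * star (S i) * S i = S i.
Proof. by case: SP => H _ _; exact: H. Qed.

Lemma gen_projection i : projection (S i * star (S i)).
Proof. by split; [rewrite starM starK|rewrite mulrA gen_partial]. Qed.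

(** The range projections of the generators sum to one, hence are mutually
    orthogonal. *)
Lemma gen_orthogonal i j : i != j -> star (S i) * S j = 0.
Proof.
move=> ij; have [_ S1 _] := SP.
have O : (S i * star (S i)) * (S j * star (S j)) = 0.
  by apply: (projections_orthogonal gen_projection S1); rewrite eq_sym.
have Ei : star (S i) = star (S i) * (S i * star (S i)).
  by rewrite -[in LHS](gen_partial i) !starM starK.
transitivity (star (S i) * ((S i * star (S i)) * (S j * star (S j))) * S j).
  by rewrite mulrA -Ei -[in LHS](gen_partial j) !mulrA.
by rewrite O mulr0 mul0r.
Qed.

Lemma gen_source i j : A i j -> star (S i) * S i * S j = S j.
Proof.
move=> ij; have [_ _ ->] := SP; rewrite mulr_suml (bigD1 j)//= big1 ?addr0.
  by rewrite ij scale1r gen_partial.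
by move=> k kj; rewrite -scalerAl -mulrA gen_orthogonal// mulr0 scaler0.
Qed.

Lemma gen_mul0 i j : ~~ A i j -> S i * S j = 0.
Proof.
move=> ij; have [_ _ SS] := SP.
rewrite -(gen_partial i) -!mulrA [star _ * (_ * _)]mulrA SS mulr_suml big1 ?mulr0//.
move=> k _; have [->|kj] := eqVneq k j; first by rewrite (negbTE ij) scale0r mul0r.
by rewrite -scalerAl -mulrA gen_orthogonal// mulr0 scaler0.
Qed.

Definition Sw (w : seq 'I_n) : V := \prod_(i <- w) S i.
Definition Sx (x : X) k : V := Sw (prefix x k).
Definition Qx (x : X) k : V := Sx x k * star (Sx x k).

Lemma Sx_agree k x y : agree k x y -> Sx x k = Sx y k.
Proof. by rewrite /Sx => /prefix_agree->. Qed.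

Lemma Qx_agree k x y : agree k x y -> Qx x k = Qx y k.
Proof. by rewrite /Qx => /Sx_agree->. Qed.

Lemma Sx0 x : Sx x 0 = 1.
Proof. by rewrite /Sx /Sw big_nil. Qed.

Lemma SxD x k l : Sx x (k + l) = Sx x k * Sx (iter k sh x) l.
Proof. by rewrite /Sx prefixD /Sw big_cat. Qed.

Lemma Sx1 x : Sx x 1 = S (letter x 0).
Proof. by rewrite /Sx /Sw /prefix /= big_cons big_nil mulr1. Qed.

Lemma SxS x k : Sx x k.+1 = S (letter x 0) * Sx (sh x) k.
Proof. by rewrite -add1n SxD Sx1. Qed.

Lemma SxSr x k : Sx x k.+1 = Sx x k * S (letter x k).
Proof. by rewrite -addn1 SxD Sx1 letter_iter add0n. Qed.

Lemma gen_source_Sx i x k : A i (letter x 0) ->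
  star (S i) * S i * Sx x k.+1 = Sx x k.+1.
Proof. by move=> ix; rewrite SxS mulrA gen_source. Qed.

(** Only the last letter matters, since by admissibility each source projection
    contains the range projection of the next letter. *)
Lemma Sx_source x k : star (Sx x k.+1) * Sx x k.+1 =
  star (S (letter x k)) * S (letter x k).
Proof.
elim: k x => [|k IH] x; first by rewrite Sx1.
rewrite SxS starM -mulrA [star (S _) * (_ * _)]mulrA gen_source_Sx ?IH//.
exact: letter_adm.
Qed.

Lemma Sx_source_mul x k : Sx x k.+1 * (star (S (letter x k)) * S (letter x k)) = Sx x k.+1.
Proof. by rewrite SxSr -mulrA [S _ * (_ * _)]mulrA gen_partial. Qed.

Lemma Sx_partial x k : Sx x k * star (Sx x k) * Sx x k = Sx x k.
Proof.
case: k => [|k]; first by rewrite Sx0 star1 !mulr1.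
by rewrite -mulrA Sx_source Sx_source_mul.
Qed.

Lemma Sx_cancel x k t : star (Sx x k) * Sx x (k + t.+1) = Sx (iter k sh x) t.+1.
Proof.
case: k => [|k]; first by rewrite Sx0 star1 mul1r.
rewrite SxD mulrA Sx_source gen_source_Sx//.
by rewrite letter_iter add0n; exact: letter_adm.
Qed.

Lemma Sx_orthogonal x y k : ~ agree k x y -> star (Sx x k) * Sx y k = 0.
Proof.
elim: k x y => [|k IH] x y nxy; first by exfalso; apply: nxy.
rewrite !SxS starM -mulrA [star (S _) * (_ * _)]mulrA.
have [xy|xy] := eqVneq (letter x 0) (letter y 0); last first.
  by rewrite gen_orthogonal// mul0r mulr0.
have nxy' : ~ agree k (sh x) (sh y).
  by move=> xy'; apply: nxy => -[|t]//; exact: xy'.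
case: k IH nxy nxy' => [|k] IH nxy nxy'; first by exfalso; apply: nxy'.
by rewrite xy gen_source_Sx ?IH//; exact: (letter_adm y 0).
Qed.

Lemma Sx_orthogonal_le x y k l : ~ agree k x y -> (k <= l)%N -> star (Sx x k) * Sx y l = 0.
Proof. by move=> nxy /subnKC<-; rewrite SxD mulrA Sx_orthogonal// mul0r. Qed.

Lemma Qx_projection x k : projection (Qx x k).
Proof. by split; [rewrite /Qx starM starK|rewrite /Qx mulrA Sx_partial]. Qed.

Lemma cnorm_Sx_le1 x k : cnorm (Sx x k) <= 1.
Proof.
have := cnorm_starM (star (Sx x k)); rewrite starK cnorm_star => E.
have := projection_norm_le1 (Qx_projection x k).
by rewrite /Qx E expr_le1 ?cnorm_ge0.
Qed.

Lemma Qx_Sx x k t : Qx x k * Sx x (k + t) = Sx x (k + t).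
Proof. by rewrite SxD mulrA Sx_partial. Qed.

Lemma Qx_le x k l : (k <= l)%N -> Qx x k * Qx x l = Qx x l.
Proof. by move=> /subnKC<-; rewrite {2}/Qx mulrA Qx_Sx. Qed.

Lemma Qx_ler x k l : (k <= l)%N -> Qx x l * Qx x k = Qx x l.
Proof.
move=> kl; have [sk _] := Qx_projection x k; have [sl _] := Qx_projection x l.
by rewrite -{1}sl -{1}sk -starM Qx_le.
Qed.

Lemma Qx_orthogonal x y k : ~ agree k x y -> Qx x k * Qx y k = 0.
Proof.
by move=> nxy; rewrite /Qx mulrA -[_ * Sx y k]mulrA Sx_orthogonal// mulr0 mul0r.
Qed.

Lemma point_of_algebra : exists x : X, True.
Proof.
have [i _] : exists i : 'I_n, True.
  apply: contrapT => ni; have [_ S1 _] := SP; have := oner_neq0 V.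
  rewrite -S1 big1 ?eqxx// => i; exfalso; apply: ni; by exists i.
by have [x _] := point_from rows i; exists x.
Qed.

(** Words that are not admissible give zero, and admissible ones extend to points
    because no row of the matrix vanishes. *)
Lemma Sw_point w : Sw w = 0 \/ exists x : X, w = prefix x (size w).
Proof.
elim: w => [|i w [w0|[x wx]]].
- by right; have [x _] := point_of_algebra; exists x.
- by left; rewrite /Sw big_cons -/(Sw w) w0 mulr0.
case: w wx => [|j w] wx.
  by right; have [y yi] := point_from rows i; exists y; rewrite -yi.
have xj : letter x 0 = j by case: wx.
have [ij|ij] := boolP (A i j); last first.
  by left; rewrite /Sw !big_cons mulrA gen_mul0// mul0r.
right; have [y [yi yx]] := @point_cons _ _ i x ltac:(by rewrite xj).
exists y; rewrite [size _]/= -[(size w).+2]add1n prefixD [iter _ _ _]/= yx.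
by rewrite -[(size w).+1]/(size (j :: w)) -wx -yi.
Qed.

Lemma sum_words k : \sum_(w <- words n k) Sw w * star (Sw w) = 1.
Proof.
elim: k => [|k IH]; first by rewrite big_seq1 /Sw big_nil star1 mulr1.
rewrite /= big_allpairs_dep; have [_ S1 _] := SP; rewrite -[RHS]S1 big_enum /=.
apply: eq_bigr => i _; rewrite -[RHS]mulr1 -[X in _ = _ * X]IH.
under eq_bigr => w _.
  rewrite /Sw big_cons -/(Sw w) starM mulrA -[S i * Sw w * _]mulrA; over.
by rewrite -mulr_suml -mulr_sumr IH !mulr1.
Qed.

Lemma sum_words_ext k (v v' : V) :
  (forall x, v * Qx x k = v' * Qx x k) -> v = v'.
Proof.
move=> vv; rewrite -[v]mulr1 -[v']mulr1 -(sum_words k) !mulr_sumr.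
rewrite big_seq [RHS]big_seq; apply: eq_bigr => w; rewrite mem_words => /eqP wk.
have [->|[x wx]] := Sw_point w; first by rewrite mul0r !mulr0.
by have := vv x; rewrite /Qx /Sx -wk -wx.
Qed.

End WordsInAlgebra.

(** * Elements that stand for sets of arrows *)

Lemma agreeS n (A : 'M[bool]_n) k (x y : sft A) :
  agree k x y -> letter x k = letter y k -> agree k.+1 x y.
Proof. by move=> xy xyk t; rewrite ltnS leq_eqVlt => /predU1P[->|/xy]. Qed.

Section LocalForm.
Variables (n : nat) (A : 'M[bool]_n).
Local Notation X := (sft A).
Local Notation sh := (@sft_shift n A).
Local Notation G := (sft_groupoid A).
Implicit Types (U W : set G) (x y z : X) (g : G).

Definition no_arrows_at U x N := forall g, agree N.+1 x (gsource g) -> ~ U g.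

(** Over the cylinder of the first [N+1] letters of [x], the set [U] replaces these
    letters by the first [M+1] letters of [y].  Keeping the last letter, rather
    than cutting right after the common tail begins, makes every point of the
    cylinder a source. *)
Definition arrows_at U x N y M := iter M sh y = iter N sh x /\
  forall g, agree N.+1 x (gsource g) -> (U g <->
    [/\ glag g = M%:Z - N%:Z, iter M sh (grange g) = iter N sh (gsource g) &
        agree M.+1 y (grange g)]).

Lemma no_arrows_at_le U x N N' : (N <= N')%N -> no_arrows_at U x N -> no_arrows_at U x N'.
Proof. by move=> NN H g xg; apply: H; apply: agree_le xg. Qed.

Lemma no_arrows_at_agree U x x' N : agree N.+1 x x' -> no_arrows_at U x N -> no_arrows_at U x' N.
Proof. by move=> xx H g xg; apply: H; exact: agree_trans xg. Qed.

Lemma letter_eq_iter M N y x t : iter M sh y = iter N sh x -> letter y (t + M) = letter x (t + N).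
Proof. by move=> yx; rewrite -!letter_iter yx. Qed.

Lemma arrows_at_add U x N y M t : arrows_at U x N y M -> arrows_at U x (N + t) y (M + t).
Proof.
move=> H; elim: t => [|t]; rewrite ?addn0// !addnS.
move: (N + t)%N (M + t)%N => {H} {}N {}M [yx H].
have yx' := letter_eq_iter _ yx.
split=> [|g xg]; first by rewrite !iterS yx.
have xg' : agree N.+1 x (gsource g) by apply: agree_le xg.
rewrite (H g xg'); split=> -[gd rs yr]; split=> //; try lia.
- by rewrite !iterS rs.
- apply: agreeS => //; rewrite -[M.+1]add1n yx' xg//.
  by apply/esym; exact: letter_eq_iter rs.
- apply: (@eq_glue _ _ 1); last by rewrite -!iterD !add1n.
  move=> [|//] _; rewrite !letter_iter !add0n -yr// -xg//.
  exact: (yx' 0%N).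
- exact: agree_le yr.
Qed.

Lemma arrows_at_arrow U x N y M : arrows_at U x N y M ->
  exists g, [/\ U g, grange g = y, glag g = M%:Z - N%:Z & gsource g = x].
Proof.
move=> [yx H]; have [g [gr gd gs]] : exists g : G,
    [/\ grange g = y, glag g = M%:Z - N%:Z & gsource g = x].
  by apply: arrow_exists; exists M, N.
by exists g; split=> //; apply/H; rewrite ?gs//; split; rewrite ?gr ?gs//.
Qed.

Lemma arrows_at_agree U x x' N y M : agree N.+1 x x' -> arrows_at U x N y M ->
  exists y', agree M.+1 y y' /\ arrows_at U x' N y' M.
Proof.
move=> xx [yx H].
have [|y' [yy' y'x]] := @splice _ _ M y (iter N sh x').
  rewrite letter_iter add0n -xx//; exact: (letter_eq_iter 0 yx).
have yy : agree M.+1 y y'.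
  apply: agreeS => //; rewrite -[M in LHS]add0n (letter_eq_iter 0 yx) xx//.
  by rewrite -[M]add0n (letter_eq_iter 0 y'x).
exists y'; split=> //; split=> // g xg; rewrite H; last exact: agree_trans xg.
split=> -[gd rs yr]; split=> //; last exact: agree_trans yy yr.
exact: agree_trans (agree_sym yy) yr.
Qed.

Lemma arrows_at_unique U x N y M y' M' : arrows_at U x N y M ->
  arrows_at U x N y' M' -> M = M' /\ agree M.+1 y' y.
Proof.
move=> /arrows_at_arrow[g [Ug gr gd gs]] [yx' H].
have := H g; rewrite gs => /(_ (@agree_refl _ _ _ _))[/(_ Ug)[]]; rewrite gd gr.
by move=> E _ yy _; have -> : M = M' by lia.
Qed.

End LocalForm.

Section Representation.
Variables (R : realType) (n : nat) (A : 'M[bool]_n) (V : cstarAlgType R).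
Variable S : 'I_n -> V.
Hypotheses (rows : forall i, exists j, A i j) (SP : cuntz_krieger_family A S).
Local Notation X := (sft A).
Local Notation sh := (@sft_shift n A).
Local Notation G := (sft_groupoid A).
Local Notation Sx := (@Sx R n A V S).
Local Notation Qx := (@Qx R n A V S).
Implicit Types (U W : set G) (x y z : X) (g : G) (v w : V).

Definition acts_at U v x N y M := arrows_at U x N y M /\
  v * Qx x N.+1 = Sx y M.+1 * star (Sx x N.+1).

Definition acts_locally U v x N := (no_arrows_at U x N /\ v * Qx x N.+1 = 0) \/
  exists y M, acts_at U v x N y M.

(** The element of the algebra that stands for the indicator function of a compact
    open set of arrows with injective source map, in the form of its local
    behaviour on cylinders. *)
Definition represents U v := exists N, forall x, acts_locally U v x N.

Lemma Sx_star_add x y N M t : iter M sh y = iter N sh x ->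
  Sx y M.+1 * star (Sx x N.+1) * Qx x (N + t).+1 =
  Sx y (M + t).+1 * star (Sx x (N + t).+1).
Proof.
move=> yx; have lE : letter y M = letter x N by exact: (letter_eq_iter 0 yx).
case: t => [|t].
  rewrite !addn0 -mulrA [star _ * (_ * _)]mulrA (Sx_source SP) mulrA.
  by rewrite -lE (Sx_source_mul SP).
rewrite -mulrA [star _ * (_ * _)]mulrA -!addSn (Sx_cancel SP).
by rewrite [Sx y (_ + _)]SxD !iterS yx mulrA.
Qed.

Lemma acts_at_add U v x N y M t : acts_at U v x N y M ->
  acts_at U v x (N + t) y (M + t).
Proof.
move=> [H vQ]; split; first exact: arrows_at_add.
by rewrite -(Sx_star_add t H.1) -vQ -mulrA (Qx_le SP)// ltnS leq_addr.
Qed.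

Lemma acts_locally_le U v x N N' : (N <= N')%N ->
  acts_locally U v x N -> acts_locally U v x N'.
Proof.
move=> NN [[no vQ]|[y [M H]]].
  left; split; first exact: no_arrows_at_le no.
  by rewrite -(@Qx_le _ _ _ _ _ SP x N.+1)// mulrA vQ mul0r.
by right; exists y, (M + (N' - N))%N; have := acts_at_add (N' - N) H; rewrite subnKC.
Qed.

Lemma acts_at_agree U v x x' N y M : agree N.+1 x x' -> acts_at U v x N y M ->
  exists y', acts_at U v x' N y' M.
Proof.
move=> xx [H vQ]; have [y' [yy H']] := arrows_at_agree xx H; exists y'; split=> //.
by rewrite -(Qx_agree S xx) -(Sx_agree S xx) -(Sx_agree S yy).
Qed.

Lemma acts_locally_agree U v x x' N : agree N.+1 x x' ->
  acts_locally U v x N -> acts_locally U v x' N.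
Proof.
move=> xx [[no vQ]|[y [M H]]].
  by left; split; [exact: no_arrows_at_agree no|rewrite -(Qx_agree S xx)].
by right; have [y' H'] := acts_at_agree xx H; exists y', M.
Qed.

(** Compactness makes the level uniform. *)
Lemma represents_pointwise U v :
  (forall x, exists N, acts_locally U v x N) -> represents U v.
Proof.
move=> H; pose P x N := exists2 k, (k < N)%N & acts_locally U v x k.
have [|||N NP] := @uniform_level _ _ P.
- by move=> x N M NM [k kN]; exists k => //; exact: leq_trans NM.
- move=> x y N xy [k kN H1]; exists k => //; apply: acts_locally_agree H1.
  exact: agree_le xy.
- by move=> x; have [N NP] := H x; exists N.+1, N.
by exists N => x; have [k /ltnW kN] := NP x; exact: acts_locally_le.
Qed.

(** The projections of the words of one length sum to one, so an element is
    determined by its local behaviour. *)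
Lemma represents_unique U v v' : represents U v -> represents U v' -> v = v'.
Proof.
move=> [N NP] [N' NP']; apply: (sum_words_ext rows SP (k := (N + N').+1)) => x.
have := acts_locally_le (leq_addr N' N) (NP x).
have := acts_locally_le (leq_addl N N') (NP' x).
move=> [[no' ->]|[y' [M' [H' ->]]]] [[no ->]|[y [M [H ->]]]] //.
- by have [g [Ug _ _ gs]] := arrows_at_arrow H; exfalso; apply: (no' g); rewrite ?gs.
- by have [g [Ug _ _ gs]] := arrows_at_arrow H'; exfalso; apply: (no g); rewrite ?gs.
- by have [-> yy] := arrows_at_unique H' H; rewrite (Sx_agree S yy).
Qed.

Definition arrow_mul U W : set G := [set g | exists a b,
  [/\ U a, W b, gsource a = grange b &
      [/\ grange g = grange a, glag g = glag a + glag b & gsource g = gsource b]]].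

Definition arrow_inv U : set G := [set g | U (ginv g)].

(** On a small cylinder [w] replaces a prefix and moves the cylinder into one on
    which [v] replaces a prefix in its turn. *)
Lemma represents_mul U W v w : represents U v -> represents W w ->
  represents (arrow_mul U W) (v * w).
Proof.
move=> [N NP] [N' NP']; apply: represents_pointwise => x.
have [[no wQ]|[y [M Hw]]] := NP' x.
  exists N'; left; split; last by rewrite -mulrA wQ mulr0.
  by move=> g xg [a [b [_ Wb _ [_ _ gb]]]]; apply: no Wb; rewrite -gb.
have {Hw}[[yx Hw] wQ] := acts_at_add N Hw; move: (N' + N)%N (M + N)%N (leq_addl M N) yx Hw wQ.
move=> {NP'} {}N' {}M NM yx Hw wQ; exists N'.
have vwQ : v * w * Qx x N'.+1 = v * Qx y M.+1 * (Sx y M.+1 * star (Sx x N'.+1)).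
  by rewrite -mulrA wQ -[RHS]mulrA -{1}[M.+1]addn0 -(Qx_Sx SP) addn0 [Qx _ _ * (_ * _)]mulrA.
have [[no vQ]|[z [K [[zy Hv] vQ]]]] := acts_locally_le NM (NP y).
  left; split; last by rewrite vwQ vQ mul0r.
  move=> g xg [a [b [Ua Wb ab [_ _ gb]]]]; apply: no Ua.
  by rewrite ab; have [] := (Hw b _).1 Wb; rewrite -gb.
right; exists z, K; split; last first.
  rewrite vwQ vQ -mulrA [star _ * (_ * _)]mulrA (Sx_source SP) mulrA.
  have -> : letter y M = letter z K by apply/esym; exact: (letter_eq_iter 0 zy).
  by rewrite (Sx_source_mul SP).
split=> [|g xg]; first by rewrite zy.
split=> [[a [b [Ua Wb ab [gr gd gs]]]]|[gd rs zr]].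
  have [bd brs yb] := (Hw b ltac:(by rewrite -gs)).1 Wb.
  have [ad ars za] := (Hv a ltac:(by rewrite ab)).1 Ua.
  by rewrite gd ad bd gr gs ars ab brs; split=> //; lia.
have [|u [yu us]] := @splice _ _ M y (iter N' sh (gsource g)).
  by rewrite letter_iter add0n -xg//; exact: (letter_eq_iter 0 yx).
have yu' : agree M.+1 y u.
  apply: agreeS => //.
  have -> : letter y M = letter x N' by exact: (letter_eq_iter 0 yx).
  by rewrite xg//; apply/esym; exact: (letter_eq_iter 0 us).
have [b [br bd bs]] : exists b : G, [/\ grange b = u, glag b = M%:Z - N'%:Z & gsource b = gsource g].
  by apply: arrow_exists; exists M, N'.
have [a [ar ad as_]] : exists a : G, [/\ grange a = grange g, glag a = K%:Z - M%:Z & gsource a = u].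
  by apply: arrow_exists; exists K, M; rewrite us.
exists a, b; split.
- by apply/Hv; rewrite as_//; split=> //; rewrite ?ar ?as_ ?us.
- by apply/Hw; rewrite bs//; split=> //; rewrite ?br ?bs.
- by rewrite as_ br.
- by rewrite ar ad bd bs gd; split=> //; lia.
Qed.

Lemma represents_ext U W v : U `<=>` W -> represents U v -> represents W v.
Proof. by move=> UW; have -> : U = W by apply/seteqP; split; apply UW. Qed.

Lemma represents0 : represents set0 0.
Proof. by exists 0%N => x; left; split; [move=> g _ []|rewrite mul0r]. Qed.

Lemma represents_add U W v w : (forall g g', U g -> W g' -> gsource g <> gsource g') ->
  represents U v -> represents W w -> represents (U `|` W) (v + w).
Proof.
move=> UW [N NP] [N' NP']; exists (N + N')%N => x.
have := acts_locally_le (leq_addr N' N) (NP x).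
have := acts_locally_le (leq_addl N N') (NP' x).
move=> [[no' wQ]|[y' [M' [H' wQ]]]] [[no vQ]|[y [M [H vQ]]]].
- left; rewrite mulrDl vQ wQ addr0; split=> // g xg [Ug|Wg].
    exact: no xg Ug.
  exact: no' xg Wg.
- right; exists y, M; rewrite /acts_at mulrDl vQ wQ addr0; split=> //.
  split=> [|g xg]; first exact: H.1.
  by rewrite -(H.2 g xg); split=> [[Ug|Wg]|Ug]; [exact: Ug|case: (no' g xg)|left].
- right; exists y', M'; rewrite /acts_at mulrDl vQ wQ add0r; split=> //.
  split=> [|g xg]; first exact: H'.1.
  by rewrite -(H'.2 g xg); split=> [[Ug|Wg]|Wg]; [case: (no g xg)|exact: Wg|right].
- have [g [Ug _ _ gs]] := arrows_at_arrow H.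
  have [g' [Ug' _ _ gs']] := arrows_at_arrow H'.
  by exfalso; apply: (UW g g') => //; rewrite gs gs'.
Qed.

Lemma represents_sum (I : eqType) (r : seq I) (U : I -> set G) (v : I -> V) :
  uniq r -> (forall i, i \in r -> represents (U i) (v i)) ->
  (forall i j g g', i != j -> U i g -> U j g' -> gsource g <> gsource g') ->
  represents [set g | exists2 i, i \in r & U i g] (\sum_(i <- r) v i).
Proof.
move=> + + disj; elim: r => [_ _|i r IH /= /andP[ir ur] rv].
  rewrite big_nil; apply: represents_ext represents0.
  by split=> g; [case|case=> i].
rewrite big_cons; apply: (@represents_ext (U i `|` [set g | exists2 i, i \in r & U i g])).
  split=> g; [move=> [Ug|[j jr Ug]]|move=> [j jr Ug]].
  - by exists i; rewrite ?mem_head.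
  - by exists j; rewrite // in_cons jr orbT.
  - by move: jr Ug; rewrite in_cons => /predU1P[->|jr] Ug; [left|right; exists j].
apply: represents_add.
- move=> g g' Ug [j jr Ug']; apply: disj Ug Ug'.
  by apply: contraNneq ir => ->.
- by apply: rv; rewrite mem_head.
- by apply: IH => // j jr; apply: rv; rewrite in_cons jr orbT.
Qed.

End Representation.

(** * Adjoints and existence of represented elements *)

Section GeneratedSubalgebras.
Variables (R : realType) (V : cstarAlgType R) (D : set V).

Lemma generated_subalgebra : cstar_subalgebra (cstar_generated D).
Proof.
split.
- split=> [C [[[C0 _] _ _ _ _] _]//|x y Hx Hy C CD].
  by have [[[_ CA] _ _ _ _] _] := CD; apply: CA; [exact: Hx|exact: Hy].
- move=> a x Hx C CD; have [[_ CZ _ _ _] _] := CD; apply: CZ; exact: Hx.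
- move=> x y Hx Hy C CD; have [[_ _ CM _ _] _] := CD.
  by apply: CM; [exact: Hx|exact: Hy].
- move=> x Hx C CD; have [[_ _ _ CS _] _] := CD; apply: CS; exact: Hx.
- move=> x Hx C CD; have [[_ _ _ _ CC] _] := CD; apply: CC => e /Hx[b Hb xb].
  by exists b => //; exact: Hb.
Qed.

Lemma sub_generated x : D x -> cstar_generated D x.
Proof. by move=> Dx C [_ DC]; exact: DC. Qed.

Lemma generated_min C : cstar_subalgebra C -> D `<=` C -> cstar_generated D `<=` C.
Proof. by move=> cC DC x; apply. Qed.

Lemma generated0 : cstar_generated D 0.
Proof. by case: generated_subalgebra => -[]. Qed.

Lemma generated_sum (I : eqType) (r : seq I) (P : pred I) (F : I -> V) :
  (forall i, i \in r -> P i -> cstar_generated D (F i)) ->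
  cstar_generated D (\sum_(i <- r | P i) F i).
Proof.
case: generated_subalgebra => -[D0 DD] _ _ _ _ H.
by rewrite big_seq_cond; apply: big_ind => // i /andP[]; exact: H.
Qed.

End GeneratedSubalgebras.

Section RepresentationExistence.
Variables (R : realType) (n : nat) (A : 'M[bool]_n) (V : cstarAlgType R).
Variable S : 'I_n -> V.
Hypotheses (rows : forall i, exists j, A i j) (SP : cuntz_krieger_family A S).
Local Notation X := (sft A).
Local Notation sh := (@sft_shift n A).
Local Notation G := (sft_groupoid A).
Local Notation Sx := (@Sx R n A V S).
Local Notation Qx := (@Qx R n A V S).
Local Notation Sw := (@Sw R n V S).
Implicit Types (U W : set G) (x y z : X) (g : G) (v w : V).

(** There are only finitely many words of length [N + 1]. *)
Lemma replaced_length_bounded U N : exists K, forall x y M,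
  arrows_at U x N y M -> (M <= K)%N.
Proof.
have H (u : seq 'I_n) : exists m : nat, forall x y M,
    prefix x N.+1 = u -> arrows_at U x N y M -> (M <= m)%N.
  have [[x [y [M [xu H]]]]|no] :=
    pselect (exists x y M, prefix x N.+1 = u /\ arrows_at U x N y M).
    exists M => x' y' M' xu' H'.
    have xx : agree N.+1 x x' by apply: agree_prefix; rewrite xu.
    have [y'' [_ H'']] := arrows_at_agree xx H.
    by have [->] := arrows_at_unique H' H''.
  by exists 0%N => x y M xu H; exfalso; apply: no; exists x, y, M.
have [m mP] := choice H; exists (\max_(u <- words n N.+1) m u)%N => x y M xM.
apply: leq_trans (mP _ _ _ _ erefl xM) _.
by apply: leq_bigmax_seq => //; rewrite mem_words size_prefix.
Qed.

(** A point that shares the new prefix is reached from the point obtained by putting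
    the old prefix back. *)
Lemma acts_at_retarget U v z N y M x : acts_at S U v z N y M -> agree M.+1 y x ->
  exists z', agree N.+1 z z' /\ acts_at S U v z' N x M.
Proof.
move=> H yx; have zy := H.1.1.
have [|z' [zz' z'x]] := @splice _ _ N z (iter M sh x).
  by rewrite letter_iter add0n -yx//; apply/esym; exact: (letter_eq_iter 0 zy).
have zz : agree N.+1 z z'.
  apply: agreeS => //; have -> : letter z' N = letter x M by exact: (letter_eq_iter 0 z'x).
  by rewrite -yx//; apply/esym; exact: (letter_eq_iter 0 zy).
exists z'; split=> //; have [y' [yy' [y'z H']]] := arrows_at_agree zz H.1.
have E : y' = x.
  apply: (@eq_glue _ _ M); last by rewrite y'z z'x.
  by apply: (@agree_trans _ _ _ y); [apply: agree_sym; exact: agree_le yy'|exact: agree_le yx].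
rewrite -E; split; first by split.
by rewrite -(Qx_agree S zz) -(Sx_agree S zz) -(Sx_agree S yy') H.2.
Qed.

(** The cut-downs of the adjoint to the cylinders of the source are known, and
    injectivity of the range map leaves at most one of them to contribute on a
    small cylinder of the range. *)
Lemma represents_inv U v :
  (forall g g', U g -> U g' -> grange g = grange g' -> gsource g = gsource g') ->
  represents S U v -> represents S (arrow_inv U) (star v).
Proof.
move=> Uinj [N NP]; have [K KP] := replaced_length_bounded U N.
exists K => x.
have expand : star v * Qx x K.+1 =
    \sum_(u <- words n N.+1) Sw u * star (Sw u) * star v * Qx x K.+1.
  by rewrite -!mulr_suml (sum_words SP) mul1r.
have term u : u \in words n N.+1 ->
    (exists z M, prefix z N.+1 = u /\ acts_at S U v z N x M) \/
    Sw u * star (Sw u) * star v * Qx x K.+1 = 0.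
  rewrite mem_words => /eqP uN.
  have [->|[p pu]] := Sw_point rows SP u; first by right; rewrite !mul0r.
  rewrite uN in pu; have E : Sw u * star (Sw u) * star v = star (v * Qx p N.+1).
    by rewrite pu [RHS]starM (Qx_projection SP p N.+1).1.
  have [[_ vQ]|[y [M H]]] := NP p; first by right; rewrite E vQ star0 mul0r.
  have [yx|yx] := pselect (agree M.+1 y x).
    have [z [pz Hz]] := acts_at_retarget H yx.
    by left; exists z, M; split=> //; rewrite pu; apply/esym; exact: prefix_agree.
  right; rewrite E H.2 starM starK /Qx -mulrA [star _ * (_ * _)]mulrA.
  by rewrite Sx_orthogonal_le ?mul0r ?mulr0// ltnS; exact: KP H.1.
have [[z [M H]]|no] := pselect (exists z M, acts_at S U v z N x M); last first.
  left; split; last first.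
    rewrite expand big_seq big1// => u /term[[z [M [_ H]]]|//].
    by exfalso; apply: no; exists z, M.
  move=> g xg Ug; have [[nz _]|[y [M H]]] := NP (grange g).
    by apply: (nz (ginv g)).
  have := (H.1.2 (ginv g) (@agree_refl _ _ _ _)).1 Ug => -[_ _ /= yg].
  have yx : agree M.+1 y x.
    apply: agree_trans yg _; apply: agree_sym; apply: agree_le xg.
    by rewrite ltnS; exact: KP H.1.
  have [z' [_ H']] := acts_at_retarget H yx.
  by apply: no; exists z', M.
right; have MK := KP _ _ _ H.1; exists z, (N + (K - M))%N.
set t := (K - M)%N; have KE : K = (M + t)%N by rewrite subnKC.
have [[xz HU] vQ] := H.
split; last first.
  have zw : prefix z N.+1 \in words n N.+1 by rewrite mem_words size_prefix.
  rewrite expand (bigD1_seq _ zw (words_uniq n N.+1))/= big_seq_cond big1 ?addr0.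
    have -> : Sw (prefix z N.+1) * star (Sw (prefix z N.+1)) * star v = star (v * Qx z N.+1).
      by rewrite [RHS]starM (Qx_projection SP z N.+1).1.
    rewrite vQ starM starK KE; apply: (Sx_star_add SP); exact: esym.
  move=> u /andP[/term[[z' [M' [<- H']]]|//]] /eqP zz'; exfalso; apply: zz'.
  have [g [Ug gr _ gs]] := arrows_at_arrow H.1.
  have [g' [Ug' gr' _ gs']] := arrows_at_arrow H'.1.
  by have := Uinj _ _ Ug' Ug; rewrite gr gr' gs gs' => ->.
split=> [|g xg]; first by rewrite addnC iterD -xz -iterD addnC -KE.
have xg' : agree M.+1 x (gsource g) by apply: agree_le xg.
have tail : agree t.+1 (iter N sh z) (iter M sh (gsource g)).
  by rewrite -xz; apply: agree_iter; apply: agree_le xg; rewrite KE; lia.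
split=> [Ug|[gd rs zg]].
  have [|z' [zz' z'g]] := @splice _ _ N z (iter M sh (gsource g)).
    by rewrite letter_iter add0n -xg'//; apply/esym; exact: (letter_eq_iter 0 xz).
  have zz : agree N.+1 z z'.
    apply: agreeS => //; have -> : letter z' N = letter (gsource g) M by exact: (letter_eq_iter 0 z'g).
    by rewrite -xg'//; apply/esym; exact: (letter_eq_iter 0 xz).
  have [b [br bd bs]] : exists b : G,
      [/\ grange b = gsource g, glag b = M%:Z - N%:Z & gsource b = z'].
    by apply: arrow_exists; exists M, N.
  have Ub : U b by apply/HU; rewrite bs//; split; rewrite ?br ?bs.
  have gz : grange g = z' by have := Uinj _ _ Ug Ub; rewrite /= br bs; apply.
  have [/= gd rs _] := (HU (ginv g) ltac:(by rewrite /= gz)).1 Ug.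
  split; first by lia.
    by rewrite addnC iterD -rs -iterD KE addnC.
  rewrite gz; have -> : (N + t).+1 = (t.+1 + N)%N by rewrite addnC.
  by apply: agree_glue => //; rewrite z'g.
have zg' : agree N.+1 z (grange g) by apply: agree_le zg; rewrite ltnS leq_addr.
apply/(HU (ginv g) zg'); split=> //=; first by lia.
apply: (@eq_glue _ _ t).
  apply: (@agree_trans _ _ _ (iter N sh z)).
    by apply: agree_sym; exact: agree_le tail.
  by apply: agree_iter; apply: agree_le zg; rewrite addnC.
by rewrite -!iterD addnC -KE addnC rs.
Qed.

(** The part of [acts_locally] that speaks of the set of arrows alone. *)
Definition structured U x N := no_arrows_at U x N \/ exists y M, arrows_at U x N y M.

(** The element is the sum over the words of one length of the partial isometries
    that replace these words by the prescribed ones. *)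
Lemma represents_exists U : (forall x, exists N, structured U x N) ->
  exists v, represents S U v.
Proof.
move=> US; have [N NP] : exists N, forall x, structured U x N.
  pose P x N := exists2 k, (k < N)%N & structured U x k.
  have [|||N NP] := @uniform_level _ _ P.
  - by move=> x N M NM [k kN]; exists k => //; exact: leq_trans NM.
  - move=> x y N xy [k kN [no|[z [M H]]]]; exists k => //.
      by left; apply: no_arrows_at_agree no; exact: agree_le xy.
    have xy' : agree k.+1 x y by exact: agree_le xy.
    by right; have [z' [_ H']] := arrows_at_agree xy' H; exists z', M.
  - by move=> x; have [N NP] := US x; exists N.+1, N.
  exists N => x; have [k /ltnW kN [no|[y [M H]]]] := NP x.
    by left; exact: no_arrows_at_le no.
  by right; exists y, (M + (N - k))%N; have := arrows_at_add (N - k) H; rewrite subnKC.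
have F (u : seq 'I_n) : exists e : V, e * (Sw u * star (Sw u)) = e /\
    forall x, prefix x N.+1 = u -> (no_arrows_at U x N /\ e = 0) \/
      exists y M, arrows_at U x N y M /\ e = Sx y M.+1 * star (Sx x N.+1).
  have [[x0 x0u]|no] := pselect (exists x, prefix x N.+1 = u); last first.
    by exists 0; split; [rewrite mul0r|move=> x xu; exfalso; apply: no; exists x].
  have [no|[y [M H]]] := NP x0.
    exists 0; split; first by rewrite mul0r.
    move=> x xu; left; split=> //; apply: no_arrows_at_agree no.
    by apply: agree_prefix; rewrite x0u.
  exists (Sx y M.+1 * star (Sx x0 N.+1)); split.
    rewrite -mulrA; congr (_ * _); rewrite -x0u -/(Sx x0 N.+1).
    by rewrite -[in RHS](Sx_partial SP) !starM starK.
  move=> x xu; right; have xx : agree N.+1 x0 x by apply: agree_prefix; rewrite x0u.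
  have [y' [yy H']] := arrows_at_agree xx H; exists y', M; split=> //.
  by rewrite -(Sx_agree S xx) -(Sx_agree S yy).
have [e eP] := choice F; exists (\sum_(u <- words n N.+1) e u), N => x.
have -> : acts_locally S U (\sum_(u <- words n N.+1) e u) x N =
          acts_locally S U (e (prefix x N.+1)) x N.
  suff E : (\sum_(u <- words n N.+1) e u) * Qx x N.+1 = e (prefix x N.+1) * Qx x N.+1.
    by rewrite /acts_locally /acts_at E.
  have xw : prefix x N.+1 \in words n N.+1 by rewrite mem_words size_prefix.
  rewrite (bigD1_seq _ xw (words_uniq n N.+1)) mulrDl mulr_suml big_seq_cond big1 ?addr0//.
  move=> u /andP[]; rewrite mem_words => /eqP uN xu; rewrite -(eP u).1.
  have [->|[p pu]] := Sw_point rows SP u; first by rewrite !(mul0r, mulr0).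
  rewrite uN in pu; rewrite -mulrA pu (Qx_orthogonal SP) ?mulr0//.
  by move=> /prefix_agree px; rewrite pu px eqxx in xu.
have [eQ] := eP (prefix x N.+1); move=> /(_ x erefl)[[no e0]|[y [M [H e0]]]].
  by left; split=> //; rewrite e0 mul0r.
by right; exists y, M; split=> //; rewrite eQ.
Qed.

(** The bisection that prefixes the letter [i] to a point. *)
Definition gen_arrows i : set G :=
  [set g | [/\ glag g = 1, gsource g = sh (grange g) & letter (grange g) 0 = i]].

Lemma represents_gen i : represents S (gen_arrows i) (S i).
Proof.
exists 0%N => x; rewrite /acts_locally /Qx Sx1.
have [ix|ix] := boolP (A i (letter x 0)); last first.
  left; split; last by rewrite mulrA (gen_mul0 SP)// mul0r.
  move=> g xg [_ gs gi]; move/negP: ix; apply.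
  by rewrite xg// gs letter_shift -gi; exact: letter_adm.
have [y [yi yx]] := point_cons ix; right; exists y, 1%N; split; last first.
  by rewrite [Sx y 2]SxS yx yi mulrA.
split=> // g xg; split=> [[gd gs gi]|[gd rs yg]].
  split=> //; rewrite ?gs// => -[|[|//]] _; first by rewrite yi gi.
  have := xg 0%N; rewrite gs letter_shift => <-//.
  by rewrite -yx letter_shift.
by split; rewrite ?gd ?subr0// -?yg.
Qed.

Definition unit_arrows : set G := [set g | glag g = 0 /\ grange g = gsource g].

Lemma represents_units : represents S unit_arrows 1.
Proof.
exists 0%N => x; right; exists x, 0%N; split; last by rewrite mul1r.
split=> // g xg; split=> [[gd gs]|[gd rs xg']]; last by split; rewrite ?gd.
by split; rewrite ?gd ?gs.
Qed.

Lemma represents_unit_diagonal U v : U `<=` unit_arrows -> represents S U v ->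
  cuntz_krieger_diagonal S v.
Proof.
move=> Uu [N NP]; rewrite -[v]mulr1 -(sum_words SP N.+1) mulr_sumr.
apply: generated_sum => u; rewrite mem_words => /eqP uN _.
have [->|[p pu]] := Sw_point rows SP u.
  by rewrite mul0r mulr0; exact: generated0.
rewrite uN in pu; rewrite pu; have [[_ ->]|[y [M [H ->]]]] := NP p.
  exact: generated0.
have [g [/Uu[gd gs] gr gd' gs']] := arrows_at_arrow H.
rewrite -gr gs gs'; have -> : M = N by lia.
by apply: sub_generated; exists (prefix p N.+1).
Qed.

End RepresentationExistence.

(** * Images of the generating bisections *)

Lemma unit_map_cancel n (A : 'M[bool]_n) m (B : 'M[bool]_m)
    (f : sft_groupoid A -> sft_groupoid B) (fV : sft_groupoid B -> sft_groupoid A) :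
  cancel f fV -> groupoid_morphism f -> cancel (unit_map f) (unit_map fV).
Proof. by move=> fK fM x; rewrite {1}/unit_map -morphism_unit// fK. Qed.

Section ImageOfArrows.
Variables (n m : nat) (A : 'M[bool]_n) (B : 'M[bool]_m).
Variables (f : sft_groupoid A -> sft_groupoid B) (fV : sft_groupoid B -> sft_groupoid A).
Hypotheses (fK : cancel f fV) (fVK : cancel fV f)
  (fC : continuous f) (fVC : continuous fV)
  (fM : groupoid_morphism f) (fVM : groupoid_morphism fV).
Local Notation shA := (@sft_shift n A).
Local Notation shB := (@sft_shift m B).
Implicit Types U W : set (sft_groupoid A).

Let hK : cancel (unit_map f) (unit_map fV). Proof. exact: unit_map_cancel. Qed.
Let hVK : cancel (unit_map fV) (unit_map f). Proof. exact: unit_map_cancel. Qed.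

Lemma morphism_mul_lag a b g : gsource a = grange b -> grange g = grange a ->
  glag g = glag a + glag b -> gsource g = gsource b -> glag (f g) = glag (f a) + glag (f b).
Proof.
move=> ab gr gd gs; have {gr gd gs} -> : g = gmul (ab : composable a b) by exact: arrowP.
by have [fab ->] := fM.1 _ _ (ab : composable a b).
Qed.

Lemma image_arrow_mul U W : f @` arrow_mul U W = arrow_mul (f @` U) (f @` W).
Proof.
apply/seteqP; split=> [_ [g [a [b [Ua Wb ab [gr gd gs]]]] <-]|g].
  exists (f a), (f b); split; [by exists a|by exists b| |].
    by rewrite morphism_source// morphism_range// ab.
  rewrite !morphism_range// !morphism_source// gr gs; split=> //.
  exact: morphism_mul_lag.
move=> [_ [_ [[a Ua <-] [b Wb <-] fab [gr gd gs]]]].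
have ab : composable a b.
  by apply: (can_inj hK); rewrite -morphism_source// -morphism_range.
exists (gmul ab); first by exists a, b.
by have [fab' ->] := fM.1 _ _ ab; apply: arrowP.
Qed.

Lemma image_arrow_inv U : f @` arrow_inv U = arrow_inv (f @` U).
Proof.
apply/seteqP; split=> [_ [g Ug <-]|g [a Ua ag]].
  by exists (ginv g) => //; rewrite fM.2.
exists (ginv a); last by rewrite fM.2 ag; apply: arrowP => //=; rewrite opprK.
rewrite /arrow_inv/=; have -> : ginv (ginv a) = a by apply: arrowP => //=; rewrite opprK.
by [].
Qed.

Lemma image_unit_arrows U : U `<=` @unit_arrows _ A -> f @` U `<=` @unit_arrows _ B.
Proof.
move=> Uu _ [g /Uu[gd gs] <-]; have -> : g = unit_arrow (grange g) by exact: arrowP.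
by rewrite morphism_unit.
Qed.

Lemma image_all_units : f @` @unit_arrows _ A = @unit_arrows _ B.
Proof.
apply/seteqP; split; first exact: image_unit_arrows.
move=> g [gd gs]; exists (unit_arrow (unit_map fV (grange g))); first by [].
by rewrite morphism_unit// hVK; apply: arrowP.
Qed.

Lemma gen_arrows_source_inj i g g' : gen_arrows i g -> @gen_arrows n A i g' ->
  gsource g = gsource g' -> g = g'.
Proof.
move=> [gd gs gi] [gd' gs' gi'] E; apply: arrowP; rewrite ?gd ?gd'//.
apply: (@eq_glue _ _ 1); last by rewrite /= -gs -gs'.
by move=> [|//] _; rewrite gi gi'.
Qed.

(** Continuity of the inverse shows that all arrows near the image of an arrow of
    the bisection are again in the image.  They exhaust the image over a small
    cylinder because the bisection has one arrow for each source. *)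
Lemma image_gen_structured i (x : sft B) :
  exists N, structured (f @` @gen_arrows n A i) x N.
Proof.
set z := unit_map fV x; have zx : unit_map f z = x by rewrite hVK.
have [iz|iz] := boolP (A i (letter z 0)); last first.
  have hVC := unit_map_continuous fVM fVC.
  move/continuous_agreeP: hVC => /(_ x 1%N)[N NP]; exists N; left.
  move=> g' xg [g [gd gs gi] fg]; rewrite -fg in xg; move/negP: iz; apply.
  have := NP (gsource (f g)) (agree_le (leqnSn N) xg).
  rewrite morphism_source// hK => /(_ 0%N)->//.
  by rewrite gs letter_shift -gi; exact: letter_adm.
have [y0 [y0i y0z]] := point_cons iz.
pose a := shift_arrow y0; have Ua : gen_arrows i a by [].
have wa : witness 1 0 a by [].
have [k [l wf]] := witness_exists (f a).
have fs : gsource (f a) = x by rewrite morphism_source//= y0z.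
have wa' : witness 1 0 (fV (f a)) by rewrite fK.
move/continuous_nearP: (fVC) => /(_ _ _ _ _ _ wf wa' 1%N)[q qP].
have nearU b : near_arrow k l q (f a) b -> (f @` gen_arrows i) b.
  move=> /qP; rewrite fK => -[bd brs ar _]; exists (fV b); rewrite ?fVK//.
  by split; [exact: bd|exact: esym brs|rewrite -ar].
exists (l + q)%N; right; exists (grange (f a)), (k + q)%N.
have [fd frs] := wf; rewrite fs in frs.
have back b : agree (l + q).+1 x (gsource b) -> glag b = (k + q)%N%:Z - (l + q)%N%:Z ->
    iter (k + q) shB (grange b) = iter (l + q) shB (gsource b) ->
    agree (k + q).+1 (grange (f a)) (grange b) -> near_arrow k l q (f a) b.
  move=> xb bd brs ab; split.
  - by rewrite fd bd; lia.
  - apply: (@eq_glue _ _ q); last by rewrite -!iterD addnC brs addnC.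
    apply: (@agree_trans _ _ _ (iter k shB (grange (f a)))).
      by apply: agree_sym; apply: agree_iter; apply: agree_le ab; lia.
    by rewrite frs; apply: agree_iter; apply: agree_le xb; lia.
  - by apply: agree_le ab; lia.
  - by rewrite fs; apply: agree_le xb; lia.
split=> [|b xb]; first by rewrite addnC iterD frs -iterD addnC.
split=> [Ub|[bd brs ab]]; last by apply: nearU; exact: back.
have [|y [ay yb]] := @splice _ _ k (grange (f a)) (iter l shB (gsource b)).
  rewrite letter_iter add0n -xb; last by lia.
  exact: (letter_eq_iter 0 frs).
have [b' [b'r b'd b's]] : exists b' : sft_groupoid B,
    [/\ grange b' = y, glag b' = k%:Z - l%:Z & gsource b' = gsource b].
  by apply: arrow_exists; exists k, l.
have ay' : agree (k + q).+1 (grange (f a)) y.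
  rewrite -[(k + q).+1]/(k.+1 + q)%N addSnnS addnC; apply: agree_glue => //.
  by rewrite frs yb; apply: agree_iter; apply: agree_le xb; lia.
have brs' : iter (k + q) shB y = iter (l + q) shB (gsource b).
  by rewrite addnC iterD yb -iterD addnC.
have Ub' : (f @` gen_arrows i) b'.
  by apply: nearU; apply: back; rewrite ?b'r ?b's//; lia.
have -> : b = b'.
  have [g Ug gb] := Ub; have [g' Ug' gb'] := Ub'.
  rewrite -gb -gb'; congr f; apply: gen_arrows_source_inj Ug Ug' _.
  by apply: (can_inj hK); rewrite -!morphism_source// gb gb'.
by rewrite b'r b's b'd; split=> //; lia.
Qed.

End ImageOfArrows.

Section ImageFamily.
Variables (R : realType) (n m : nat) (A : 'M[bool]_n) (B : 'M[bool]_m).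
Variables (f : sft_groupoid A -> sft_groupoid B) (fV : sft_groupoid B -> sft_groupoid A).
Hypotheses (fK : cancel f fV) (fVK : cancel fV f)
  (fC : continuous f) (fVC : continuous fV)
  (fM : groupoid_morphism f) (fVM : groupoid_morphism fV).
Variables (W : cstarAlgType R) (T : 'I_m -> W).
Hypotheses (rowsB : forall i, exists j, B i j) (TP : cuntz_krieger_family B T).

Let hK : cancel (unit_map f) (unit_map fV). Proof. exact: unit_map_cancel. Qed.

Lemma represents_image_mul U U' v v' : represents T (f @` U) v ->
  represents T (f @` U') v' -> represents T (f @` arrow_mul U U') (v * v').
Proof. by move=> Uv Uv'; rewrite (image_arrow_mul fK)//; exact: represents_mul. Qed.

Lemma represents_image_inv U v :
  (forall g g', U g -> U g' -> grange g = grange g' -> gsource g = gsource g') ->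
  represents T (f @` U) v -> represents T (f @` arrow_inv U) (star v).
Proof.
move=> Uinj Uv; rewrite image_arrow_inv//; apply: represents_inv => //.
move=> _ _ [g Ug <-] [g' Ug' <-]; rewrite !morphism_range// !morphism_source//.
by move=> /(can_inj hK)/(Uinj _ _ Ug Ug')->.
Qed.

Lemma gen_arrows_range_inj i (g g' : sft_groupoid A) : gen_arrows i g -> gen_arrows i g' ->
  grange g = grange g' -> gsource g = gsource g'.
Proof. by move=> [_ -> _] [_ -> _] ->. Qed.

Definition letter_units i : set (sft_groupoid A) :=
  [set g | unit_arrows g /\ letter (grange g) 0 = i].

Lemma gen_mul_inv i :
  arrow_mul (@gen_arrows n A i) (arrow_inv (gen_arrows i)) = letter_units i.
Proof.
apply/seteqP; split=> g.
  move=> [a [b [[ad as_ ai] [/= bd bs bi] ab [gr gd gs]]]]; split; last by rewrite gr.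
  split; first by rewrite gd ad; lia.
  rewrite gr gs; apply: (@eq_glue _ _ 1); last by rewrite /= -as_ ab bs.
  by move=> [|//] _; rewrite ai bi.
move=> [[gd gs] gi]; exists (shift_arrow (grange g)), (ginv (shift_arrow (grange g))).
by split.
Qed.

Lemma gen_inv_mul i : arrow_mul (arrow_inv (@gen_arrows n A i)) (gen_arrows i) =
  [set g | exists2 j, j \in [seq j <- enum 'I_n | A i j] & letter_units j g].
Proof.
apply/seteqP; split=> g.
  move=> [a [b [[/= ad as_ ai] [bd bs bi] ab [gr gd gs]]]].
  have gu : grange g = gsource g by rewrite gr gs as_ bs ab.
  exists (letter (grange g) 0); last by split=> //; split=> //; lia.
  rewrite mem_filter mem_enum andbT gu gs bs letter_shift -bi; exact: letter_adm.
move=> [j]; rewrite mem_filter => /andP[ij _] [[gd gs] gj].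
rewrite -gj in ij; have [y [yi yg]] := point_cons ij.
exists (ginv (shift_arrow y)), (shift_arrow y).
have Uy : gen_arrows i (shift_arrow y) by [].
by split=> //=; rewrite yg gd gs.
Qed.

Lemma letter_units_mul i :
  arrow_mul (letter_units i) (@gen_arrows n A i) = gen_arrows i.
Proof.
apply/seteqP; split=> g.
  move=> [a [b [[[ad as_] ai] [bd bs bi] ab [gr gd gs]]]]; split.
  - by rewrite gd ad bd.
  - by rewrite gs gr bs -ab as_.
  - by rewrite gr ai.
move=> [gd gs gi]; exists (unit_arrow (grange g)), g; split=> //.
by split=> //=; rewrite add0r.
Qed.

(** The images of the canonical generating bisections again satisfy the
    Cuntz-Krieger relations, because these only speak of products, inverses and
    disjoint unions of bisections. *)
Lemma image_family_exists : exists N : 'I_n -> W, cuntz_krieger_family A N /\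
  forall i, represents T (f @` gen_arrows i) (N i).
Proof.
have NE i : exists v, represents T (f @` @gen_arrows n A i) v.
  apply: represents_exists => // x; exact: image_gen_structured.
have [N NP] := choice NE; exists N; split=> //.
have proj i : represents T (f @` letter_units i) (N i * star (N i)).
  rewrite -gen_mul_inv; apply: represents_image_mul => //.
  by apply: represents_image_inv => //; exact: gen_arrows_range_inj.
have disj i j g g' : i != j -> (f @` letter_units i) g -> (f @` letter_units j) g' ->
    gsource g <> gsource g'.
  move=> ij [a [[_ as_] ai] <-] [a' [[_ as_'] ai'] <-].
  rewrite !morphism_source// -as_ -as_' => /(can_inj hK) E.
  by move: ij; rewrite -ai -ai' E eqxx.
have sums r : uniq r -> represents T (f @` [set g | exists2 j, j \in r & letter_units j g])
    (\sum_(j <- r) N j * star (N j)).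
  move=> ur; apply: represents_ext (represents_sum TP ur (fun i _ => proj i) disj).
  split=> g; first by move=> [i ir [a ia <-]]; exists a => //; exists i.
  by move=> [a [i ir ia] <-]; exists i => //; exists a.
split=> [i||i].
- apply: (represents_unique rowsB TP (U := f @` gen_arrows i)) => //.
  by rewrite -{1}letter_units_mul; apply: represents_image_mul.
- rewrite -big_enum; apply: (represents_unique rowsB TP); first exact: sums (enum_uniq _).
  have -> : [set g | exists2 j, j \in enum 'I_n & letter_units j g] = @unit_arrows _ A.
    apply/seteqP; split=> g; first by move=> [j _ []].
    by move=> gu; exists (letter (grange g) 0); rewrite ?mem_enum.
  by rewrite (image_all_units fVK)//; exact: represents_units.
- have -> : \sum_j (A i j)%:R *: (N j * star (N j)) =
      \sum_(j <- [seq j <- enum 'I_n | A i j]) N j * star (N j).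
    rewrite [RHS]big_filter [RHS]big_mkcond [RHS]big_enum; apply: eq_bigr => j _.
    by case: (A i j); rewrite ?scale1r ?scale0r.
  apply: (represents_unique rowsB TP); last exact: sums (filter_uniq _ (enum_uniq _)).
  rewrite -gen_inv_mul; apply: represents_image_mul => //.
  by apply: represents_image_inv => //; exact: gen_arrows_range_inj.
Qed.

End ImageFamily.

(** * Isomorphisms of algebras from groupoid isomorphisms *)

Section Transport.
Variables (R : realType) (n m : nat) (A : 'M[bool]_n) (B : 'M[bool]_m).
Variables (f : sft_groupoid A -> sft_groupoid B) (fV : sft_groupoid B -> sft_groupoid A).
Hypotheses (fK : cancel f fV) (fVK : cancel fV f)
  (fM : groupoid_morphism f) (fVM : groupoid_morphism fV).
Variables (V W : cstarAlgType R) (S : 'I_n -> V) (T : 'I_m -> W).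
Hypotheses (rowsA : forall i, exists j, A i j) (SP : cuntz_krieger_family A S).
Hypotheses (rowsB : forall i, exists j, B i j) (TP : cuntz_krieger_family B T).
Variable psi : {lrmorphism V -> W}.
Hypotheses (psi_star : star_preserving psi)
  (psi_gen : forall i, represents T (f @` @gen_arrows n A i) (psi (S i))).
Local Notation shA := (@sft_shift n A).

Let hK : cancel (unit_map f) (unit_map fV). Proof. exact: unit_map_cancel. Qed.

Definition prefix_arrows (y : sft A) M : set (sft_groupoid A) :=
  [set g | [/\ glag g = M%:Z, gsource g = iter M shA (grange g) & agree M y (grange g)]].

Lemma represents_prefix y M : represents T (f @` prefix_arrows y M) (psi (Sx S y M)).
Proof.
elim: M => [|M IH].
  rewrite Sx0 rmorph1; have -> : prefix_arrows y 0 = @unit_arrows _ A.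
    by apply/seteqP; split=> g [gd gs]; split.
  by rewrite (image_all_units fVK)//; exact: represents_units.
rewrite SxSr rmorphM; have -> : prefix_arrows y M.+1 =
    arrow_mul (prefix_arrows y M) (gen_arrows (letter y M)).
  apply/seteqP; split=> g.
    move=> [gd gs gy].
    have [a [ar ad as_]] : exists a : sft_groupoid A,
        [/\ grange a = grange g, glag a = M%:Z & gsource a = iter M shA (grange g)].
      by apply: arrow_exists; exact: lag_rel_iter.
    exists a, (shift_arrow (iter M shA (grange g))); split=> //=.
    - by split=> //; rewrite ?ar//; apply: agree_le gy.
    - by split=> //=; rewrite letter_iter add0n gy.
    - by rewrite ar ad gs; split=> //; rewrite gd; lia.
  move=> [a [b [[ad as_ ay] [bd bs bl] ab [gr gd gs]]]]; split.
  - by rewrite gd ad bd; lia.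
  - by rewrite gs bs -ab as_ gr.
  - rewrite gr; apply: agreeS => //.
    by rewrite -bl -ab as_ letter_iter add0n.
by apply: (represents_image_mul fK).
Qed.

Lemma represents_prefix_pair y M x N :
  represents T (f @` [set g | [/\ glag g = M%:Z - N%:Z,
     iter M shA (grange g) = iter N shA (gsource g),
     agree M y (grange g) & agree N x (gsource g)]])
   (psi (Sx S y M * star (Sx S x N))).
Proof.
rewrite rmorphM /= psi_star.
have -> : [set g | [/\ glag g = M%:Z - N%:Z,
     iter M shA (grange g) = iter N shA (gsource g),
     agree M y (grange g) & agree N x (gsource g)]] =
    arrow_mul (prefix_arrows y M) (arrow_inv (prefix_arrows x N)).
  apply/seteqP; split=> g.
    move=> [gd rs gy gx].
    have [a [ar ad as_]] : exists a : sft_groupoid A,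
        [/\ grange a = grange g, glag a = M%:Z & gsource a = iter M shA (grange g)].
      by apply: arrow_exists; exact: lag_rel_iter.
    have [b [br bd bs]] : exists b : sft_groupoid A,
        [/\ grange b = iter N shA (gsource g), glag b = - N%:Z & gsource b = gsource g].
      by apply: arrow_exists; apply: lag_relN; exact: lag_rel_iter.
    exists a, b; split.
    - by split=> //; rewrite ar.
    - by split=> //=; rewrite ?bs ?br// bd opprK.
    - by rewrite as_ br.
    - by rewrite ar ad bd bs.
  move=> [a [b [[ad as_ ay] [/= bd bs bx] ab [gr gd gs]]]]; split.
  - by rewrite gd ad; lia.
  - by rewrite gr gs -as_ ab bs.
  - by rewrite gr.
  - by rewrite gs.
apply: (represents_image_mul fK) => //; first exact: represents_prefix.
apply: (represents_image_inv fK) => //; last exact: represents_prefix.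
by move=> g g' [_ -> _] [_ -> _] ->.
Qed.

(** The morphism is only known on generators, hence on the partial isometries that
    replace one prefix by another; every represented element is a sum of these. *)
Lemma represents_transport U v : represents S U v -> represents T (f @` U) (psi v).
Proof.
move=> [N NP].
have -> : psi v = \sum_(u <- words n N.+1) psi (v * (Sw S u * star (Sw S u))).
  by rewrite -rmorph_sum -mulr_sumr (sum_words SP) mulr1.
pose Uw u := [set g | U g /\ prefix (gsource g) N.+1 = u].
apply: (@represents_ext _ _ _ _ _ [set g | exists2 u, u \in words n N.+1 & (f @` Uw u) g]).
  split=> g; first by move=> [u _ [a [Ua _] <-]]; exists a.
  move=> [a Ua <-]; exists (prefix (gsource a) N.+1); last by exists a.
  by rewrite mem_words size_prefix.
apply: (represents_sum TP); first exact: words_uniq.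
- move=> u; rewrite mem_words => /eqP uN.
  have [[x xu]|no] := pselect (exists x : sft A, prefix x N.+1 = u); last first.
    have [->|[p pu]] := Sw_point rowsA SP u; last first.
      by exfalso; apply: no; exists p; rewrite -uN.
    rewrite mul0r mulr0 rmorph0; apply: represents_ext (represents0 B T).
    by split=> g; [case|move=> [a [_ au] _]; apply: no; exists (gsource a)].
  rewrite -xu -/(Sx S x N.+1) -/(Qx S x N.+1).
  have [[no ->]|[y [M [H ->]]]] := NP x.
    rewrite rmorph0; apply: represents_ext (represents0 B T); split=> g; first by case.
    by move=> [a [Ua /esym/agree_prefix ax] _]; exact: no ax Ua.
  apply: represents_ext (represents_prefix_pair y M.+1 x N.+1).
  split=> g [a + <-].
    move=> [ad rs ay ax]; exists a => //; split; last by apply/esym/prefix_agree.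
    apply/(H.2 a ax); split=> //; first by rewrite ad; lia.
    apply: (@eq_glue _ _ 1); last by rewrite -!iterD !add1n.
    move=> [|//] _; rewrite !letter_iter !add0n -ay// -ax//.
    exact: (letter_eq_iter 0 H.1).
  move=> [Ua /esym/agree_prefix ax]; exists a => //.
  have [ad rs ay] := (H.2 a ax).1 Ua; split=> //; first by rewrite ad; lia.
  by rewrite !iterS rs.
- move=> u u' g g' uu [a [_ au] <-] [a' [_ au'] <-].
  rewrite !morphism_source// => /(can_inj hK) E.
  by move: uu; rewrite -au -au' E eqxx.
Qed.

Lemma transport_diagonal : psi @` cuntz_krieger_diagonal S `<=` cuntz_krieger_diagonal T.
Proof.
move=> _ [v Dv <-]; move: v Dv; apply: generated_min.
  have [[D0 DD] DZ DM DS DC] := generated_subalgebra [set x | exists w : seq 'I_m,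
    x = (\prod_(i <- w) T i) * star (\prod_(i <- w) T i)].
  split.
  - by split=> [|x y Hx Hy]; rewrite /= ?rmorph0// rmorphD; exact: DD.
  - by move=> a x Hx; rewrite /= linearZ; exact: DZ.
  - by move=> x y Hx Hy; rewrite /= rmorphM; exact: DM.
  - by move=> x Hx; rewrite /= psi_star; exact: DS.
  - move=> x Hx; apply: DC => e /Hx[b Db xb]; exists (psi b) => //.
    by rewrite -rmorphB; apply: le_lt_trans (star_morphism_contractive psi_star _) xb.
move=> _ [u ->]; have [w0|[p pu]] := Sw_point rowsA SP u.
  by rewrite -[\prod_(i <- u) S i]/(Sw S u) w0 mul0r /= rmorph0; exact: generated0.
rewrite pu -[\prod_(i <- _) S i]/(Sx S p (size u)) /=.
apply: (represents_unit_diagonal rowsB TP); last exact: represents_prefix_pair.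
apply: (image_unit_arrows fM) => g [gd rs pr ps]; split; first by rewrite gd subrr.
apply: (@eq_glue _ _ (size u)) => //.
by apply: agree_trans ps; exact: agree_sym.
Qed.

End Transport.

(** Two morphisms that agree on generators agree, here for the identity. *)
Lemma generated_morphism_id (R : realType) (V : cstarAlgType R) (I : Type) (S : I -> V)
    (psi : {lrmorphism V -> V}) : star_preserving psi ->
  cstar_generated (range S) = [set: V] -> (forall i, psi (S i) = S i) -> psi =1 id.
Proof.
move=> psi_star SV psiS x; have : cstar_generated (range S) x by rewrite SV.
apply: (@generated_min _ _ _ [set v | psi v = v]) => {x}; last by move=> _ [i _ <-].
split.
- by split=> [|x y /= Hx Hy]; rewrite /= ?rmorph0// rmorphD /= Hx Hy.
- by move=> a x /= Hx; rewrite linearZ /= Hx.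
- by move=> x y /= Hx Hy; rewrite rmorphM /= Hx Hy.
- by move=> x /= Hx; rewrite psi_star Hx.
move=> x Hx; apply/eqP; rewrite -subr_eq0; apply/eqP.
apply: (lipschitz_closed (f := fun v => psi v - v) (K := 2)) => //.
  move=> v w; rewrite subrACA -rmorphB; apply: le_trans (cnormB _ _) _.
  by have := star_morphism_contractive psi_star (v - w); lra.
by move=> e /Hx[b /= pb xb]; exists b => //; rewrite pb subrr.
Qed.

(** The universal properties provide morphisms in both directions from the images
    of the generating bisections.  Their composites fix the generators, because an
    element is determined by the set of arrows that it represents. *)
Lemma diagonal_isomorphic_of_isomorphic (R : realType) n (A : 'M[bool]_n) m (B : 'M[bool]_m)
    (OA OB : cstarAlgType R) (S : 'I_n -> OA) (T : 'I_m -> OB) :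
  (forall i, exists j, A i j) -> (forall i, exists j, B i j) ->
  cuntz_krieger_algebra A S -> cuntz_krieger_algebra B T ->
  isomorphic_groupoids A B -> diagonal_preserving_isomorphic S T.
Proof.
move=> rA rB [SP Sgen Suniv] [TP Tgen Tuniv] [f [fV [[fK fVK fC fVC] fM fVM]]].
have [N [NP NR]] := image_family_exists fK fVK fVC fM fVM rB TP.
have [N' [NP' NR']] := image_family_exists fVK fK fC fVM fM rA SP.
have [psi psis psiS] := Suniv _ _ NP.
have [phi phis phiT] := Tuniv _ _ NP'.
have psi_gen i : represents T (f @` @gen_arrows n A i) (psi (S i)) by rewrite psiS.
have phi_gen i : represents S (fV @` @gen_arrows m B i) (phi (T i)) by rewrite phiT.
have phi_psi : cancel psi phi.
  move=> x; apply: (generated_morphism_id (psi := phi \o psi) _ Sgen) => [v|i] /=.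
    by rewrite psis phis.
  have := represents_transport fVK fK fVM fM rB TP rA SP phis phi_gen (psi_gen i).
  rewrite image_comp (_ : fV \o f = id) ?image_id; last by apply/funext => g /=.
  by move/(represents_unique rA SP); apply; exact: represents_gen.
have psi_phi : cancel phi psi.
  move=> x; apply: (generated_morphism_id (psi := psi \o phi) _ Tgen) => [v|i] /=.
    by rewrite phis psis.
  have := represents_transport fK fVK fM fVM rA SP rB TP psis psi_gen (phi_gen i).
  rewrite image_comp (_ : f \o fV = id) ?image_id; last by apply/funext => g /=.
  by move/(represents_unique rB TP); apply; exact: represents_gen.
exists psi; split=> //; first by exists phi.
apply/seteqP; split; first exact: (transport_diagonal fK fVK).
move=> v Dv; exists (phi v); last exact: psi_phi.
have := transport_diagonal fVK fK fVM fM rB TP rA SP phis phi_gen; apply.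
by exists v.
Qed.

(** * Square summable functions *)

Section SquareSummable.
Variables (R : realType) (I : choiceType).

Definition sqnorm (z : R[i]) : R := complex.Re z ^+ 2 + complex.Im z ^+ 2.

Lemma sqnorm_ge0 z : 0 <= sqnorm z. Proof. by rewrite addr_ge0 ?sqr_ge0. Qed.

Lemma sqnormM a z : sqnorm (a * z) = sqnorm a * sqnorm z.
Proof. by case: a z => [a b] [c d]; rewrite /sqnorm /=; ring. Qed.

Lemma sqnorm_parallelogram z w : sqnorm (z + w) + sqnorm (z - w) =
  (sqnorm z + sqnorm z) + (sqnorm w + sqnorm w).
Proof. by case: z w => [a b] [c d]; rewrite /sqnorm /=; ring. Qed.

Lemma sqnormD_le z w : sqnorm (z + w) <= 2 * sqnorm z + 2 * sqnorm w.
Proof. by have := sqnorm_parallelogram z w; have := sqnorm_ge0 (z - w); lra. Qed.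

Lemma sqnorm_eq0 z : sqnorm z = 0 -> z = 0.
Proof.
case: z => a b /eqP; rewrite /sqnorm /= paddr_eq0 ?sqr_ge0// !sqrf_eq0.
by move=> /andP[/eqP-> /eqP->].
Qed.

Definition sqsum (f : I -> R[i]) : \bar R := \esum_(x in [set: I]) (sqnorm (f x))%:E.

Lemma sqsum_ge0 f : (0 <= sqsum f)%E.
Proof. by apply: esum_ge0 => x _; rewrite lee_fin sqnorm_ge0. Qed.

Lemma esumZ_le (c : R) (a : I -> R) : 0 <= c -> (forall x, 0 <= a x) ->
  (\esum_(x in [set: I]) (c * a x)%:E <= c%:E * \esum_(x in [set: I]) (a x)%:E)%E.
Proof.
move=> c0 a0; apply: ge_ereal_sup => _ [X [fX _] <-].
rewrite [leLHS](_ : _ = c%:E * \sum_(x \in X) (a x)%:E)%E; last first.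
  by rewrite ge0_mule_fsumr//= => x; rewrite lee_fin.
rewrite lee_wpmul2l ?lee_fin// esum_ge//; exists X => //.
Qed.

Definition l2_pred : {pred I -> R[i]} := fun f => (sqsum f < +oo)%E.

Lemma l2_submod_closed : submod_closed l2_pred.
Proof.
split=> [|a f g].
  rewrite unfold_in /l2_pred /sqsum esum1// => x _.
  by rewrite /sqnorm /= expr0n addr0.
rewrite !unfold_in /l2_pred => fI gI.
apply: (@le_lt_trans _ _ ((2 * sqnorm a)%:E * sqsum f + 2%:E * sqsum g)%E).
  apply: (@le_trans _ _ (\esum_(x in [set: I]) ((2 * sqnorm a * sqnorm (f x))%:E +
      (2 * sqnorm (g x))%:E))%E).
    apply: le_esum => x _; rewrite -EFinD lee_fin.
    by have := sqnormD_le (a * f x) (g x); rewrite sqnormM mulrA.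
  rewrite esumD; last 2 first.
  - by move=> x _; rewrite lee_fin !mulr_ge0 ?sqnorm_ge0.
  - by move=> x _; rewrite lee_fin !mulr_ge0 ?sqnorm_ge0.
  apply: leeD; apply: esumZ_le => *; rewrite ?mulr_ge0 ?sqnorm_ge0//.
rewrite lte_add_pinfty//; rewrite lte_mul_pinfty// ?lee_fin ?mulr_ge0 ?sqnorm_ge0//.
Qed.

HB.instance Definition _ := GRing.isSubmodClosed.Build _ _ l2_pred l2_submod_closed.

Record l2 := L2 { l2val :> I -> R[i]; l2valP : l2val \in l2_pred }.

HB.instance Definition _ := [isSub for l2val].
HB.instance Definition _ := [Choice of l2 by <:].
HB.instance Definition _ := [SubChoice_isSubLmodule of l2 by <:].

Lemma l2D (f g : l2) x : (f + g) x = f x + g x. Proof. by []. Qed.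
Lemma l2B (f g : l2) x : (f - g) x = f x - g x. Proof. by []. Qed.
Lemma l2Z a (f : l2) x : (a *: f) x = a * f x. Proof. by []. Qed.
Lemma l2_ext (f g : l2) : (forall x, f x = g x) -> f = g.
Proof. by move=> fg; apply/val_inj/funext. Qed.

Definition N2 (f : l2) : R := fine (sqsum f).

Implicit Types f g h : l2.

Lemma sqsumE (f : l2) : sqsum f = (N2 f)%:E.
Proof.
rewrite /N2 fineK// ge0_fin_numE ?sqsum_ge0//; exact: (l2valP f).
Qed.

Lemma N2_ge0 f : 0 <= N2 f. Proof. exact/fine_ge0/sqsum_ge0. Qed.

(** Sums of nonnegative terms can be rearranged, so identities between squared moduli
    of the coordinates give identities between squared norms; writing all terms
    with a positive sign avoids subtracting infinite sums. *)
Lemma N2_balance (r s : seq l2) :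
  (forall x, \sum_(f <- r) sqnorm (l2val f x) = \sum_(f <- s) sqnorm (l2val f x)) ->
  \sum_(f <- r) N2 f = \sum_(f <- s) N2 f.
Proof.
move=> rs; have E (u : seq l2) :
    (\sum_(f <- u) N2 f)%:E = \esum_(x in [set: I]) (\sum_(f <- u) sqnorm (l2val f x))%:E.
  rewrite -sumEFin; under eq_bigr do rewrite -sqsumE.
  rewrite -esum_sum; first by apply: eq_esum => x _; rewrite sumEFin.
  by move=> x f _ _; rewrite lee_fin sqnorm_ge0.
by apply: EFin_inj; rewrite !E; apply: eq_esum => x _; rewrite rs.
Qed.

Lemma sqnorm_le_N2 (f : l2) x : sqnorm (f x) <= N2 f.
Proof.
rewrite -lee_fin -sqsumE; apply: esum_ge; exists [set x].
  by split => //; exact: finite_set1.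
by rewrite fsbig_set1.
Qed.

Lemma N2_eq0 f : N2 f = 0 -> f = 0.
Proof.
move=> f0; apply: l2_ext => x; apply: sqnorm_eq0; apply/eqP.
by rewrite eq_le sqnorm_ge0 andbT -f0 sqnorm_le_N2.
Qed.

Lemma N2Z a f : N2 (a *: f) = sqnorm a * N2 f.
Proof.
have le b g : N2 (b *: g) <= sqnorm b * N2 g.
  rewrite -lee_fin EFinM -!sqsumE.
  apply: le_trans (esumZ_le (sqnorm_ge0 b) (fun x => sqnorm_ge0 (g x))).
  by apply: le_esum => x _; rewrite l2Z sqnormM.
apply/eqP; rewrite eq_le le/=; have [->|a0] := eqVneq a 0.
  by rewrite /sqnorm /= expr0n addr0 mul0r N2_ge0.
have := le a^-1 (a *: f); rewrite scalerA mulVf// scale1r.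
have qa : 0 < sqnorm a.
  by rewrite lt_neqAle sqnorm_ge0 andbT eq_sym; apply: contra_neq a0; exact: sqnorm_eq0.
have E : sqnorm a^-1 * sqnorm a = 1.
  by rewrite -sqnormM mulVf// /sqnorm /= expr1n expr0n addr0.
have -> : sqnorm a^-1 = (sqnorm a)^-1 by rewrite -[LHS](mulfK (lt0r_neq0 qa)) E div1r.
by rewrite mulrC ler_pdivlMr// mulrC.
Qed.

Lemma N20 : N2 0 = 0.
Proof. by have := N2Z 0 0; rewrite scale0r /sqnorm/= expr0n addr0 mul0r. Qed.

(** The real part of the inner product, by polarization.  It determines adjoints of
    complex linear operators, and its properties follow from identities between
    squared norms. *)
Definition ip (f g : l2) : R := (N2 (f + g) - N2 f - N2 g) / 2.

Lemma ipC f g : ip f g = ip g f.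
Proof. by rewrite /ip [g + f]addrC; lra. Qed.

Lemma ip_self f : ip f f = N2 f.
Proof.
have -> : ip f f = (N2 (2%:R *: f) - N2 f - N2 f) / 2 by rewrite scaler_nat mulr2n.
have -> : N2 (2%:R *: f) = 4 * N2 f.
  by rewrite N2Z -(rmorph_nat (@real_complex R)) /sqnorm/= expr0n addr0; ring.
by lra.
Qed.

Lemma ipDl f g h : ip (f + g) h = ip f h + ip g h.
Proof.
have := @N2_balance [:: f + g + h; f; g; h] [:: f + g; g + h; f + h].
rewrite !big_cons !big_nil /ip => E.
suff : N2 (f + g + h) + (N2 f + (N2 g + (N2 h + 0))) =
    N2 (f + g) + (N2 (g + h) + (N2 (f + h) + 0)) by lra.
apply: E => x; rewrite !big_cons !big_nil !l2D.
by case: (f x) (g x) (h x) => [a b] [c d] [e k]; rewrite /sqnorm /=; ring.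
Qed.

Lemma ipZl a f g : ip (a *: f) g = ip f (a^*%C *: g).
Proof.
have := @N2_balance [:: a *: f + g; f; a^*%C *: g] [:: f + a^*%C *: g; a *: f; g].
rewrite !big_cons !big_nil /ip => E.
suff : N2 (a *: f + g) + (N2 f + (N2 (a^*%C *: g) + 0)) =
    N2 (f + a^*%C *: g) + (N2 (a *: f) + (N2 g + 0)) by lra.
apply: E => x; rewrite !big_cons !big_nil !l2D !l2Z.
by case: a (f x) (g x) => [a b] [c d] [e k]; rewrite /sqnorm /=; ring.
Qed.

Lemma ipNl f g : ip (- f) g = - ip f g.
Proof.
have := ipDl f (- f) g; rewrite subrr; have -> : ip 0 g = 0; last by lra.
by rewrite /ip add0r N20; lra.
Qed.

Lemma ipBl f g h : ip (f - g) h = ip f h - ip g h.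
Proof. by rewrite ipDl ipNl. Qed.

Lemma ipDr f g h : ip f (g + h) = ip f g + ip f h.
Proof. by rewrite ipC ipDl !(ipC f). Qed.

Lemma ipBr f g h : ip f (g - h) = ip f g - ip f h.
Proof. by rewrite ipC ipBl !(ipC f). Qed.

Lemma ip_nondegenerate f g : (forall h, ip h f = ip h g) -> f = g.
Proof.
by move=> fg; apply/eqP; rewrite -subr_eq0; apply/eqP/N2_eq0; rewrite -ip_self ipBr fg subrr.
Qed.

Definition n2 (f : l2) : R := Num.sqrt (N2 f).

Lemma n2_ge0 f : 0 <= n2 f. Proof. exact: sqrtr_ge0. Qed.

Lemma n2_sqr f : n2 f ^+ 2 = N2 f. Proof. by rewrite sqr_sqrtr ?N2_ge0. Qed.

Lemma N2D f g : N2 (f + g) = N2 f + 2 * ip f g + N2 g.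
Proof. by rewrite /ip; lra. Qed.

Lemma cauchy_schwarz f g : ip f g <= n2 f * n2 g.
Proof.
have half (u v : l2) : ip u v <= (N2 u + N2 v) / 2.
  have := N2_ge0 (u - v); rewrite -[u - v]/(u + (- v)) /ip.
  have := @N2_balance [:: u + v; u - v] [:: u; u; v; v].
  rewrite !big_cons !big_nil => E.
  suff : N2 (u + v) + (N2 (u - v) + 0) = N2 u + (N2 u + (N2 v + (N2 v + 0))) by lra.
  apply: E => x; rewrite !big_cons !big_nil l2D l2B !addr0 sqnorm_parallelogram.
  by rewrite !addrA.
have [f0|f0] := eqVneq (n2 f) 0.
  have -> : f = 0 by apply: N2_eq0; rewrite -n2_sqr f0 expr0n.
  have -> : ip 0 g = 0 by have := ipNl 0 g; rewrite oppr0; lra.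
  by rewrite mulr_ge0 ?n2_ge0.
have [g0|g0] := eqVneq (n2 g) 0.
  have -> : g = 0 by apply: N2_eq0; rewrite -n2_sqr g0 expr0n.
  have -> : ip f 0 = 0 by have := ipNl 0 f; rewrite oppr0 (ipC 0); lra.
  by rewrite mulr_ge0 ?n2_ge0.
(* rescale both vectors to the same norm *)
have fp : 0 < n2 f by rewrite lt_neqAle n2_ge0 eq_sym f0.
have gp : 0 < n2 g by rewrite lt_neqAle n2_ge0 eq_sym g0.
pose c := Num.sqrt (n2 g / n2 f).
have c2 : c ^+ 2 = n2 g / n2 f by rewrite sqr_sqrtr ?divr_ge0 ?n2_ge0.
have c0 : c != 0 by rewrite -sqrf_eq0 c2 mulf_neq0 ?invr_neq0.
have -> : ip f g = ip (c%:C%C *: f) ((c^-1)%:C%C *: g).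
  by rewrite ipZl conjc_real scalerA -rmorphM/= mulfV// scale1r.
apply: le_trans (half _ _) _; rewrite !N2Z /sqnorm/= !expr0n !addr0 exprVn c2.
rewrite -!n2_sqr le_eqVlt; apply/orP; left; apply/eqP.
by field; rewrite f0 g0.
Qed.

Lemma n2D f g : n2 (f + g) <= n2 f + n2 g.
Proof.
rewrite -(@ler_pXn2r _ 2)// ?nnegrE ?addr_ge0 ?n2_ge0// n2_sqr N2D sqrrD !n2_sqr.
by rewrite -mulr_natl; have := cauchy_schwarz f g; lra.
Qed.

Lemma n2Z a f : n2 (a *: f) = complex.Re `|a| * n2 f.
Proof. by rewrite /n2 N2Z sqrtrM ?sqnorm_ge0// normc_def. Qed.

Lemma n2B f g : n2 (f - g) = n2 (g - f).
Proof. by rewrite -opprB -scaleN1r n2Z normrN1 mul1r. Qed.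

Lemma n2_0 : n2 0 = 0.
Proof. by rewrite /n2 N20 sqrtr0. Qed.

Lemma cauchy_real_limit (v : nat -> R) :
  (forall e : R, 0 < e -> exists N, forall p q, (N <= p)%N -> (N <= q)%N ->
     `|v p - v q| < e) -> exists l : R, v @ \oo --> l.
Proof.
move=> vC; have /cvg_ex[l vl] : cvg (v @ \oo).
  apply: cauchy_cvg; apply: cauchy_exP => e /= e0; have [N NP] := vC e e0.
  exists (v N); exists N => // q /= Nq; rewrite -ball_normE /=; exact: NP.
by exists l.
Qed.

(** The limit is taken coordinatewise, and the norm estimates pass to the limit on
    finite sets of coordinates. *)
Lemma l2_complete (u : nat -> l2) :
  (forall e : R, 0 < e -> exists N, forall p q, (N <= p)%N -> (N <= q)%N ->
     n2 (u p - u q) < e) ->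
  exists l, forall e : R, 0 < e -> exists N, forall p, (N <= p)%N -> n2 (u p - l) < e.
Proof.
move=> uC.
have coord (r : R[i] -> R) : (forall z w, r (z - w) = r z - r w) ->
    (forall z, r z ^+ 2 <= sqnorm z) -> exists l : I -> R,
    forall x, (fun p => r (u p x)) @ \oo --> l x.
  move=> rB rq.
  suff /choice[l lP] : forall x, exists l : R, (fun p => r (u p x)) @ \oo --> l by exists l.
  move=> x; apply: cauchy_real_limit => e /uC[N NP].
  exists N => p q Np Nq; rewrite -rB -l2B; apply: le_lt_trans (NP p q Np Nq).
  rewrite -(@ler_pXn2r _ 2)// ?nnegrE ?n2_ge0// n2_sqr real_normK ?num_real//.
  exact: le_trans (rq _) (sqnorm_le_N2 _ _).
have [a aP] : exists l : I -> R, forall x, (fun p => complex.Re (u p x)) @ \oo --> l x.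
  by apply: coord => [[? ?] [? ?]//|z]; rewrite /sqnorm lerDl sqr_ge0.
have [b bP] : exists l : I -> R, forall x, (fun p => complex.Im (u p x)) @ \oo --> l x.
  by apply: coord => [[? ?] [? ?]//|z]; rewrite /sqnorm lerDr sqr_ge0.
pose l x : R[i] := (a x +i* b x)%C.
have bound (e : R) : 0 < e -> exists N, forall p, (N <= p)%N ->
    (sqsum (fun x => (u p x - l x)%R) <= (e ^+ 2)%:E)%E.
  move=> e0; have [N NP] := uC e e0; exists N => p Np.
  apply: ge_ereal_sup => _ [X [fX _] <-]; rewrite fsbig_finite//= sumEFin lee_fin.
  have lim (r : seq I) : (fun q => \sum_(x <- r) sqnorm (u p x - u q x)) @ \oo -->
      \sum_(x <- r) sqnorm (u p x - l x).
    elim: r => [|x r IH].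
      under eq_fun do rewrite big_nil; rewrite big_nil; exact: cvg_cst.
    under eq_fun do rewrite big_cons; rewrite big_cons; apply: cvgD => //.
    rewrite (_ : sqnorm (u p x - l x) =
      (complex.Re (u p x) - a x) ^+ 2 + (complex.Im (u p x) - b x) ^+ 2); last first.
      by rewrite /l; case: (u p x).
    rewrite (_ : (fun q => _) = (fun q => (complex.Re (u p x) - complex.Re (u q x)) ^+ 2 +
      (complex.Im (u p x) - complex.Im (u q x)) ^+ 2)); last first.
      by apply/funext => q; case: (u p x) (u q x) => [? ?] [? ?].
    apply: cvgD; rewrite expr2; under eq_fun do rewrite expr2.
      by apply: cvgM; apply: cvgB; [exact: cvg_cst|exact: aP|exact: cvg_cst|exact: aP].
    by apply: cvgM; apply: cvgB; [exact: cvg_cst|exact: bP|exact: cvg_cst|exact: bP].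
  rewrite -(cvg_lim _ (lim _))//; apply: limr_le; first by apply/cvg_ex; eexists; exact: lim.
  exists N => // q /= Nq; apply: (@le_trans _ _ (N2 (u p - u q))).
    rewrite -lee_fin -sqsumE; apply: esum_ge; exists X => //.
    by rewrite fsbig_finite//= sumEFin.
  by rewrite -n2_sqr ler_pXn2r ?nnegrE ?n2_ge0 ?(ltW e0)// ltW// NP.
have l2l : l \in l2_pred.
  have [N /(_ N (leqnn N))NP] := bound 1 ltr01.
  have dl : (fun x => u N x - l x) \in l2_pred.
    by rewrite unfold_in /l2_pred; apply: le_lt_trans NP _; rewrite ltry.
  have -> : l = val (u N - L2 dl).
    by apply/funext => x; rewrite /= -[RHS]/(u N x - (u N x - l x)) opprB addrC subrK.
  exact: valP.
exists (L2 l2l) => e e0; have e2 : 0 < e / 2 by rewrite divr_gt0.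
have [N NP] := bound _ e2; exists N => p /NP H.
apply: (@le_lt_trans _ _ (e / 2)); last by lra.
rewrite -(@ler_pXn2r _ 2)// ?nnegrE ?n2_ge0 ?(ltW e2)// n2_sqr -lee_fin -sqsumE.
exact: H.
Qed.

End SquareSummable.

(** * The C*-algebra of bounded operators *)

Section Operators.
Variables (R : realType) (I : choiceType).
Local Notation E := (l2 R I).
Implicit Types (f g h : E).

Definition adjoint_pair (T T' : E -> E) := forall f g, ip (T f) g = ip f (T' g).

Definition bounded_by (T : E -> E) (K : R) := forall f, n2 (T f) <= K * n2 f.

(** The existence of an adjoint is part of the definition, in place of the Riesz
    representation theorem. *)
Definition op_pred : {pred E -> E} := fun T => `[<
  [/\ forall a f g, T (a *: f + g) = a *: T f + T g,
      exists T', adjoint_pair T T' & exists2 K, 0 <= K & bounded_by T K] >].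

Lemma ipZr a f g : ip f (a *: g) = ip (a^*%C *: f) g.
Proof. by rewrite ipZl conjcK. Qed.

Lemma n2Z_sqr (a : R[i]) f : n2 (a *: f) = Num.sqrt (sqnorm a) * n2 f.
Proof. by rewrite n2Z normc_def. Qed.

Lemma op_submod_closed : submod_closed op_pred.
Proof.
split=> [|a T U].
  apply/asboolP; split=> [b f g||]; rewrite ?scaler0 ?addr0//.
    exists (fun _ => 0) => f g.
    have -> : (0 : E -> E) f = 0 by [].
    by rewrite -(subrr f) ipBl ipBr; lra.
  by exists 0 => // f; rewrite n2_0 mul0r.
move=> /asboolP[Tl [T' TT'] [K K0 TK]] /asboolP[Ul [U' UU'] [L L0 UL]].
have aTU f : (a *: T + U) f = a *: T f + U f by [].
apply/asboolP; split=> [b f g||].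
- rewrite !aTU Tl Ul !scalerDr !scalerA mulrC.
  by rewrite addrACA.
- exists (fun g => T' (a^*%C *: g) + U' g) => f g.
  by rewrite aTU ipDl ipZl TT' UU' ipDr.
exists (Num.sqrt (sqnorm a) * K + L); first by rewrite addr_ge0 ?mulr_ge0 ?sqrtr_ge0.
move=> f; rewrite aTU; apply: le_trans (n2D _ _) _; rewrite mulrDl lerD//.
by rewrite n2Z_sqr -mulrA ler_wpM2l ?sqrtr_ge0.
Qed.

HB.instance Definition _ := GRing.isSubmodClosed.Build _ _ op_pred op_submod_closed.

(** The base point makes the index set nonempty and the algebra nonzero. *)
Record op (x0 : I) := Op { opval :> E -> E; opvalP : opval \in op_pred }.

Section OperatorAlgebra.
Variable x0 : I.
Local Notation L := (op x0).
Implicit Types T U : L.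

HB.instance Definition _ := [isSub for @opval x0].
HB.instance Definition _ := [Choice of L by <:].
HB.instance Definition _ := [SubChoice_isSubLmodule of L by <:].

Lemma op_ext T U : (forall f, T f = U f) -> T = U.
Proof. by move=> TU; apply/val_inj/funext. Qed.

Lemma opD T U f : (T + U) f = T f + U f. Proof. by []. Qed.
Lemma opB T U f : (T - U) f = T f - U f. Proof. by []. Qed.
Lemma opZ a T f : (a *: T) f = a *: T f. Proof. by []. Qed.

Lemma op_linear T a f g : T (a *: f + g) = a *: T f + T g.
Proof. by have /asboolP[+ _ _] := opvalP T; apply. Qed.

Lemma op0 T : T 0 = 0.
Proof. by have := op_linear T (-1) 0 0; rewrite scaler0 addr0 scaleN1r addNr. Qed.

Lemma op_add T f g : T (f + g) = T f + T g.
Proof. by have := op_linear T 1 f g; rewrite !scale1r. Qed.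

Lemma op_scale T a f : T (a *: f) = a *: T f.
Proof. by have := op_linear T a f 0; rewrite !addr0 op0 addr0. Qed.

Lemma op_one_subproof : id \in op_pred.
Proof.
apply/asboolP; split=> //; first by exists id.
by exists 1 => // f; rewrite mul1r.
Qed.

Definition op_one : L := Op x0 op_one_subproof.

Lemma op_mul_subproof T U : (fun f => T (U f)) \in op_pred.
Proof.
have /asboolP[_ [T' TT'] [K K0 TK]] := opvalP T.
have /asboolP[_ [U' UU'] [M M0 UM]] := opvalP U.
apply/asboolP; split=> [a f g||]; first by rewrite !op_linear.
  by exists (fun g => U' (T' g)) => f g; rewrite TT' UU'.
exists (K * M); first by rewrite mulr_ge0.
by move=> f; apply: le_trans (TK _) _; rewrite -mulrA ler_wpM2l.
Qed.

Definition op_mul T U : L := Op x0 (op_mul_subproof T U).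

Lemma op_compE T U f : op_mul T U f = T (U f). Proof. by []. Qed.

Lemma op_mulA : associative op_mul. Proof. by move=> T U W; apply: op_ext => f; reflexivity. Qed.
Lemma op_mul1l : left_id op_one op_mul. Proof. by move=> T; apply: op_ext => f; reflexivity. Qed.
Lemma op_mul1r : right_id op_one op_mul. Proof. by move=> T; apply: op_ext => f; reflexivity. Qed.
Lemma op_mulDl : left_distributive op_mul +%R.
Proof. by move=> T U W; apply: op_ext => f; rewrite opD !op_compE opD. Qed.
Lemma op_mulDr : right_distributive op_mul +%R.
Proof. by move=> T U W; apply: op_ext => f; rewrite opD !op_compE opD op_add. Qed.

Lemma delta_subproof : (fun x => if x == x0 then 1 else 0 : R[i]) \in @l2_pred R I.
Proof.
rewrite unfold_in /l2_pred /sqsum.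
have -> : \esum_(x in [set: I]) (sqnorm (if x == x0 then 1 else 0 : R[i]))%:E =
    \esum_(x in [set x0]) (1 : R)%:E.
  rewrite [RHS]esum_mkcond; apply: eq_esum => x _; rewrite in_set1.
  by case: eqP => _; rewrite /sqnorm /= ?expr1n expr0n ?addr0.
by rewrite esum_set1 ?lee_fin// ltry.
Qed.

Lemma op_one_neq0 : op_one != 0.
Proof.
apply/eqP => /(congr1 (fun T : L => l2val (T (L2 delta_subproof)) x0)) /=.
by rewrite eqxx => /eqP; rewrite oner_eq0.
Qed.

HB.instance Definition _ := GRing.Zmodule_isNzRing.Build L
  op_mulA op_mul1l op_mul1r op_mulDl op_mulDr op_one_neq0.

Lemma op_mulE T U f : (T * U) f = T (U f). Proof. by []. Qed.
Lemma op_1E f : (1 : L) f = f. Proof. by []. Qed.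

Lemma op_scaleAl (a : R[i]) T U : a *: (T * U) = a *: T * U.
Proof. by apply: op_ext => f; rewrite opZ !op_mulE opZ. Qed.

HB.instance Definition _ := GRing.Lmodule_isLalgebra.Build R[i] L op_scaleAl.

Lemma op_scaleAr (a : R[i]) T U : a *: (T * U) = T * (a *: U).
Proof. by apply: op_ext => f; rewrite opZ !op_mulE opZ op_scale. Qed.

HB.instance Definition _ := GRing.Lalgebra_isAlgebra.Build R[i] L op_scaleAr.

Lemma adjoint_exists T : exists T' : L, adjoint_pair T T'.
Proof.
have /asboolP[_ [T' TT'] [K K0 TK]] := opvalP T.
suff T'P : T' \in op_pred by exists (Op x0 T'P).
apply/asboolP; split.
- move=> a f g; apply: ip_nondegenerate => h; rewrite -TT' !ipDr.
  congr (_ + _); last exact: TT'.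
  by rewrite !ipZr -TT' op_scale.
- by exists T => f g; rewrite ipC -TT' ipC.
exists K => // f; have [->|fn] := eqVneq (n2 (T' f)) 0; first by rewrite mulr_ge0 ?n2_ge0.
have fp : 0 < n2 (T' f) by rewrite lt_neqAle eq_sym fn n2_ge0.
rewrite -(ler_pM2l fp) -expr2 n2_sqr -ip_self -TT'.
apply: le_trans (cauchy_schwarz _ _) _; rewrite mulrCA mulrA ler_wpM2r ?n2_ge0//.
Qed.

Definition op_star T : L := sval (cid (adjoint_exists T)).

Lemma op_starP T f g : ip (T f) g = ip f (op_star T g).
Proof. by rewrite /op_star; case: cid. Qed.

Lemma op_star_unique T (T' : E -> E) f : adjoint_pair T T' -> op_star T f = T' f.
Proof. by move=> TT'; apply: ip_nondegenerate => h; rewrite -op_starP TT'. Qed.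

Lemma op_star_ext T U : adjoint_pair T U -> op_star T = U.
Proof. by move=> TU; apply: op_ext => f; exact: op_star_unique. Qed.

Lemma op_starK : involutive op_star.
Proof. by move=> T; apply: op_star_ext => f g; rewrite ipC -op_starP ipC. Qed.

Lemma op_starD : {morph op_star : T U / T + U}.
Proof.
by move=> T U; apply: op_star_ext => f g; rewrite !opD ipDl ipDr !op_starP.
Qed.

Lemma op_starZ (a : R[i]) T : op_star (a *: T) = (a^*)%C *: op_star T.
Proof. by apply: op_star_ext => f g; rewrite !opZ ipZl op_starP op_scale. Qed.

Lemma op_starM T U : op_star (T * U) = op_star U * op_star T.
Proof. by apply: op_star_ext => f g; rewrite !op_mulE !op_starP. Qed.

Definition op_norm T : R := inf [set K | 0 <= K /\ bounded_by T K].

Lemma op_norm_nonempty T : [set K | 0 <= K /\ bounded_by T K] !=set0.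
Proof. by have /asboolP[_ _ [K K0 TK]] := opvalP T; exists K. Qed.

Lemma op_norm_le T K : 0 <= K -> bounded_by T K -> op_norm T <= K.
Proof. by move=> K0 TK; apply: ge_inf => //; exists 0 => ? []. Qed.

Lemma op_norm_ge0 T : 0 <= op_norm T.
Proof. by apply: lb_le_inf; [exact: op_norm_nonempty|move=> ? []]. Qed.

Lemma op_norm_bound T : bounded_by T (op_norm T).
Proof.
move=> f; have [f0|fn] := eqVneq (n2 f) 0.
  have -> : f = 0 by apply: N2_eq0; rewrite -n2_sqr f0 expr0n.
  by rewrite op0 n2_0 mulr0.
have fp : 0 < n2 f by rewrite lt_neqAle eq_sym fn n2_ge0.
rewrite -ler_pdivrMr//; apply: lb_le_inf; first exact: op_norm_nonempty.
by move=> K [K0 TK]; rewrite ler_pdivrMr.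
Qed.

Lemma op_normD T U : op_norm (T + U) <= op_norm T + op_norm U.
Proof.
apply: op_norm_le; first by rewrite addr_ge0 ?op_norm_ge0.
move=> f; rewrite opD mulrDl; apply: le_trans (n2D _ _) _.
by rewrite lerD ?op_norm_bound.
Qed.

Lemma op_normZ (a : R[i]) T : op_norm (a *: T) = complex.Re `|a| * op_norm T.
Proof.
have a0 (b : R[i]) : 0 <= complex.Re `|b| by rewrite normc_def sqrtr_ge0.
have le (b : R[i]) (U : L) : op_norm (b *: U) <= complex.Re `|b| * op_norm U.
  apply: op_norm_le; first by rewrite mulr_ge0 ?op_norm_ge0.
  by move=> f; rewrite opZ n2Z -mulrA ler_wpM2l ?op_norm_bound.
apply/eqP; rewrite eq_le le andTb; have [->|an] := eqVneq a 0.
  by rewrite normc_def /= expr0n addr0 sqrtr0 mul0r op_norm_ge0.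
have := le a^-1 (a *: T); rewrite scalerA mulVf// scale1r => /(ler_wpM2l (a0 a)).
rewrite mulrA; suff -> : complex.Re `|a| * complex.Re `|a^-1| = 1 by rewrite mul1r.
rewrite !normc_def /= -/(sqnorm a) -/(sqnorm a^-1) -sqrtrM ?sqnorm_ge0// -sqnormM.
by rewrite mulfV// /sqnorm /= expr1n expr0n addr0 sqrtr1.
Qed.

Lemma op_norm0_eq0 T : op_norm T = 0 -> T = 0.
Proof.
move=> T0; apply: op_ext => f; apply: N2_eq0; rewrite -n2_sqr.
have := op_norm_bound T f; rewrite T0 mul0r => H.
have -> : n2 (T f) = 0 by apply/eqP; rewrite eq_le H n2_ge0.
by rewrite expr0n.
Qed.

Lemma op_normM T U : op_norm (T * U) <= op_norm T * op_norm U.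
Proof.
apply: op_norm_le; first by rewrite mulr_ge0 ?op_norm_ge0.
move=> f; rewrite op_mulE; apply: le_trans (op_norm_bound _ _) _.
by rewrite -mulrA ler_wpM2l ?op_norm_ge0 ?op_norm_bound.
Qed.

(** [|T f|^2 = <f, T^* T f>] and the Cauchy-Schwarz inequality. *)
Lemma op_norm_star_le T : op_norm T ^+ 2 <= op_norm (op_star T * T).
Proof.
rewrite -[leRHS]sqr_sqrtr ?op_norm_ge0// ler_pXn2r ?nnegrE ?op_norm_ge0 ?sqrtr_ge0//.
apply: op_norm_le => [|f]; first exact: sqrtr_ge0.
rewrite -(@ler_pXn2r _ 2)// ?nnegrE ?mulr_ge0 ?sqrtr_ge0 ?n2_ge0//.
rewrite n2_sqr exprMn (sqr_sqrtr (op_norm_ge0 _)) -ip_self op_starP -op_mulE.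
apply: le_trans (cauchy_schwarz _ _) _; rewrite [n2 f ^+ 2]expr2 mulrA [leRHS]mulrC.
by rewrite ler_wpM2l ?n2_ge0 ?op_norm_bound.
Qed.

Lemma op_norm_star T : op_norm (op_star T) <= op_norm T.
Proof.
have H := le_trans (op_norm_star_le (op_star T)) (op_normM _ _).
rewrite op_starK expr2 in H.
have [->|Tn] := eqVneq (op_norm (op_star T)) 0; first exact: op_norm_ge0.
by rewrite ler_pM2r// in H; rewrite lt_neqAle eq_sym Tn op_norm_ge0.
Qed.

Lemma op_norm_starM T : op_norm (op_star T * T) = op_norm T ^+ 2.
Proof.
apply/eqP; rewrite eq_le op_norm_star_le andbT; apply: le_trans (op_normM _ _) _.
by rewrite expr2 ler_wpM2r ?op_norm_ge0 ?op_norm_star.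
Qed.

(** Since taking adjoints is isometric, the adjoints converge pointwise as well, and
    their limit is an adjoint of the limit. *)
Lemma op_norm_complete (u : nat -> L) :
  (forall e : R, 0 < e -> exists N, forall p q, (N <= p)%N -> (N <= q)%N ->
     op_norm (u p - u q) < e) ->
  exists l, forall e : R, 0 < e -> exists N, forall p, (N <= p)%N ->
     op_norm (u p - l) < e.
Proof.
move=> uC.
pose cvg2 (v : nat -> E) l := forall e : R, 0 < e ->
  exists N, forall p, (N <= p)%N -> n2 (v p - l) < e.
have lim (w : nat -> L) : (forall e : R, 0 < e -> exists N, forall p q,
    (N <= p)%N -> (N <= q)%N -> op_norm (w p - w q) < e) ->
    exists l : E -> E, forall f, cvg2 (fun p => w p f) (l f).
  move=> wC; suff /choice[l lP] : forall f, exists l, cvg2 (fun p => w p f) l by exists l.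
  move=> f; apply: l2_complete => e e0.
  have d0 : 0 < e / (n2 f + 1) by rewrite divr_gt0// ltr_wpDl ?n2_ge0.
  have [N NP] := wC _ d0; exists N => p q Np Nq; rewrite -opB.
  apply: le_lt_trans (op_norm_bound _ _) _.
  apply: (@le_lt_trans _ _ (e / (n2 f + 1) * n2 f)).
    by rewrite ler_wpM2r ?n2_ge0// ltW// NP.
  rewrite mulrAC ltr_pdivrMr ?ltr_wpDl ?n2_ge0// ltr_pM2l//.
  by lra.
have [l lP] := lim u uC.
have [l' lP'] : exists l' : E -> E, forall f, cvg2 (fun p => op_star (u p) f) (l' f).
  apply: (lim (fun p => op_star (u p))) => e /uC[N NP]; exists N => p q Np Nq.
  have -> : op_star (u p) - op_star (u q) = op_star (u p - u q).
    by rewrite op_starD -scaleN1r -[- u q]scaleN1r op_starZ; congr (_ + _ *: _);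
       rewrite rmorphN rmorph1.
  by apply: le_lt_trans (op_norm_star _) _; exact: NP.
have unique v a b : cvg2 v a -> cvg2 v b -> a = b.
  move=> va vb; apply/eqP; rewrite -subr_eq0; apply/eqP/N2_eq0.
  suff : n2 (a - b) = 0 by rewrite -n2_sqr => ->; rewrite expr0n.
  apply/eqP; rewrite eq_le n2_ge0 andbT leNgt; apply/negP => ab.
  have d0 : 0 < n2 (a - b) / 2 by rewrite divr_gt0.
  have [N NP] := va _ d0; have [M MP] := vb _ d0.
  have := NP (N + M)%N (leq_addr _ _); have := MP (N + M)%N (leq_addl _ _).
  have := n2D (a - v (N + M)%N) (v (N + M)%N - b); rewrite addrA subrK (n2B a (v _)).
  by move: (n2 _) (n2 _) (n2 _) => r s t; lra.
have ll a f g : l (a *: f + g) = a *: l f + l g.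
  apply: unique (lP _) _ => e e0.
  have K0 : 0 <= Num.sqrt (sqnorm a) by rewrite sqrtr_ge0.
  have d0 : 0 < e / (Num.sqrt (sqnorm a) + 1) by rewrite divr_gt0// ltr_wpDl.
  have [N NP] := lP f _ d0; have [M MP] := lP g _ d0; exists (N + M)%N => p NMp.
  have -> : u p (a *: f + g) - (a *: l f + l g) = a *: (u p f - l f) + (u p g - l g).
    by rewrite op_linear scalerBr opprD addrACA.
  apply: le_lt_trans (n2D _ _) _; rewrite n2Z_sqr.
  have := ler_wpM2l K0 (ltW (NP p (leq_trans (leq_addr _ _) NMp))).
  have := MP p (leq_trans (leq_addl _ _) NMp).
  have : Num.sqrt (sqnorm a) * (e / (Num.sqrt (sqnorm a) + 1)) +
      e / (Num.sqrt (sqnorm a) + 1) = e.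
    by field; rewrite gt_eqF// ltr_wpDl.
  by lra.
have lim_bound (e : R) : 0 < e -> exists N, forall p, (N <= p)%N ->
    forall f, n2 (u p f - l f) <= e * n2 f.
  move=> e0; have [N NP] := uC _ e0; exists N => p Np f.
  apply/ler_addgt0Pr => d d0; have [M MP] := lP f _ d0.
  have := n2D (u p f - u (N + M)%N f) (u (N + M)%N f - l f); rewrite addrA subrK.
  move/le_trans; apply; rewrite lerD//; last exact/ltW/MP/leq_addl.
  rewrite -opB; apply: le_trans (op_norm_bound _ _) _.
  by rewrite ler_wpM2r ?n2_ge0// ltW// NP// leq_addr.
have lpred : l \in op_pred.
  apply/asboolP; split=> //.
  - exists l' => f g; apply/eqP; rewrite -subr_eq0; apply/eqP.
    apply/eqP; rewrite -normr_le0; apply/ler_addgt0Pr => e e0; rewrite add0r.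
    pose K := n2 f + n2 g + 1.
    have K0 : 0 < K by rewrite ltr_wpDl// addr_ge0 ?n2_ge0.
    have d0 : 0 < e / K by rewrite divr_gt0.
    have [N NP] := lP f _ d0; have [M MP] := lP' g _ d0.
    have N1 := NP (N + M)%N (leq_addr _ _); have M1 := MP (N + M)%N (leq_addl _ _).
    set v := u (N + M)%N in N1 M1.
    have E1 : ip (l f) g - ip f (l' g) = ip f (op_star v g - l' g) - ip (v f - l f) g.
      by rewrite ipBr ipBl op_starP; ring.
    have cs h k : `|ip h k| <= n2 h * n2 k.
      rewrite ler_norml cauchy_schwarz andbT lerNl -ipNl.
      by apply: le_trans (cauchy_schwarz _ _) _; rewrite -scaleN1r n2Z normrN1 mul1r.
    rewrite E1; apply: le_trans (ler_normB _ _) _.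
    apply: le_trans (lerD (cs _ _) (cs _ _)) _.
    have := ler_wpM2l (n2_ge0 f) (ltW M1); have := ler_wpM2r (n2_ge0 g) (ltW N1).
    have : e / K * (n2 f + n2 g + 1) = e by rewrite -/K divfK ?gt_eqF.
    rewrite !mulrDr mulr1.
    by have := ltW d0; lra.
  - have [N NP] := lim_bound 1 ltr01; exists (op_norm (u N) + 1).
      by rewrite addr_ge0 ?op_norm_ge0.
    move=> f; have := NP N (leqnn N) f; rewrite n2B mul1r.
    have := n2D (l f - u N f) (u N f); rewrite subrK.
    by have := op_norm_bound (u N) f; lra.
exists (Op x0 lpred) => e e0; have e2 : 0 < e / 2 by rewrite divr_gt0.
have [N NP] := lim_bound _ e2; exists N => p /NP H.
apply: (@le_lt_trans _ _ (e / 2)); last by lra.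
by apply: op_norm_le; first exact: ltW.
Qed.

HB.instance Definition _ := isCStarAlgebra.Build R L op_starK op_starD op_starZ
  op_starM op_normD op_normZ op_norm0_eq0 op_normM op_norm_starM op_norm_complete.

End OperatorAlgebra.
End Operators.

(** * The representation on functions on the shift space *)

Section PartialPermutation.
Variables (R : realType) (I : choiceType) (x0 : I).
Local Notation E := (l2 R I).
Implicit Types (f g : E).

(** Composition with a bijection between two subsets of the index set, extended by
    zero: a partial isometry whose adjoint belongs to the inverse bijection. *)
Definition compose_on (D : set I) (t : I -> I) (f : I -> R[i]) (x : I) : R[i] :=
  if x \in D then f (t x) else 0.

Section Bijection.
Variables (D D' : set I) (t k : I -> I).
Hypotheses (tD : set_bij D D' t) (kD : set_bij D' D k)
  (tk : forall x, D x -> k (t x) = x) (kt : forall y, D' y -> t (k y) = y).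

Lemma sqnorm0 : sqnorm (0 : R[i]) = 0.
Proof. by rewrite /sqnorm /= expr0n addr0. Qed.

Lemma sqsum_compose_on (f : I -> R[i]) :
  sqsum (compose_on D t f) = \esum_(y in D') (sqnorm (f y))%:E.
Proof.
rewrite (reindex_esum _ _ _ _ tD) [RHS]esum_mkcond; apply: eq_esum => x _.
by rewrite /compose_on; case: ifP => //; rewrite sqnorm0.
Qed.

Lemma compose_on_l2 f : compose_on D t f \in @l2_pred R I.
Proof.
rewrite unfold_in /l2_pred sqsum_compose_on; apply: le_lt_trans (l2valP f).
rewrite /sqsum esum_mkcond; apply: le_esum => x _.
by case: ifP => // _; rewrite lee_fin sqnorm_ge0.
Qed.

Definition compose_l2 f : E := L2 (compose_on_l2 f).

Lemma compose_l2E f x : compose_l2 f x = if x \in D then f (t x) else 0.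
Proof. by []. Qed.

Lemma compose_l2_bound f : n2 (compose_l2 f) <= n2 f.
Proof.
rewrite ler_sqrt ?N2_ge0// -lee_fin -!sqsumE sqsum_compose_on /sqsum esum_mkcond.
by apply: le_esum => x _; case: ifP => // _; rewrite lee_fin sqnorm_ge0.
Qed.

Lemma compose_l2_linear a f g :
  compose_l2 (a *: f + g) = a *: compose_l2 f + compose_l2 g.
Proof.
apply: l2_ext => x; rewrite l2D l2Z !compose_l2E; case: ifP => // _.
by rewrite mulr0 addr0.
Qed.

End Bijection.

Lemma compose_l2_adjoint D D' t k (tD : set_bij D D' t) (kD : set_bij D' D k) :
  (forall x, D x -> k (t x) = x) -> (forall y, D' y -> t (k y) = y) ->
  adjoint_pair (compose_l2 tD) (compose_l2 kD).
Proof.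
move=> tk kt f g; pose F (P : set I) (h : I -> R[i]) : \bar R := \esum_(x in P) (sqnorm (h x))%:E.
have split (P : set I) (h : I -> R[i]) : sqsum h = (F P h + F (~` P) h)%E.
  rewrite /sqsum (esumID P)//; first by rewrite !setTI.
  by move=> x _; rewrite lee_fin sqnorm_ge0.
have e1 : sqsum (compose_l2 tD f + g) = (F D' (fun y => (f y + g (k y))%R) + F (~` D) g)%E.
  rewrite (split D); congr (_ + _)%E.
    rewrite /F [RHS](reindex_esum _ _ _ _ tD); apply: eq_esum => x Dx.
    by rewrite l2D compose_l2E mem_set// tk.
  apply: eq_esum => x Dx; rewrite l2D compose_l2E.
  by case: ifPn => [/set_mem//|_]; rewrite add0r.
have e2 : sqsum (f + compose_l2 kD g) = (F D' (fun y => (f y + g (k y))%R) + F (~` D') f)%E.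
  rewrite (split D'); congr (_ + _)%E.
    by apply: eq_esum => x Dx; rewrite l2D compose_l2E mem_set.
  apply: eq_esum => x Dx; rewrite l2D compose_l2E.
  by case: ifPn => [/set_mem//|_]; rewrite addr0.
have e3 : sqsum (compose_l2 tD f) = F D' f by exact: sqsum_compose_on.
have e4 : sqsum (compose_l2 kD g) = F D g by exact: sqsum_compose_on.
suff : N2 (compose_l2 tD f + g) + N2 f + N2 (compose_l2 kD g) =
    N2 (f + compose_l2 kD g) + N2 (compose_l2 tD f) + N2 g by rewrite /ip; lra.
apply: EFin_inj; rewrite !EFinD -!sqsumE e1 e2 e3 e4 (split D' f) (split D g).
have rearrange (a b c d e : \bar R) : (a + b + (c + d) + e = a + d + c + (e + b))%E.
  by rewrite [(c + d)%E]addeC addeACA -!addeA [(e + b)%E]addeC [(b + (c + e))%E]addeCA.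
exact: rearrange.
Qed.

Lemma compose_op_subproof D D' t k (tD : set_bij D D' t) (kD : set_bij D' D k) :
  (forall x, D x -> k (t x) = x) -> (forall y, D' y -> t (k y) = y) ->
  compose_l2 tD \in @op_pred R I.
Proof.
move=> tk kt; apply/asboolP; split.
- exact: compose_l2_linear.
- by exists (compose_l2 kD); exact: compose_l2_adjoint.
- by exists 1 => // f; rewrite mul1r compose_l2_bound.
Qed.

End PartialPermutation.

Section CanonicalFamily.
Variables (R : realType) (n : nat) (A : 'M[bool]_n) (x0 : sft A).
Local Notation X := (sft A).
Local Notation sh := (@sft_shift n A).
Local Notation L := (op R x0).

Definition starts_with i : set X := [set x | letter x 0 = i].
Definition can_follow i : set X := [set y | A i (letter y 0)].

Lemma pcons_subproof i (y : X) : exists z : X, A i (letter y 0) -> letter z 0 = i /\ sh z = y.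
Proof.
by have [/point_cons[z zP]|] := boolP (A i (letter y 0)); [exists z|exists y].
Qed.

(** Outside [can_follow i] the value is arbitrary. *)
Definition pcons i y : X := sval (cid (pcons_subproof i y)).

Lemma pconsP i y : A i (letter y 0) -> letter (pcons i y) 0 = i /\ sh (pcons i y) = y.
Proof. by rewrite /pcons; case: cid. Qed.

Lemma pcons_shift i x : letter x 0 = i -> pcons i (sh x) = x.
Proof.
move=> xi; have [|zi zx] := @pconsP i (sh x).
  by rewrite -xi letter_shift; exact: letter_adm.
apply: (@eq_glue _ _ 1) => //; move=> [|//] _; by rewrite zi xi.
Qed.

Lemma shift_bij i : set_bij (starts_with i) (can_follow i) sh.
Proof.
split=> [x xi|x y /set_mem xi /set_mem yi xy|y yi].
- by rewrite /can_follow /= -xi letter_shift; exact: letter_adm.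
- by rewrite -(pcons_shift xi) xy pcons_shift.
- by have [zi zy] := pconsP yi; exists (pcons i y).
Qed.

Lemma pcons_bij i : set_bij (can_follow i) (starts_with i) (pcons i).
Proof.
split=> [y /pconsP[]//|x y /set_mem /pconsP[_ xE] /set_mem /pconsP[_ yE] xy|x xi].
  by rewrite -xE xy yE.
exists (sh x); last exact: pcons_shift.
by rewrite /can_follow /= -xi letter_shift; exact: letter_adm.
Qed.

Lemma pcons_shiftK i x : starts_with i x -> pcons i (sh x) = x.
Proof. exact: pcons_shift. Qed.

Lemma shift_pconsK i y : can_follow i y -> sh (pcons i y) = y.
Proof. by move=> /pconsP[]. Qed.

(** The generator [S_i] acts on functions on the shift space by restricting
    [f o sh] to the points that start with [i]. *)
Definition can_gen i : L :=
  Op x0 (@compose_op_subproof R X _ _ _ _ (shift_bij i) (pcons_bij i)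
    (@pcons_shiftK i) (@shift_pconsK i)).

Definition can_gen_adj i : L :=
  Op x0 (@compose_op_subproof R X _ _ _ _ (pcons_bij i) (shift_bij i)
    (@shift_pconsK i) (@pcons_shiftK i)).

Lemma can_genE i (f : l2 R X) x : can_gen i f x = if letter x 0 == i then f (sh x) else 0.
Proof.
rewrite [LHS]compose_l2E; case: eqP => xi; first by rewrite mem_set.
by rewrite memNset.
Qed.

Lemma can_gen_star i : star (can_gen i) = can_gen_adj i.
Proof.
apply: op_star_ext; apply: compose_l2_adjoint; [exact: pcons_shiftK|exact: shift_pconsK].
Qed.

Lemma can_gen_starE i (f : l2 R X) y :
  star (can_gen i) f y = if A i (letter y 0) then f (pcons i y) else 0.
Proof.
rewrite can_gen_star [LHS]compose_l2E; case: ifPn => [/set_mem|]; first by move=> ->.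
by move/negP => yi; case: ifPn => // iy; exfalso; apply: yi; rewrite mem_set.
Qed.

Lemma op_sumE (J : finType) (T : J -> L) (f : l2 R X) x :
  (\sum_j T j) f x = \sum_j T j f x.
Proof. by elim/big_rec2: _ => // j u v _ <-. Qed.

Lemma can_gen_mulstarE i (f : l2 R X) x :
  (can_gen i * star (can_gen i)) f x = if letter x 0 == i then f x else 0.
Proof.
rewrite op_mulE can_genE can_gen_starE; case: eqP => // xi.
by rewrite letter_shift -{1}xi letter_adm pcons_shift.
Qed.

Lemma canonical_family : cuntz_krieger_family A can_gen.
Proof.
split=> [i||i].
- apply: op_ext => f; apply: l2_ext => x; rewrite op_mulE can_gen_mulstarE can_genE.
  by case: eqP.
- apply: op_ext => f; apply: l2_ext => x; rewrite op_sumE op_1E.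
  rewrite (bigD1 (letter x 0))// big1 => [|j xj].
    by rewrite can_gen_mulstarE eqxx; exact: addr0.
  by rewrite can_gen_mulstarE eq_sym (negbTE xj).
- apply: op_ext => f; apply: l2_ext => y; rewrite op_sumE op_mulE can_gen_starE.
  rewrite (bigD1 (letter y 0))// big1 => [|j yj]; last first.
    by rewrite opZ l2Z can_gen_mulstarE eq_sym (negbTE yj) mulr0.
  rewrite opZ l2Z can_gen_mulstarE eqxx can_genE; apply: etrans (esym (addr0 _)).
  case: ifP => iy; last by rewrite mul0r.
  by have [-> ->] := pconsP iy; rewrite eqxx mul1r.
Qed.

Lemma canonical_Sx (x : X) k (f : l2 R X) : Sx can_gen x k f x = f (iter k sh x).
Proof.
elim: k x => [|k IH] x; first by rewrite Sx0.
by rewrite SxS op_mulE can_genE eqxx IH -iterSr.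
Qed.

Lemma canonical_Sx_neq0 (x : X) k : Sx can_gen x k != 0.
Proof.
apply/eqP => S0; have := canonical_Sx x k (L2 (delta_subproof R (iter k sh x))).
by rewrite S0 /= eqxx => /esym/eqP; rewrite oner_eq0.
Qed.

End CanonicalFamily.

Lemma Sx_morphism (R : realType) n (A : 'M[bool]_n) (V W : cstarAlgType R)
    (S : 'I_n -> V) (T : 'I_n -> W) (psi : {lrmorphism V -> W}) (x : sft A) k :
  (forall i, psi (S i) = T i) -> psi (Sx S x k) = Sx T x k.
Proof.
by move=> ST; rewrite /Sx /Sw rmorph_prod; apply: eq_bigr => i _; exact: ST.
Qed.

(** The diagonal projections of the universal algebra are nonzero because they are
    nonzero in the representation on the square summable functions on the shift
    space. *)
Lemma universal_Qx_neq0 (R : realType) n (A : 'M[bool]_n) (V : cstarAlgType R)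
    (S : 'I_n -> V) (x : sft A) k : cuntz_krieger_algebra A S -> Qx S x k != 0.
Proof.
move=> [SP _ /(_ _ _ (canonical_family R x))[psi psis psiS]].
apply/eqP => Q0; have := canonical_Sx_neq0 R x x k.
rewrite -(Sx_morphism x k psiS) -(Sx_partial SP) -/(Qx S x k) Q0 mul0r rmorph0.
by rewrite eqxx.
Qed.

(** * Spans of bisections and the gauge action *)

Section Density.
Variables (R : realType) (n : nat) (A : 'M[bool]_n) (V : cstarAlgType R).
Variable S : 'I_n -> V.
Hypotheses (rows : forall i, exists j, A i j) (SP : cuntz_krieger_family A S).
Implicit Types (U : set (sft_groupoid A)) (v w : V).

Definition range_determines U := forall g g', U g -> U g' ->
  grange g = grange g' -> gsource g = gsource g'.

Definition bisection_element v := exists2 U, range_determines U & represents S U v.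

Definition bisection_span v := exists r : seq (R[i] * V),
  (forall p, p \in r -> bisection_element p.2) /\ v = \sum_(p <- r) p.1 *: p.2.

Lemma represents_source_determines U v g g' : represents S U v ->
  U g -> U g' -> gsource g = gsource g' -> grange g = grange g'.
Proof.
move=> [N NP] Ug Ug' gg; have [[no _]|[y [M [H _]]]] := NP (gsource g).
  by exfalso; apply: no Ug.
have [_ rs yg] := (H.2 g (@agree_refl _ _ _ _)).1 Ug.
have [|_ rs' yg'] := (H.2 g' _).1 Ug'; first by rewrite gg.
apply: (@eq_glue _ _ M); last by rewrite rs rs' gg.
apply: agree_le (leqnSn M) _; exact: agree_trans (agree_sym yg) yg'.
Qed.

Lemma bisection_element_mul v w : bisection_element v -> bisection_element w ->
  bisection_element (v * w).
Proof.
move=> [U Ui Uv] [W Wi Ww]; exists (arrow_mul U W); last exact: represents_mul.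
move=> g g' [a [b [Ua Wb ab [gr gd gs]]]] [a' [b' [Ua' Wb' ab' [gr' gd' gs']]]] E.
rewrite gs gs'; apply: Wi => //; rewrite -ab -ab'; apply: Ui => //.
by rewrite -gr -gr'.
Qed.

Lemma bisection_element_star v : bisection_element v -> bisection_element (star v).
Proof.
move=> [U Ui Uv]; exists (arrow_inv U); last exact: represents_inv.
by move=> g g' Ug Ug' E; have := represents_source_determines Uv Ug Ug'; apply.
Qed.

Lemma bisection_element_gen i : bisection_element (S i).
Proof.
exists (gen_arrows i); last exact: represents_gen.
by move=> g g' [_ -> _] [_ -> _] ->.
Qed.

(** The span is a *-subalgebra that contains the generators. *)
Lemma bisection_span_dense v : cstar_generated (range S) = [set: V] ->
  forall e : R, 0 < e -> exists2 w, bisection_span w & cnorm (v - w) < e.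
Proof.
move=> SV; have : cstar_generated (range S) v by rewrite SV.
have spanD w w' : bisection_span w -> bisection_span w' -> bisection_span (w + w').
  move=> [r [rP ->]] [r' [rP' ->]]; exists (r ++ r'); rewrite big_cat; split=> //.
  by move=> p; rewrite mem_cat => /orP[/rP|/rP'].
have spanZ a w : bisection_span w -> bisection_span (a *: w).
  move=> [r [rP ->]]; exists [seq (a * p.1, p.2) | p <- r]; split.
    by move=> _ /mapP[p /rP pP ->].
  by rewrite big_map scaler_sumr; apply: eq_bigr => p _; rewrite scalerA.
have spanM w w' : bisection_span w -> bisection_span w' -> bisection_span (w * w').
  move=> [r [rP ->]] [r' [rP' ->]].
  exists [seq (p.1 * q.1, p.2 * q.2) | p <- r, q <- r']; split.
    move=> _ /allpairsP[[p q] /= [pr qr ->]] /=.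
    by apply: bisection_element_mul; [exact: rP|exact: rP'].
  rewrite big_allpairs_dep mulr_suml; apply: eq_bigr => p _; rewrite mulr_sumr.
  by apply: eq_bigr => q _; rewrite -scalerAl -scalerAr scalerA.
have spanS w : bisection_span w -> bisection_span (star w).
  move=> [r [rP ->]]; exists [seq (p.1^*%C, star p.2) | p <- r]; split.
    by move=> _ /mapP[p /rP pP ->]; exact: bisection_element_star.
  by rewrite big_map star_sum; apply: eq_bigr => p _; rewrite starZ.
have span0 : bisection_span 0 by exists [::]; rewrite big_nil.
apply: (@generated_min _ _ _ [set v | forall e : R, 0 < e ->
    exists2 w, bisection_span w & cnorm (v - w) < e]); last first.
  move=> _ [i _ <-] e e0; exists (S i); last by rewrite subrr cnorm0.
  exists [:: (1, S i)]; rewrite big_seq1 scale1r; split=> // p.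
  by rewrite inE => /eqP ->; exact: bisection_element_gen.
split.
- split=> [e e0|x y xP yP e e0]; first by exists 0; rewrite ?subrr ?cnorm0.
  have e2 : 0 < e / 2 by rewrite divr_gt0.
  have [w wP xw] := xP _ e2; have [w' wP' yw] := yP _ e2.
  exists (w + w'); first exact: spanD.
  rewrite opprD addrACA; apply: le_lt_trans (cnormD _ _) _; lra.
- move=> a x xP e e0; pose K := complex.Re `|a|.
  have K0 : 0 <= K by rewrite /K normc_def sqrtr_ge0.
  have d0 : 0 < e / (K + 1) by rewrite divr_gt0// ltr_wpDl.
  have [w wP xw] := xP _ d0; exists (a *: w); first exact: spanZ.
  rewrite -scalerBr cnormZ -/K; apply: (@le_lt_trans _ _ (K * (e / (K + 1)))).
    by rewrite ler_wpM2l// ltW.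
  by rewrite mulrA ltr_pdivrMr ?ltr_wpDl// mulrC ltr_pM2l//; lra.
- move=> x y xP yP e e0; pose K := cnorm x + cnorm y + 1.
  have K0 : 0 < K by rewrite ltr_wpDl// addr_ge0 ?cnorm_ge0.
  pose d := Num.min 1 (e / (2 * K)).
  have d0 : 0 < d by rewrite lt_min ltr01 divr_gt0// mulr_gt0.
  have [w wP xw] := xP _ d0; have [w' wP' yw] := yP _ d0.
  exists (w * w'); first exact: spanM.
  have -> : x * y - w * w' = (x - w) * y + w * (y - w').
    by rewrite mulrBl mulrBr addrA subrK.
  apply: le_lt_trans (cnormD _ _) _.
  have d1 : d <= 1 by rewrite ge_min lexx.
  have wn : cnorm w <= cnorm x + 1.
    have := cnormB x (x - w); rewrite subKr; lra.
  have dK : 2 * (K * d) <= e.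
    have : d <= e / (2 * K) by rewrite ge_min lexx orbT.
    by rewrite ler_pdivlMr ?mulr_gt0//; lra.
  have h1 := cnormM (x - w) y; have h2 := cnormM w (y - w').
  have h3 := ler_wpM2r (cnorm_ge0 y) (ltW xw).
  have h4 := ler_pM (cnorm_ge0 _) (cnorm_ge0 _) wn (ltW yw).
  have h5 : K * d = d * cnorm y + (cnorm x + 1) * d by rewrite /K; ring.
  have h6 : 0 < K * d by rewrite mulr_gt0.
  by lra.
- move=> x xP e e0; have [w wP xw] := xP _ e0; exists (star w); first exact: spanS.
  by rewrite -starB cnorm_star.
- move=> x xP e e0; have e2 : 0 < e / 2 by rewrite divr_gt0.
  have [y yP xy] := xP _ e2; have [w wP yw] := yP _ e2; exists w => //.
  have := cnormD (x - y) (y - w); rewrite addrA subrK; lra.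
Qed.

(** An element of the span has finitely many terms, so they have a common level. *)
Lemma bisection_span_levels b : bisection_span b ->
  exists (r : seq (R[i] * V)) (U : R[i] * V -> set (sft_groupoid A)) N,
  (forall q y, q \in r -> acts_locally S (U q) q.2 y N) /\ b = \sum_(q <- r) q.1 *: q.2.
Proof.
move=> [r [rP bE]].
have /choice[U UP] (q : R[i] * V) : exists U : set (sft_groupoid A), q \in r -> represents S U q.2.
  by have [/rP[U _ UP]|] := boolP (q \in r); [exists U|exists set0].
have /choice[N NP] (q : R[i] * V) : exists N, q \in r -> forall y, acts_locally S (U q) q.2 y N.
  by have [/UP[N NP]|] := boolP (q \in r); [exists N|exists 0%N].
exists r, U, (\max_(q <- r) N q)%N; split=> // q y qr.
by apply: (acts_locally_le SP _ (NP q qr y)); exact: leq_bigmax_seq.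
Qed.

End Density.

Section Gauge.
Variables (R : realType) (n : nat) (A : 'M[bool]_n) (V : cstarAlgType R).
Variable S : 'I_n -> V.
Hypotheses (rows : forall i, exists j, A i j) (SU : cuntz_krieger_algebra A S).

Let SP : cuntz_krieger_family A S. Proof. by case: SU. Qed.

Definition gauge (z : R[i]) (gam : {lrmorphism V -> V}) :=
  [/\ z * z^*%C = 1, star_preserving gam & forall i, gam (S i) = z *: S i].

(** The family [z S_i] again satisfies the Cuntz-Krieger relations. *)
Lemma gauge_exists z : z * z^*%C = 1 -> exists gam, gauge z gam.
Proof.
move=> z1; have [_ _ univ] := SU.
have zz i : z *: S i * star (z *: S i) = S i * star (S i).
  by rewrite starZ -scalerAl -scalerAr scalerA z1 scale1r.
have [gam gs gS] : exists2 gam : {lrmorphism V -> V}, star_preserving gam &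
    forall i, gam (S i) = z *: S i.
  apply: univ; have [_ S1 SS] := SP; split=> [i||i].
  - by rewrite /partial_isometry zz -scalerAr (gen_partial SP).
  - by rewrite -S1; apply: eq_bigr => i _; exact: zz.
  - rewrite starZ -scalerAl -scalerAr scalerA mulrC z1 scale1r SS.
    by apply: eq_bigr => j _; rewrite zz.
by exists gam.
Qed.

Lemma gauge_Sx z gam (x : sft A) k : gauge z gam -> gam (Sx S x k) = z ^+ k *: Sx S x k.
Proof.
move=> [_ _ gS]; elim: k x => [|k IH] x; first by rewrite Sx0 rmorph1 scale1r.
by rewrite SxS rmorphM /= gS IH -scalerAl -scalerAr scalerA exprS.
Qed.

(** The degree [M' - M] may be negative, hence the two exponents. *)
Definition homogeneous M M' (v : V) := forall z gam, gauge z gam ->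
  gam v = ((z^*%C) ^+ M * z ^+ M') *: v.

Lemma unit_root_exists d : (0 < d)%N ->
  exists z : R[i], z * z^*%C = 1 /\ z ^+ d = -1.
Proof.
move=> d0; pose z : R[i] := d.-root (-1).
have zd : z ^+ d = -1 by rewrite rootCK.
exists z; split=> //; have z1 : `|z| = 1.
  by apply/eqP; rewrite -(@pexpr_eq1 _ _ d)// -normrX zd normrN1.
by have := normCK z; rewrite z1 expr1n => <-.
Qed.

(** Averaging over suitable gauge automorphisms kills the homogeneous elements of
    prescribed nonzero degrees and fixes those of degree zero; it replaces the
    integral over the circle. *)
Lemma gauge_average (ds : seq nat) : (forall d, d \in ds -> (0 < d)%N) ->
  exists F : V -> V, [/\ {morph F : v w / v + w},
    forall a v, F (a *: v) = a *: F v,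
    forall v, cnorm (F v) <= cnorm v,
    forall M v, homogeneous M M v -> F v = v &
    forall M M' v, homogeneous M M' v -> ((M - M') + (M' - M))%N \in ds -> F v = 0].
Proof.
elim: ds => [_|d ds IH dsP]; first by exists id.
have [|F [FD FZ FN F1 F0]] := IH; first by move=> e eds; apply: dsP; rewrite in_cons eds orbT.
have [z [z1 zd]] := unit_root_exists (dsP d (mem_head _ _)).
have [gam gP] := gauge_exists z1; have [_ gs _] := gP.
(* [gam] multiplies the homogeneous elements of degree [d] and [- d] by [-1] *)
pose H v := (2^-1)%:C%C *: (v + gam v).
exists (fun v => F (H v)); split.
- by move=> v w; rewrite /H rmorphD /= addrACA scalerDr FD.
- by move=> a v; rewrite /H linearZ /= -scalerDr scalerA mulrC -scalerA FZ.
- move=> v; apply: le_trans (FN _) _; rewrite /H cnormZr ger0_norm ?invr_ge0//.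
  have := cnormD v (gam v); have := star_morphism_contractive gs v; lra.
- move=> M v hv; rewrite /H (hv _ _ gP) -exprMn mulrC z1 expr1n scale1r half_double.
  exact: F1 hv.
move=> M M' v hv; rewrite in_cons /H (hv _ _ gP) -{1}[v]scale1r -scalerDl scalerA FZ.
case/predU1P => [E|Mds]; last by rewrite (F0 M M' v hv Mds) scaler0.
suff -> : 1 + z^*%C ^+ M * z ^+ M' = 0 by rewrite mulr0 scale0r.
have zz k : z^*%C ^+ k * z ^+ k = 1 by rewrite -exprMn mulrC z1 expr1n.
have [MM|/ltnW MM] := leqP M M'.
  have -> : M' = (d + M)%N by lia.
  by rewrite exprD mulrCA zz zd mulr1 subrr.
have -> : M = (d + M')%N by lia.
by rewrite exprD -mulrA zz mulr1 -rmorphXn zd rmorphN rmorph1 subrr.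
Qed.

End Gauge.

(** * The homeomorphism defined by an isomorphism of diagonals *)

Section DiagonalProjections.
Variables (R : realType) (n : nat) (A : 'M[bool]_n) (V : cstarAlgType R).
Variable S : 'I_n -> V.
Hypotheses (rows : forall i, exists j, A i j) (SP : cuntz_krieger_family A S).
Hypothesis Qnz : forall (x : sft A) k, Qx S x k != 0.
Local Notation X := (sft A).
Local Notation sh := (@sft_shift n A).
Local Notation Qx := (@Qx R n A V S).
Implicit Types (x y : X) (q d : V).

(** Elements of the diagonal are functions on the shift space: they commute with
    the projections of cylinders and are nearly constant on small cylinders. *)
Lemma diagonal_nearly_constant d : cuntz_krieger_diagonal S d ->
  (forall x k, d * Qx x k = Qx x k * d) /\
  forall x (e : R), 0 < e -> exists N (c : R[i]), cnorm (d * Qx x N - c *: Qx x N) < e.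
Proof.
pose C : set V := [set d | (forall x k, d * Qx x k = Qx x k * d) /\
  forall x (e : R), 0 < e -> exists N (c : R[i]), forall M, (N <= M)%N ->
    cnorm (d * Qx x M - c *: Qx x M) < e].
suff CP : cuntz_krieger_diagonal S `<=` C.
  move=> /CP[dQ dc]; split=> // x e /(dc x)[N [c H]]; exists N, c; exact: H.
have Qle x N M v c : (N <= M)%N ->
    cnorm (v * Qx x M - c *: Qx x M) <= cnorm (v * Qx x N - c *: Qx x N).
  move=> NM; rewrite -(Qx_le SP x NM) mulrA scalerAl -mulrBl.
  apply: le_trans (cnormM _ _) _; apply: ler_piMr (cnorm_ge0 _) _.
  exact: projection_norm_le1 (Qx_projection SP _ _).
have Q1 x N : cnorm (Qx x N) <= 1 by apply: projection_norm_le1 (Qx_projection SP _ _).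
apply: generated_min; first split.
- split=> [|v w [vQ vc] [wQ wc]].
    split=> [x k|x e e0]; first by rewrite mul0r mulr0.
    by exists 0%N, 0 => M _; rewrite mul0r scale0r subrr cnorm0.
  split=> [x k|x e e0]; first by rewrite mulrDl mulrDr vQ wQ.
  have e2 : 0 < e / 2 by rewrite divr_gt0.
  have [N [c Nc]] := vc x _ e2; have [N' [c' Nc']] := wc x _ e2.
  exists (N + N')%N, (c + c') => M NM; rewrite mulrDl scalerDl opprD addrACA.
  apply: le_lt_trans (cnormD _ _) _.
  have := Nc M (leq_trans (leq_addr _ _) NM).
  have := Nc' M (leq_trans (leq_addl _ _) NM); lra.
- move=> a v [vQ vc]; split=> [x k|x e e0]; first by rewrite -scalerAl -scalerAr vQ.
  pose K := complex.Re `|a|; have K0 : 0 <= K by rewrite /K normc_def sqrtr_ge0.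
  have d0 : 0 < e / (K + 1) by rewrite divr_gt0// ltr_wpDl.
  have [N [c Nc]] := vc x _ d0; exists N, (a * c) => M NM.
  rewrite -scalerAl -scalerA -scalerBr cnormZ -/K.
  apply: (@le_lt_trans _ _ (K * (e / (K + 1)))); first by rewrite ler_wpM2l// ltW// Nc.
  by rewrite mulrA ltr_pdivrMr ?ltr_wpDl// mulrC ltr_pM2l//; lra.
- move=> v w [vQ vc] [wQ wc]; split=> [x k|x e e0].
    by rewrite -mulrA wQ mulrA vQ mulrA.
  pose K := cnorm v + cnorm w + 2.
  have v0 := cnorm_ge0 v; have w0 := cnorm_ge0 w.
  have K0 : 0 < K by rewrite /K; lra.
  pose del := Num.min 1 (e / (2 * K)).
  have d0 : 0 < del by rewrite lt_min ltr01 divr_gt0// mulr_gt0.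
  have d1 : del <= 1 by rewrite ge_min lexx.
  have dK : 2 * (K * del) <= e.
    have : del <= e / (2 * K) by rewrite ge_min lexx orbT.
    by rewrite ler_pdivlMr ?mulr_gt0//; lra.
  have [N [c Nc]] := vc x _ d0; have [N' [c' Nc']] := wc x _ d0.
  exists (N + N')%N, (c * c') => M NM.
  have H := Nc M (leq_trans (leq_addr _ _) NM).
  have H' := Nc' M (leq_trans (leq_addl _ _) NM).
  have -> : v * w * Qx x M - (c * c') *: Qx x M =
      v * (w * Qx x M - c' *: Qx x M) + c' *: (v * Qx x M - c *: Qx x M).
    rewrite mulrBr scalerBr -scalerAr addrA subrK [v * (w * _)]mulrA.
    by rewrite scalerA [c' * c]mulrC.
  apply: le_lt_trans (cnormD _ _) _; rewrite cnormZ.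
  have h1 := cnormM v (w * Qx x M - c' *: Qx x M).
  have h2 := ler_wpM2l v0 (ltW H').
  have c'n : complex.Re `|c'| <= cnorm w + 1.
    have := cnormB (w * Qx x M) (w * Qx x M - c' *: Qx x M).
    rewrite subKr cnormZ (projection_norm1 (Qx_projection SP _ _) (Qnz _ _)) mulr1.
    have := cnormM w (Qx x M); have := ler_piMr w0 (Q1 x M); lra.
  have c'0 : 0 <= complex.Re `|c'| by rewrite normc_def sqrtr_ge0.
  have h3 := ler_pM c'0 (cnorm_ge0 _) c'n (ltW H).
  have h4 : K * del = cnorm v * del + (cnorm w + 1) * del + del by rewrite /K; ring.
  have h5 : 0 < K * del by rewrite mulr_gt0.
  by lra.
- move=> v [vQ vc]; split=> [x k|x e e0].
    have [sQ _] := Qx_projection SP x k.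
    by have := congr1 (@Defs.star R V) (vQ x k); rewrite (starM v) (starM (Qx x k)) sQ => ->.
  have [N [c Nc]] := vc x _ e0; exists N, (c^*%C) => M NM.
  rewrite -cnorm_star starB starZ conjcK starM starK.
  by rewrite (Qx_projection SP x M).1 -vQ; exact: Nc.
- move=> v vC; split=> [x k|x e e0].
    apply/eqP; rewrite -subr_eq0; apply/eqP.
    apply: (lipschitz_closed (f := fun u => u * Qx x k - Qx x k * u) (K := 2)) => //.
      move=> u w; rewrite subrACA -mulrBl -mulrBr; apply: le_trans (cnormB _ _) _.
      have := cnormM (u - w) (Qx x k); have := cnormM (Qx x k) (u - w).
      have := ler_piMr (cnorm_ge0 (u - w)) (Q1 x k).
      have := ler_piMl (cnorm_ge0 (u - w)) (Q1 x k); lra.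
    by move=> e /vC[b [bQ _] vb]; exists b => //; rewrite bQ subrr.
  have e2 : 0 < e / 2 by rewrite divr_gt0.
  have [b [bQ bc] vb] := vC _ e2; have [N [c Nc]] := bc x _ e2.
  exists N, c => M NM.
  have -> : v * Qx x M - c *: Qx x M = (v - b) * Qx x M + (b * Qx x M - c *: Qx x M).
    by rewrite mulrBl addrA subrK.
  apply: le_lt_trans (cnormD _ _) _.
  have := cnormM (v - b) (Qx x M); have := ler_piMr (cnorm_ge0 (v - b)) (Q1 x M).
  have := Nc M NM; lra.
move=> _ [u ->]; have [w0|[p pu]] := Sw_point rows SP u.
  rewrite -[\prod_(i <- u) S i]/(Sw S u) w0 mul0r; split=> [x k|x e e0].
    by rewrite mul0r mulr0.
  by exists 0%N, 0 => M _; rewrite mul0r scale0r subrr cnorm0.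
rewrite pu -[\prod_(i <- _) S i]/(Sx S p (size u)) -/(Qx p (size u)).
move: (size u) => l {u pu}.
have QQ x : Qx p l * Qx x l = if `[< agree l p x >] then Qx x l else 0.
  case: asboolP => px; last exact: Qx_orthogonal.
  by rewrite (Qx_agree S px) (Qx_le SP).
have comm x k : Qx p l * Qx x k = Qx x k * Qx p l.
  have [lk|/ltnW kl] := leqP l k.
    have [px|px] := pselect (agree l p x).
      by rewrite (Qx_agree S px) (Qx_le SP x lk) (Qx_ler SP x lk).
    have H : Qx p l * Qx x k = 0.
      by rewrite -(Qx_le SP x lk) mulrA (Qx_orthogonal SP)// mul0r.
    have := congr1 (@Defs.star R V) H; rewrite starM star0.
    by rewrite (Qx_projection SP x k).1 (Qx_projection SP p l).1 H.
  have [px|px] := pselect (agree k p x).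
    by rewrite -(Qx_agree S px) (Qx_le SP p kl) (Qx_ler SP p kl).
  have H : Qx x k * Qx p l = 0.
    rewrite -(Qx_le SP p kl) mulrA (Qx_orthogonal SP) ?mul0r// => xp.
    by apply: px; exact: agree_sym.
  have := congr1 (@Defs.star R V) H; rewrite starM star0.
  by rewrite (Qx_projection SP x k).1 (Qx_projection SP p l).1 H.
split=> // x e e0; exists l, (if `[< agree l p x >] then 1 else 0) => M lM.
rewrite -(Qx_le SP x lM) mulrA QQ; case: asboolP => _.
  by rewrite scale1r subrr cnorm0.
by rewrite !mul0r scale0r subrr cnorm0.
Qed.

(** For a projection [q] of the diagonal: the character of the diagonal given by [x]
    takes the value one at [q]. *)
Definition below x q := exists N, q * Qx x N = Qx x N.

Lemma below_level x q N M : (N <= M)%N -> q * Qx x N = Qx x N -> q * Qx x M = Qx x M.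
Proof. by move=> NM H; rewrite -(Qx_le SP x NM) mulrA H. Qed.

(** A projection of the diagonal is the indicator function of a clopen set, since
    no multiple of the unit is within one half of a proper projection. *)
Lemma diagonal_projection_dichotomy q x : projection q -> cuntz_krieger_diagonal S q ->
  below x q \/ exists N, q * Qx x N = 0.
Proof.
move=> [sq qq] /diagonal_nearly_constant[qQ qc].
have [N [c H]] := qc x _ (ltac:(by rewrite invr_gt0) : (0 : R) < 2^-1).
have [sQ QQ] := Qx_projection SP x N.
set a := q * Qx x N in H; set b := Qx x N - a.
have aa : a * a = a by rewrite /a mulrA -(mulrA q) -qQ mulrA qq -mulrA QQ.
have aQ : a * Qx x N = a by rewrite /a -mulrA QQ.
have Qa : Qx x N * a = a by rewrite /a qQ mulrA QQ.
have pa : projection a by split=> //; rewrite /a starM sq sQ qQ.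
have pb : projection b.
  split; first by rewrite /b starB sQ pa.1.
  by rewrite /b mulrBl !mulrBr QQ Qa aQ aa subrr subr0.
have [a0|an] := eqVneq a 0; first by right; exists N.
have [b0|bn] := eqVneq b 0.
  by left; exists N; apply/eqP; rewrite -/a eq_sym -subr_eq0 -/b b0.
exfalso.
(* [a] and [b] are nonzero complementary projections: [a] forces [c] to be near
   one, and [b] forces it to be near zero *)
have h1 : complex.Re `|1 - c| < 2^-1.
  rewrite -[ltLHS]mulr1 -(projection_norm1 pa an) -cnormZ.
  have -> : (1 - c) *: a = a * (a - c *: Qx x N) by rewrite mulrBr aa -scalerAr aQ scalerBl scale1r.
  apply: le_lt_trans (cnormM _ _) _; rewrite (projection_norm1 pa an) mul1r; exact: H.
have h2 : complex.Re `|c| < 2^-1.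
  rewrite -[ltLHS]mulr1 -(projection_norm1 pb bn) -cnormZ -cnormN.
  have -> : - (c *: b) = b * (a - c *: Qx x N).
    by rewrite mulrBr /b [(_ - _) * a]mulrBl Qa aa subrr sub0r -scalerAr mulrBl QQ aQ.
  apply: le_lt_trans (cnormM _ _) _; rewrite (projection_norm1 pb bn) mul1r; exact: H.
have := cnormD ((1 - c) *: Qx x N) (c *: Qx x N).
rewrite -scalerDl subrK scale1r !cnormZ.
by rewrite (projection_norm1 (Qx_projection SP _ _) (Qnz _ _)); lra.
Qed.

End DiagonalProjections.

Section StateMap.
Variables (R : realType) (n : nat) (A : 'M[bool]_n) (m : nat) (B : 'M[bool]_m).
Variables (V W : cstarAlgType R) (S : 'I_n -> V) (T : 'I_m -> W).
Hypotheses (rowsA : forall i, exists j, A i j) (rowsB : forall i, exists j, B i j).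
Hypotheses (SP : cuntz_krieger_family A S) (TP : cuntz_krieger_family B T).
Hypothesis (TQ : forall (y : sft B) k, Qx T y k != 0).
Variable psi : {lrmorphism V -> W}.
Hypotheses (psi_star : star_preserving psi)
  (psi_diag : psi @` cuntz_krieger_diagonal S `<=` cuntz_krieger_diagonal T).

Lemma psi_Qx_projection (x : sft A) k : projection (psi (Qx S x k)).
Proof.
have [sQ QQ] := Qx_projection SP x k.
by split; [rewrite -psi_star sQ|rewrite -rmorphM QQ].
Qed.

Lemma psi_Qx_diagonal (x : sft A) k : cuntz_krieger_diagonal T (psi (Qx S x k)).
Proof.
by apply: psi_diag; exists (Qx S x k) => //; apply: sub_generated; exists (prefix x k).
Qed.

Lemma below_agree (y : sft B) (x x' : sft A) k k' : (k <= k')%N ->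
  below T y (psi (Qx S x k)) -> below T y (psi (Qx S x' k')) -> agree k x x'.
Proof.
move=> kk [N NP] [N' NP']; apply: contrapT => xx; move/eqP: (TQ y (N + N')%N); apply.
rewrite -(below_level TP (leq_addr N' N) NP) -(below_level TP (leq_addl N N') NP') mulrA.
have E : Qx S x k * Qx S x' k' = 0.
  by rewrite -(Qx_le SP x' kk) [LHS]mulrA (Qx_orthogonal SP)// mul0r.
by rewrite -rmorphM E rmorph0 mul0r.
Qed.

(** The projections of the words of length [k] sum to one, so they cannot all be
    zero near [y]. *)
Lemma below_exists_level (y : sft B) k : exists x : sft A, below T y (psi (Qx S x k)).
Proof.
apply: contrapT => no.
have H (u : seq 'I_n) : exists N, psi (Sw S u * star (Sw S u)) * Qx T y N = 0 \/ size u != k.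
  have [uk|] := eqVneq (size u) k; last by exists 0%N; right.
  have [->|[p pu]] := Sw_point rowsA SP u.
    by exists 0%N; left; rewrite mul0r rmorph0 mul0r.
  rewrite uk in pu; rewrite pu -/(Sx S p k) -/(Qx S p k).
  have [bl|[N NP]] := diagonal_projection_dichotomy rowsB TP TQ y
      (psi_Qx_projection p k) (psi_Qx_diagonal p k); last by exists N; left.
  by exfalso; apply: no; exists p.
have [N NP] := choice H; pose M := (\max_(u <- words n k) N u)%N.
move/eqP: (TQ y M); apply; rewrite -[LHS]mul1r -(rmorph1 psi) -(sum_words SP k).
rewrite rmorph_sum mulr_suml big_seq big1// => u uk.
have NM : (N u <= M)%N by apply: leq_bigmax_seq.
rewrite -(Qx_le TP y NM) mulrA.
have [->|] := NP u; first by rewrite mul0r.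
by move: uk; rewrite mem_words => ->.
Qed.

(** The points of the two shift spaces are the characters of the diagonals, so an
    inclusion of diagonals induces a map in the opposite direction. *)
Lemma state_map_exists (y : sft B) : exists x : sft A, forall k, below T y (psi (Qx S x k)).
Proof.
have [u uP] := choice (below_exists_level y).
have uA k l : (k <= l)%N -> agree k (u k) (u l).
  by move=> kl; apply: below_agree kl (uP k) (uP l).
have [|x xE] := @point_exists _ A (fun t => letter (u t.+1) t).
  by move=> t; rewrite (uA t.+1 t.+2)//; exact: letter_adm.
exists x => k; suff xu : agree k x (u k) by rewrite (Qx_agree S xu).
by move=> t tk; rewrite xE (uA t.+1 k).
Qed.

End StateMap.

Section DiagonalHomeomorphism.
Variables (R : realType) (n : nat) (A : 'M[bool]_n) (m : nat) (B : 'M[bool]_m).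
Variables (V W : cstarAlgType R) (S : 'I_n -> V) (T : 'I_m -> W).
Hypotheses (SP : cuntz_krieger_family A S) (TP : cuntz_krieger_family B T).
Hypotheses (SQ : forall (x : sft A) k, Qx S x k != 0)
  (TQ : forall (y : sft B) k, Qx T y k != 0).
Variables (psi : {lrmorphism V -> W}) (phi : {lrmorphism W -> V}).
Hypotheses (phiK : cancel psi phi).
Variables (hV : sft B -> sft A) (h : sft A -> sft B).
Hypotheses (hVP : forall y k, below T y (psi (Qx S (hV y) k)))
  (hP : forall x k, below S x (phi (Qx T (h x) k))).

Lemma state_map_continuous : continuous hV.
Proof.
apply/continuous_agreeP => y k; have [N NP] := hVP y k; exists N => y' yy'.
apply: (below_agree SP TP TQ (leqnn k) (y := y') (psi := psi)) => //.
by exists N; rewrite -(Qx_agree T yy').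
Qed.

(** If [x] and [hV (h x)] had different prefixes, the images under [phi] of the
    projections near [h x] would meet two orthogonal projections near [x]. *)
Lemma state_map_cancel : cancel h hV.
Proof.
move=> x; apply: letterP => t; set y := h x.
suff H : agree t.+1 (hV y) x by exact: H.
have [N NP] := hVP y t.+1; have [M MP] := hP x N.
have /(congr1 phi) := NP; rewrite rmorphM /= phiK => E.
apply: contrapT => xx; move/eqP: (SQ x (M + t.+1)%N); apply.
rewrite -(below_level SP (leq_addr t.+1 M) MP) -/y -E -mulrA.
rewrite (below_level SP (leq_addr t.+1 M) MP).
rewrite -(Qx_le SP x (leq_addl M t.+1)) [LHS]mulrA (Qx_orthogonal SP) ?mul0r//.
Qed.

End DiagonalHomeomorphism.

(** * Coefficients of elements at pairs of points *)

Section Approximation.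
Variables (R : realType) (m : nat) (B : 'M[bool]_m) (W : cstarAlgType R).
Variable T : 'I_m -> W.
Hypotheses (rowsB : forall i, exists j, B i j) (TU : cuntz_krieger_algebra B T).
Local Notation Y := (sft B).
Local Notation shB := (@sft_shift m B).
Local Notation Sx := (@Sx R m B W T).
Local Notation Qx := (@Qx R m B W T).
Local Notation term := ((R[i] * W)%type).
Implicit Types (y z : Y) (q : term).

Let TP : cuntz_krieger_family B T. Proof. by case: TU. Qed.

(* [b] is a linear combination of elements that stand for sets of arrows, given
   with a common level [N]; it is examined near the arrows from a point [y'] to a
   point [y]. *)
Variables (r : seq term) (U : term -> set (sft_groupoid B)) (N : nat).
Hypothesis rN : forall q y, q \in r -> acts_locally T (U q) q.2 y N.
Let b := \sum_(q <- r) q.1 *: q.2.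

(** The term [q] contains the germ that carries [y'] to [y], with [M+1] letters
    replacing [N+1] letters. *)
Definition active y y' q M := acts_at T (U q) q.2 y' N y M.

Lemma active_level y y' q M t K : active y y' q M -> (K <= (M + t).+1)%N ->
  Qx y K * q.2 * Qx y' (N + t).+1 = Sx y (M + t).+1 * star (Sx y' (N + t).+1).
Proof.
move=> /(acts_at_add TP t)[_ H] KM; rewrite -mulrA H mulrA; congr (_ * _).
by rewrite -(subnKC KM) Qx_Sx.
Qed.

(** A term without germ from [y'] to [y] sends small cylinders at [y'] to zero or to
    cylinders that avoid [y]. *)
Lemma inactive_level y y' q : q \in r -> ~ (exists M, active y y' q M) ->
  exists K, forall t, (K <= t)%N -> Qx y K * q.2 * Qx y' (N + t).+1 = 0.
Proof.
move=> qr na; have [[_ H]|[z [M H]]] := rN y' qr.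
  exists 0%N => t _; rewrite -(Qx_le TP y' (_ : N.+1 <= (N + t).+1)%N) ?ltnS ?leq_addr//.
  by rewrite -mulrA [q.2 * (_ * _)]mulrA H mul0r mulr0.
have [K nK] : exists K, ~ agree K y z.
  apply: contrapT => nK; apply: na; exists M.
  suff -> : y = z by [].
  apply: letterP => t; apply: contrapT => yz; apply: nK; exists t.+1 => H'.
  exact/yz/H'.
exists K => t Kt; have [_ {}H] := acts_at_add TP t H.
rewrite -mulrA H mulrA /Qx -[Sx y K * star _ * _]mulrA Sx_orthogonal_le ?mulr0 ?mul0r//.
by apply: leq_trans Kt _; rewrite -addnS; lia.
Qed.

(** On small cylinders only the active terms of [b] survive. *)
Lemma cut_to_active y y' (a : term -> bool) (M : term -> nat) :
  (forall q, q \in r -> a q -> active y y' q (M q)) ->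
  (forall q, q \in r -> ~~ a q -> ~ exists M, active y y' q M) ->
  exists K t, Qx y K * b * Qx y' (N + t).+1 =
    \sum_(q <- r | a q) q.1 *: (Sx y (M q + t).+1 * star (Sx y' (N + t).+1)).
Proof.
move=> act inact.
have H q : exists K, q \in r -> ~~ a q -> forall t, (K <= t)%N ->
    Qx y K * q.2 * Qx y' (N + t).+1 = 0.
  have [[qr na]|H] := pselect (q \in r /\ ~~ a q).
    by have [K KP] := inactive_level qr (inact q qr na); exists K.
  by exists 0%N => qr na; exfalso; apply: H.
have [K KP] := choice H; pose L := (\max_(q <- r) K q)%N.
exists L, L; rewrite /b mulr_sumr mulr_suml [RHS]big_mkcond.
rewrite big_seq [RHS]big_seq; apply: eq_bigr => q qr; rewrite -scalerAr -scalerAl.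
have [aq|naq] := boolP (a q).
  by rewrite (active_level (act q qr aq))// -addnS; lia.
have KL : (K q <= L)%N by exact: leq_bigmax_seq.
have := KP q qr naq L KL; rewrite -(Qx_ler TP y KL) => E.
by rewrite -[_ * _ * q.2]mulrA -[_ * _ * Qx y' _]mulrA E mulr0 scaler0.
Qed.

Lemma active_unique y y' q M z' y'' M' : active y y' q M -> active y'' z' q M' ->
  agree N.+1 y' z' -> M = M' /\ agree M.+1 y y''.
Proof.
move=> [[yy H] _] [H' _] yz; have [g [Ug gr gd gs]] := arrows_at_arrow H'.
have [|gd' _ yg] := (H g _).1 Ug; first by rewrite gs.
by rewrite gr in yg; split=> //; rewrite gd' in gd; lia.
Qed.

(** The term stays active with the same numbers of letters as long as the points
    merge accordingly. *)
Lemma active_stable y y' q M yt yt' : active y y' q M ->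
  agree M.+1 y yt -> agree N.+1 y' yt' -> iter M shB yt = iter N shB yt' ->
  active yt yt' q M.
Proof.
move=> H yyt yyt' E; have [z [yz Hz]] : exists z, agree M.+1 y z /\ active z yt' q M.
  have [H1 H2] := H; have [z [yz Hz]] := arrows_at_agree yyt' H1.
  exists z; split=> //; split=> //.
  by rewrite -(Qx_agree T yyt') -(Sx_agree T yyt') -(Sx_agree T yz).
suff <- : z = yt by [].
apply: (@eq_glue _ _ M); last by rewrite Hz.1.1 E.
by apply: agree_le (leqnSn M) _; apply: agree_trans (agree_sym yz) yyt.
Qed.

Lemma inactive_stable y y' q : q \in r -> ~ (exists M, active y y' q M) ->
  exists K, forall yt yt', agree K y yt -> agree K y' yt' ->
    ~ exists M, active yt yt' q M.
Proof.
move=> qr na; have [[no _]|[z [M H]]] := rN y' qr.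
  exists N.+1 => yt yt' _ yyt' [M [H _]].
  by have [g [Ug _ _ gs]] := arrows_at_arrow H; apply: no Ug; rewrite gs.
have [K nK] : exists K, ~ agree K z y.
  apply: contrapT => nK; apply: na; exists M.
  suff -> : y = z by [].
  apply: letterP => t; apply: contrapT => yz; apply: nK; exists t.+1 => H'.
  by apply/yz/esym/H'.
exists (K + N.+1)%N => yt yt' yyt yyt' [M' H'].
have yy' : agree N.+1 y' yt' by apply: agree_le yyt'; lia.
have [ME zyt] := active_unique (H : active z y' q M) H' yy'; apply: nK.
apply: (@agree_trans _ _ _ yt); last by apply: agree_sym; apply: agree_le yyt; lia.
apply: (@agree_le _ _ (K + M)); first by lia.
apply: agree_glue; first by apply: agree_le zyt.
rewrite H.1.1 ME H'.1.1; apply: agree_iter; apply: agree_le yyt'; lia.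
Qed.

Lemma conj_mul_self (c : R[i]) : c^*%C * c = ((complex.Re `|c|) ^+ 2)%:C%C.
Proof.
case: c => u v; rewrite normc_def /= sqr_sqrtr ?addr_ge0 ?sqr_ge0//.
by apply/eqP; rewrite eq_complex /=; apply/andP; split; apply/eqP; ring.
Qed.

(** The sum of the coefficients of the terms whose germ has the lag of [k]. *)
Definition coefficient (a : term -> bool) (M : term -> nat) k : R[i] :=
  \sum_(q <- r | a q && (M q == k)) q.1.

(** Elements of different degrees are orthogonal on average over the gauge
    action, so the coefficients of [b] at one pair of points are bounded in the
    mean square by the norm of [b]. *)
Lemma coefficient_bound y y' (a : term -> bool) (M : term -> nat) k1 k2 :
  (forall k, Qx y' k != 0) ->
  (forall q, q \in r -> a q -> active y y' q (M q)) ->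
  (forall q, q \in r -> ~~ a q -> ~ exists M, active y y' q M) ->
  k1 <> k2 ->
  (complex.Re `|coefficient a M k1|) ^+ 2 + (complex.Re `|coefficient a M k2|) ^+ 2
    <= cnorm b ^+ 2.
Proof.
move=> Qnz act inact k12; have [K [t E]] := cut_to_active act inact.
set beta := Qx y K * b * Qx y' (N + t).+1 in E.
pose c := coefficient a M.
(* [D] exceeds all the numbers of letters in question *)
pose D := (\max_(q <- r) M q + k1 + k2).+1.
pose u k := Sx y (k + t).+1 * star (Sx y' (N + t).+1).
have betaE : beta = \sum_(k < D) c k *: u k.
  have -> : beta = \sum_(q <- r | a q) \sum_(k < D | M q == k) q.1 *: u k.
    rewrite E big_seq_cond [RHS]big_seq_cond; apply: eq_bigr => q /andP[qr _].
    have qD : (M q < D)%N.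
      by rewrite /D ltnS -addnA; apply: leq_trans (leq_addr _ _); exact: leq_bigmax_seq.
    by rewrite (big_pred1 (Ordinal qD)).
  rewrite (exchange_big_dep xpredT)//=; apply: eq_bigr => k _.
  by rewrite /c /coefficient scaler_suml.
have uu k k' : homogeneous T k k' (star (u k) * u k').
  move=> z gam zg; have [z1 gs _] := zg; have gS x l := gauge_Sx x l zg.
  have ug l : gam (u l) = (z ^+ (l + t).+1 * z^*%C ^+ (N + t).+1) *: u l.
    by rewrite rmorphM /= gs !gS starZ rmorphXn -scalerAl -scalerAr scalerA.
  rewrite rmorphM /= gs !ug starZ -scalerAl -scalerAr scalerA.
  congr (_ *: _).
  have zz l : z^*%C ^+ l * z ^+ l = 1 by rewrite -exprMn mulrC z1 expr1n.
  rewrite rmorphM !rmorphXn /= conjcK.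
  have -> : ((k + t).+1 = k + t.+1)%N by rewrite addnS.
  have -> : ((k' + t).+1 = k' + t.+1)%N by rewrite addnS.
  rewrite !exprD; have := zz t.+1; have := zz (N + t).+1.
  move: (z ^+ t.+1) (z^*%C ^+ t.+1) (z ^+ (N + t).+1) (z^*%C ^+ (N + t).+1).
  move: (z^*%C ^+ k) (z ^+ k') => a1 a2 b1 b2 d1 d2 hd hb.
  transitivity (a1 * a2 * (b2 * b1) * (d2 * d1)); first by ring.
  by rewrite hd hb !mulr1.
have usu (k : nat) : star (c k *: u k) * (c k *: u k) =
    (complex.Re `|c k| ^+ 2)%:C%C *: Qx y' (N + t).+1.
  rewrite starZ -scalerAl -scalerAr scalerA conj_mul_self.
  have [->|ck] := eqVneq (c k) 0; first by rewrite normr0 expr0n /= scale0r scale0r.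
  have [q [qr aq /eqP Mq]] : exists q, [/\ q \in r, a q & M q == k].
    apply: contrapT => no; move/eqP: ck; apply.
    rewrite /c /coefficient big_seq_cond big1// => q /and3P[qr aq Mq].
    by exfalso; apply: no; exists q.
  congr (_ *: _); have [[yy _] _] := act q qr aq; rewrite Mq in yy.
  have yt : letter y (k + t) = letter y' (N + t) by rewrite ![(_ + t)%N]addnC; exact: letter_eq_iter.
  rewrite /u starM starK -mulrA [star _ * (_ * _)]mulrA Sx_source// yt -Sx_source//.
  by rewrite !mulrA Sx_partial.
(* averaging removes the mixed products of [star beta * beta] *)
have [F [FD FZ FN F1 F0]] : exists F : W -> W, [/\ {morph F : v w / v + w},
    forall a v, F (a *: v) = a *: F v, forall v, cnorm (F v) <= cnorm v,
    forall M v, homogeneous T M M v -> F v = v &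
    forall M M' v, homogeneous T M M' v -> ((M - M') + (M' - M))%N \in iota 1 D -> F v = 0].
  by apply: (gauge_average TU) => // d; rewrite mem_iota => /andP[].
have Fs I (s : seq I) (P : pred I) G : F (\sum_(i <- s | P i) G i) = \sum_(i <- s | P i) F (G i).
  by apply: (big_morph F FD); rewrite -(scale0r (0 : W)) FZ !scale0r.
have Fb : F (star beta * beta) =
    (\sum_(k < D) complex.Re `|c k| ^+ 2)%:C%C *: Qx y' (N + t).+1.
  rewrite betaE star_sum mulr_suml Fs rmorph_sum scaler_suml; apply: eq_bigr => k _.
  rewrite mulr_sumr Fs (bigD1 k)//= usu FZ (F1 0%N) ?big1 ?addr0//.
    move=> k' kk'; rewrite starZ -scalerAl -scalerAr !FZ.
    rewrite (F0 k k')// ?scaler0//.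
    have /eqP : val k' <> val k by move/val_inj/eqP; apply/negP.
    by rewrite mem_iota /= => ?; have := ltn_ord k; have := ltn_ord k'; lia.
  move=> z gam zg; have [z1 gs _] := zg; have gS := gauge_Sx _ _ zg.
  rewrite rmorphM /= gs !gS starZ -scalerAl -scalerAr scalerA !mulr1 rmorphXn /=.
  by rewrite -exprMn z1 expr1n.
have k1D : (k1 < D)%N by rewrite /D; lia.
have k2D : (k2 < D)%N by rewrite /D; lia.
have Qn := projection_norm1 (Qx_projection TP y' (N + t).+1) (Qnz _).
have bb : cnorm beta <= cnorm b.
  exact: cnorm_compress (Qx_projection TP _ _) (Qx_projection TP _ _).
have c0 k : 0 <= complex.Re `|c k| ^+ 2 by exact: sqr_ge0.
have := FN (star beta * beta); rewrite Fb cnormZr Qn mulr1 cnorm_starM ger0_norm ?sumr_ge0//.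
have bb2 : cnorm beta ^+ 2 <= cnorm b ^+ 2 by rewrite ler_sqr ?nnegrE ?cnorm_ge0.
rewrite (bigD1 (Ordinal k1D))//= (bigD1 (Ordinal k2D))/=; last first.
  by apply/eqP => /(congr1 val) /= E'; apply: k12.
have : 0 <= \sum_(i < D | (i != Ordinal k1D) && (i != Ordinal k2D)) complex.Re `|c i| ^+ 2.
  exact: sumr_ge0.
rewrite /c; lra.
Qed.

End Approximation.

(** * The cocycle defined by an isomorphism of algebras *)

Section LocalCocycle.
Variables (R : realType) (n : nat) (A : 'M[bool]_n) (m : nat) (B : 'M[bool]_m).
Variables (V W : cstarAlgType R) (S : 'I_n -> V) (T : 'I_m -> W).
Hypotheses (rowsB : forall i, exists j, B i j).
Hypotheses (SP : cuntz_krieger_family A S) (TU : cuntz_krieger_algebra B T).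
Hypotheses (SQ : forall (x : sft A) k, Qx S x k != 0)
  (TQ : forall (y : sft B) k, Qx T y k != 0).
Variable psi : {lrmorphism V -> W}.
Hypotheses (psi_star : star_preserving psi) (psi_inj : injective psi).
Variable h : sft A -> sft B.
Hypotheses (h_inj : injective h) (h_continuous : continuous h).
Hypothesis hP : forall x K, exists k, Qx T (h x) K * psi (Qx S x k) = psi (Qx S x k).
Local Notation shA := (@sft_shift n A).
Local Notation shB := (@sft_shift m B).

Let TP : cuntz_krieger_family B T. Proof. by case: TU. Qed.

(** The image of the generator [S_i] is seen with norm one at each pair of points
    [h x], [h (shA x)] such that [x] starts with [i], however small the cylinders. *)
Lemma image_generator_corner x b (e : R) K K' :
  cnorm (psi (S (letter x 0)) - b) < e ->
  1 - e < cnorm (Qx T (h x) K * b * Qx T (h (shA x)) K').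
Proof.
move=> nb; have [k kP] := hP x K; have [k' kP'] := hP (shA x) K'.
pose l := (k + k').+1.
have P1 : Qx T (h x) K * psi (Qx S x l.+1) = psi (Qx S x l.+1).
  rewrite -(Qx_le SP x (_ : k <= l.+1)%N); last by rewrite /l; lia.
  by rewrite rmorphM /= mulrA kP.
have P2 : Qx T (h (shA x)) K' * psi (Qx S (shA x) l) = psi (Qx S (shA x) l).
  rewrite -(Qx_le SP (shA x) (_ : k' <= l)%N); last by rewrite /l; lia.
  by rewrite rmorphM /= mulrA kP'.
have pP (y : sft A) t : projection (psi (Qx S y t)).
  have [sQ QQ] := Qx_projection SP y t.
  by split; [rewrite -psi_star sQ|rewrite -rmorphM QQ].
have P2' : psi (Qx S (shA x) l) * Qx T (h (shA x)) K' = psi (Qx S (shA x) l).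
  have := congr1 (@Defs.star R W) P2.
  by rewrite starM (pP _ _).1 (Qx_projection TP _ _).1.
have P1' : psi (Qx S x l.+1) * Qx T (h x) K = psi (Qx S x l.+1).
  have := congr1 (@Defs.star R W) P1.
  by rewrite starM (pP _ _).1 (Qx_projection TP _ _).1.
set P := psi (Qx S x l.+1) in P1 P1'; set P' := psi (Qx S (shA x) l) in P2 P2'.
have sS : star (S (letter x 0)) * S (letter x 0) * Qx S (shA x) l = Qx S (shA x) l.
  rewrite /Qx mulrA (gen_source_Sx SP)// letter_shift; exact: letter_adm.
have QS : Qx S (shA x) l * (star (S (letter x 0)) * S (letter x 0)) = Qx S (shA x) l.
  have := congr1 (@Defs.star R V) sS.
  by rewrite starM (Qx_projection SP _ _).1 starM starK.
have E : Qx S x l.+1 * S (letter x 0) * Qx S (shA x) l = S (letter x 0) * Qx S (shA x) l.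
  have -> : Qx S x l.+1 * S (letter x 0) =
      S (letter x 0) * (Qx S (shA x) l * (star (S (letter x 0)) * S (letter x 0))).
    by rewrite /Qx SxS starM !mulrA.
  by rewrite QS -[LHS]mulrA (Qx_projection SP _ _).2.
have n1 : cnorm (P * psi (S (letter x 0)) * P') = 1.
  rewrite -!rmorphM E; apply/eqP; rewrite -(@pexpr_eq1 _ _ 2) ?cnorm_ge0//.
  rewrite -cnorm_starM -psi_star -rmorphM starM (Qx_projection SP _ _).1.
  rewrite -mulrA [star _ * (_ * _)]mulrA sS (Qx_projection SP _ _).2.
  rewrite (projection_norm1 (pP _ _))// -(rmorph0 psi).
  by apply/eqP => /psi_inj/eqP; apply/negP; exact: SQ.
have b1 : cnorm (P * b * P') <= cnorm (Qx T (h x) K * b * Qx T (h (shA x)) K').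
  have -> : P * b * P' = P * (Qx T (h x) K * b * Qx T (h (shA x)) K') * P'.
    by rewrite -{1}P1' -{1}P2 !mulrA.
  exact: cnorm_compress (pP _ _) (pP _ _).
have n2 : cnorm (P * (psi (S (letter x 0)) - b) * P') <= cnorm (psi (S (letter x 0)) - b).
  exact: cnorm_compress (pP _ _) (pP _ _).
have := cnormD (P * (psi (S (letter x 0)) - b) * P') (P * b * P').
by rewrite -mulrDl -mulrDr subrK n1; lra.
Qed.

Local Notation term := ((R[i] * W)%type).

(** The image of the generator is close to a linear combination [b] of elements that
    stand for sets of arrows, and has norm one on all corners.  At each point near
    [x], other than [x], the terms of [b] that are active have the same lag, so the
    coefficient of that lag is close to one in modulus.  All these lags are active
    at [x] too, and by the mean square bound there can only be one of them. *)
Lemma local_cocycle x : exists L i j, forall x', agree L x x' ->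
  iter i shB (h (shA x')) = iter j shB (h x').
Proof.
have TS : cstar_generated (range T) = [set: W] by case: TU.
have e0 : (0 : R) < 10^-1 by rewrite invr_gt0.
(* with [b] within [1/10], coefficients are at least [9/10] and [cnorm b] is at most
   [11/10]; two lags would give [2 * (9/10)^2 > (11/10)^2] *)
have [b bs nb] := bisection_span_dense rowsB TP (psi (S (letter x 0))) TS e0.
have b11 : cnorm b ^+ 2 <= (11 / 10) ^+ 2.
  have h11 : (0 : R) <= 11 / 10 by lra.
  rewrite ler_sqr ?nnegrE ?cnorm_ge0//.
  have := star_morphism_contractive psi_star (S (letter x 0)).
  have := cnorm_Sx_le1 SP x 1; rewrite Sx1.
  have := cnormB (psi (S (letter x 0))) (psi (S (letter x 0)) - b); rewrite subKr; lra.
have [r [U [N [rN bE]]]] := bisection_span_levels TP bs.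
pose y := h x; pose y' := h (shA x).
pose act := active T U N.
pose a q := `[< exists M, act y y' q M >].
have /choice[M MP] q : exists M, a q -> act y y' q M.
  by have [/asboolP[M H]|] := boolP (a q); [exists M|exists 0%N].
(* near [x] no term becomes active unless it is active at [x] *)
have /choice[K KP] q : exists K, q \in r -> ~~ a q ->
    forall yt yt', agree K y yt -> agree K y' yt' -> ~ exists M, act yt yt' q M.
  have [[qr na]|H] := pselect (q \in r /\ ~~ a q).
    by have [|K KP] := inactive_stable rN qr _ (y := y) (y' := y'); [move/asboolP: na|exists K].
  by exists 0%N => qr na; exfalso; apply: H.
pose Lev := (\max_(q <- r) K q + \max_(q <- r) M q + N).+1.
have KL q : q \in r -> (K q <= Lev)%N.
  move=> qr; have : (K q <= \max_(q <- r) K q)%N by exact: leq_bigmax_seq.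
  by rewrite /Lev; lia.
have ML q : q \in r -> (M q < Lev)%N.
  move=> qr; have : (M q <= \max_(q <- r) M q)%N by exact: leq_bigmax_seq.
  by rewrite /Lev; lia.
have [L [L0 hL hL']] : exists L, [/\ (0 < L)%N,
    forall x', agree L x x' -> agree Lev y (h x') &
    forall x', agree L x x' -> agree Lev y' (h (shA x'))].
  have /continuous_agreeP hc := h_continuous.
  have [L1 H1] := hc x Lev; have [L2 H2] := hc (shA x) Lev.
  exists (L1 + L2).+1; split=> // x' xx'; first by apply: H1; apply: agree_le xx'; lia.
  by apply: H2; apply: agree_shift; apply: agree_le xx'; lia.
(* the terms active at [x'], with the same numbers of letters as at [x] *)
pose a' x' q := a q && `[< iter (M q) shB (h x') = iter N shB (h (shA x')) >].
have act' x' q : agree L x x' -> q \in r -> a' x' q -> act (h x') (h (shA x')) q (M q).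
  move=> xx' qr /andP[aq /asboolP E]; apply: (active_stable (MP q aq)) => //.
    by apply: agree_le (hL _ xx'); exact: ML.
  by apply: agree_le (hL' _ xx'); rewrite /Lev; lia.
have inact' x' q : agree L x x' -> q \in r -> ~~ a' x' q ->
    ~ exists M, act (h x') (h (shA x')) q M.
  move=> xx' qr; rewrite negb_and => /orP[na|/asboolP nE].
    apply: KP => //; first by apply: agree_le (hL _ xx'); exact: KL.
    by apply: agree_le (hL' _ xx'); exact: KL.
  move=> [M' H]; have [aq|na] := boolP (a q); last first.
    apply: (KP q qr na _ _ _ _ (ex_intro _ M' H)).
      by apply: agree_le (hL _ xx'); exact: KL.
    by apply: agree_le (hL' _ xx'); exact: KL.
  have [|ME _] := active_unique (MP q aq) H.
    by apply: agree_le (hL' _ xx'); rewrite /Lev; lia.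
  by apply: nE; rewrite ME; case: H => -[].
have cut x' : agree L x x' -> exists t,
    9/10 < cnorm (\sum_(q <- r | a' x' q)
      q.1 *: (Sx T (h x') (M q + t).+1 * star (Sx T (h (shA x')) (N + t).+1))).
  move=> xx'.
  have [K' [t E]] := cut_to_active TU rN (fun q => @act' x' q xx') (fun q => @inact' x' q xx').
  exists t; rewrite -E -bE.
  have lx : letter x 0 = letter x' 0 by exact: xx'.
  rewrite lx in nb; have := image_generator_corner K' (N + t).+1 nb; lra.
have some_active x' : agree L x x' -> exists q, [/\ q \in r, a q &
    iter (M q) shB (h x') = iter N shB (h (shA x'))].
  move=> /cut[t] H; apply: contrapT => no; move: H.
  rewrite big_seq_cond big1; first by rewrite cnorm0; lra.
  by move=> q /and3P[qr aq /asboolP E]; exfalso; apply: no; exists q.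
(* two numbers of letters active at [x] and at [x'] would make [h x] and [h x']
   solutions of one periodicity equation *)
have lag x' : agree L x x' -> x' <> x -> exists k, 
    iter k shB (h x') = iter N shB (h (shA x')) /\
    9/10 < complex.Re `|coefficient r a M k|.
  move=> xx' nx; have [q0 [q0r aq0 E0]] := some_active _ xx'; exists (M q0); split=> //.
  have [t] := cut _ xx'; set k := M q0.
  have a'E q : q \in r -> a' x' q = a q && (M q == k).
    move=> qr; rewrite /a'; have [aq|//] := boolP (a q) => /=.
    apply/asboolP/eqP => [E|->//].
    have Ey : iter (M q) shB y = iter k shB y by rewrite (MP q aq).1.1 (MP q0 aq0).1.1.
    have Ex : iter (M q) shB (h x') = iter k shB (h x') by rewrite E E0.
    have Lk := ML q0 q0r; have Lq := ML q qr; rewrite -/k in Lk.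
    have [lt|lt|//] := ltngtP (M q) k; exfalso; apply: nx; apply: h_inj; apply/esym.
      apply: (eventually_periodic_unique lt) => //; apply: agree_le (hL _ xx'); lia.
    apply: (eventually_periodic_unique lt) => //; apply: agree_le (hL _ xx'); lia.
  have -> : \sum_(q <- r | a' x' q)
      q.1 *: (Sx T (h x') (M q + t).+1 * star (Sx T (h (shA x')) (N + t).+1)) =
    coefficient r a M k *: (Sx T (h x') (k + t).+1 * star (Sx T (h (shA x')) (N + t).+1)).
    rewrite /coefficient scaler_suml big_seq_cond [RHS]big_seq_cond; apply: eq_big => q.
      by have [qr|//] := boolP (q \in r); rewrite /= a'E.
    by move=> /andP[qr]; rewrite a'E// => /andP[_ /eqP->].
  move=> H; apply: lt_le_trans H _.
  rewrite cnormZ; apply: ler_piMr; first by rewrite normc_def sqrtr_ge0.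
  apply: le_trans (cnormM _ _) _; rewrite cnorm_star.
  by apply: mulr_ile1; rewrite ?cnorm_ge0 ?(cnorm_Sx_le1 TP).
have [[x1 [xx1 nx1]]|alone] := pselect (exists x', agree L x x' /\ x' <> x); last first.
  have [q [_ _ E]] := some_active x (@agree_refl _ _ _ _).
  exists L, N, (M q) => x' xx'; suff -> : x' = x by [].
  by apply: contrapT => nx; apply: alone; exists x'.
have [k [_ ck]] := lag _ xx1 nx1; exists L, N, k => x' xx'.
have [->|nx] := pselect (x' = x).
  have [q [qr aq /eqP Mq]] : exists q, [/\ q \in r, a q & M q == k].
    apply: contrapT => no; move: ck; rewrite /coefficient big_seq_cond big1.
      by rewrite normr0 /=; lra.
    by move=> q /and3P[qr aq Mq]; exfalso; apply: no; exists q.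
  by rewrite -Mq (MP q aq).1.1.
have [k' [<- ck']] := lag _ xx' nx; suff -> : k = k' by [].
apply: contrapT => kk.
have inact q : q \in r -> ~~ a q -> ~ exists M, act y y' q M by move=> _ /asboolP.
have := coefficient_bound TU rN (TQ y') (fun q _ => MP q) inact kk.
rewrite -bE => H; have c1 : (9 / 10) ^+ 2 < complex.Re `|coefficient r a M k| ^+ 2.
  by rewrite ltr_pXn2r// ?nnegrE; lra.
have c2 : (9 / 10) ^+ 2 < complex.Re `|coefficient r a M k'| ^+ 2.
  by rewrite ltr_pXn2r// ?nnegrE; lra.
by clear TS; lra.
Qed.

(** Locally constant lags make up continuous functions. *)
Lemma continuous_cocycle : exists k l : sft A -> nat, [/\ continuous k, continuous l &
  forall x, iter (k x) shB (h (shA x)) = iter (l x) shB (h x)].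
Proof.
have [x|c [cP cc]] := @locally_constant_choice _ A (nat * nat)%type (0%N, 0%N)
  (fun x c => iter c.1 shB (h (shA x)) = iter c.2 shB (h x)).
  by have [L [i [j H]]] := local_cocycle x; exists L, (i, j).
exists (fun x => (c x).1), (fun x => (c x).2); split=> //; apply/continuous_natP => x.
  by have [M MP] := cc x; exists M => z /MP->.
by have [M MP] := cc x; exists M => z /MP->.
Qed.

End LocalCocycle.

(** * The three equivalent conditions *)

(** The universal property of the target provides the inverse. *)
Lemma inverse_star_morphism (R : realType) m (B : 'M[bool]_m) (V W : cstarAlgType R)
    (T : 'I_m -> W) (psi : {lrmorphism V -> W}) :
  cuntz_krieger_algebra B T -> bijective psi -> star_preserving psi ->
  exists phi : {lrmorphism W -> V}, [/\ star_preserving phi, cancel psi phi & cancel phi psi].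
Proof.
move=> [[Tp T1 TT] Tgen Tuniv] [g gK Kg] psis.
have inj := can_inj gK; have gs w : g (star w) = star (g w).
  by apply: inj; rewrite psis !Kg.
have gTP : cuntz_krieger_family B (g \o T).
  split=> [i||i] /=.
  - by apply: inj; rewrite !rmorphM /= -gs !Kg; exact: Tp.
  - apply: inj; rewrite rmorph_sum rmorph1 -T1; apply: eq_bigr => j _.
    by rewrite rmorphM /= -gs !Kg.
  apply: inj; rewrite rmorphM rmorph_sum /= -gs !Kg TT; apply: eq_bigr => j _.
  by rewrite linearZ /= rmorphM /= -gs !Kg.
have [phi phis phiT] := Tuniv _ _ gTP.
have psi_phi : cancel phi psi.
  move=> x; apply: (generated_morphism_id (psi := psi \o phi) _ Tgen) => [v|i] /=.
    by rewrite phis psis.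
  by rewrite phiT Kg.
by exists phi; split=> // v; apply: inj; rewrite psi_phi.
Qed.

(** Each diagonal is the algebra of continuous functions on its shift space, so a
    diagonal preserving isomorphism comes with a homeomorphism of shift spaces; the
    image of the generators carries the lags of the orbit equivalence. *)
Lemma orbit_equivalent_of_diagonal_isomorphic (R : realType) n (A : 'M[bool]_n)
    m (B : 'M[bool]_m) (OA OB : cstarAlgType R) (S : 'I_n -> OA) (T : 'I_m -> OB) :
  (forall i, exists j, A i j) -> (forall i, exists j, B i j) ->
  cuntz_krieger_algebra A S -> cuntz_krieger_algebra B T ->
  diagonal_preserving_isomorphic S T ->
  continuously_orbit_equivalent (@sft_shift n A) (@sft_shift m B).
Proof.
move=> rA rB SU TU [psi [psib psis psiD]].
have [phi [phis psiK phiK]] := inverse_star_morphism TU psib psis.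
have [SP _ _] := SU; have [TP _ _] := TU.
have SQ (x : sft A) k := universal_Qx_neq0 x k SU.
have TQ (y : sft B) k := universal_Qx_neq0 y k TU.
have psi_diag : psi @` cuntz_krieger_diagonal S `<=` cuntz_krieger_diagonal T by rewrite psiD.
have phi_diag : phi @` cuntz_krieger_diagonal T `<=` cuntz_krieger_diagonal S.
  by move=> _ [w + <-]; rewrite -psiD => -[v Dv <-]; rewrite psiK.
have /choice[hV hVP] := state_map_exists rA rB SP TP TQ psis psi_diag.
have /choice[h hP] := state_map_exists rB rA TP SP SQ phis phi_diag.
have hK := state_map_cancel SP SQ psiK hVP hP.
have hVK := state_map_cancel TP TQ phiK hP hVP.
have hVc := state_map_continuous SP TP TQ hVP.
have hc := state_map_continuous TP SP SQ hP.
exists h, hV; split; first by split.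
- apply: (continuous_cocycle rB SP TU SQ TQ psis (can_inj psiK) (can_inj hK) hc) => x K.
  have [N /(congr1 psi)] := hP x K; rewrite rmorphM /= phiK => E; by exists N.
- apply: (continuous_cocycle rA TP SU TQ SQ phis (can_inj phiK) (can_inj hVK) hVc) => y K.
  have [N /(congr1 phi)] := hVP y K; rewrite rmorphM /= psiK => E; by exists N.
Qed.

Theorem corollary7p1 (R : realType) (n m : nat)
    (A : 'M[bool]_n) (B : 'M[bool]_m)
    (hA : nonzero_rows_cols A) (hB : nonzero_rows_cols B) :
  (continuously_orbit_equivalent (@sft_shift n A) (@sft_shift m B) <->
     isomorphic_groupoids A B) /\
  (forall (OA OB : cstarAlgType R) (S : 'I_n -> OA) (T : 'I_m -> OB),
     cuntz_krieger_algebra A S -> cuntz_krieger_algebra B T ->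
     (isomorphic_groupoids A B <-> diagonal_preserving_isomorphic S T)).
Proof.
split.
  by split; [exact: isomorphic_of_orbit_equivalent|exact: orbit_equivalent_of_isomorphic].
move=> OA OB S T SU TU; split.
  exact: diagonal_isomorphic_of_isomorphic hA.1 hB.1 SU TU.
move/(orbit_equivalent_of_diagonal_isomorphic hA.1 hB.1 SU TU).
exact: isomorphic_of_orbit_equivalent.
Qed.
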